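(* Let $A=\bigoplus_{i=1}^kM_{n_i}(\mathbb{C})$, with $n_1,\ldots,n_k$ positive integers. The set of density matrices $\mathbb{D}(A)$ is a closed semialgebraic subset of $A^{\mathrm{sa}}$. In particular, $\mathbb{D}(A)$ admits a semialgebraic Whitney stratification.
   Context: Set $n=n_1+\ldots+n_k$; $A$ is regarded as the subalgebra of $M_n(\mathbb{C})$ of block diagonal matrices with blocks of size $n_1,\ldots,n_k$. $A^{\mathrm{sa}}$ is the real vector space of Hermitian elements of $A$. $\mathbb{D}(A)$ is the set of density matrices: elements $\rho\in A$ that are positive (semidefinite Hermitian) with trace $1$. A subset of $\mathbb{R}^N$ (or of a finite-dimensional real vector space, via a linear isomorphism with $\mathbb{R}^N$) is semialgebraic if it is a finite union of subsets each defined by finitely many polynomial equations and/or inequalities. An $I$-decomposition of a topological space $X$ ($I$ a set) is a locally finite collection of disjoint locally closed subsets $S_i\subset X$, $i\in I$, with $X=\bigcup_{i\in I}S_i$ and such that $S_i\cap\overline{S}_j\ne\emptyset$ implies $S_i\subset\overline{S}_j$. One writes $i\le j$ iff $S_i\subset\overline{S}_j$. Let $X$ be a closed subset of a smooth manifold $M$. An $I$-decomposition of $X$ is a Whitney stratification if each $S_i$ is a smooth embedded submanifold of $M$ (without boundary) and, for all $i\le j$, Whitney's condition (B) holds: if $(x_k)$ is a sequence in $S_j$ and $(y_k)$ a sequence in $S_i$, both converging to some $y\in S_i$, $\ell_k$ is the line through $x_k$ and $y_k$ in some local chart on $M$, $(\ell_k)$ converges to a limiting line $\ell$ and the tangent spaces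 $T_{x_k}S_j$ converge to a limiting space $\tau$ in the Grassmann bundle of $TM$, then $\ell\subset\tau$. Here $M=A^{\mathrm{sa}}$. The stratification is called semialgebraic if its strata $S_i$ are semialgebraic sets. *)

(* Defs.v *)
From HB Require Import structures.
From mathcomp Require Import all_boot all_order all_algebra.
From mathcomp Require Import sesquilinear spectral.
From mathcomp Require Import complex.
From mathcomp Require Import -(notations) mpoly.
From mathcomp Require Import all_classical all_reals all_analysis.

Set Implicit Arguments.
Unset Strict Implicit.
Unset Printing Implicit Defensive.

Import Order.TTheory GRing.Theory Num.Theory.
Import numFieldNormedType.Exports.

Local Open Scope classical_set_scope.
Local Open Scope complex_scope.
Local Open Scope sesquilinear_scope.
Local Open Scope ring_scope.

(** * Block-diagonal matrices, their Hermitian part, density matrices *)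

Section BlockAlgebra.
Variables (R : realType) (k : nat) (n_ : 'I_k -> nat).

(* The direct sum of the algebras of complex [n_ i]-by-[n_ i] matrices, as a
   subalgebra of the square matrices of size [\sum_i n_ i]. *)
Definition blockalg : {pred 'M[R[i]]_(\sum_i n_ i)} :=
  [pred M | M == \mxdiag_i submxblock M i i].

Definition samx : {pred 'M[R[i]]_(\sum_i n_ i)} :=
  [pred M | (M \in blockalg) && (M \is hermsymmx)].

Record sa := Sa { sa_val :> 'M[R[i]]_(\sum_i n_ i); sa_valP : sa_val \in samx }.

HB.instance Definition _ := [isSub for sa_val].
HB.instance Definition _ := [Choice of sa by <:].

Lemma samxP (M : 'M[R[i]]_(\sum_i n_ i)) :
  reflect (M = \mxdiag_i submxblock M i i /\ M ^t* = M) (M \in samx).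
Proof.
apply: (iffP andP) => [[/eqP ? ]|[e1 e2]].
  by rewrite qualifE /= expr0 scale1r => /eqP e; split=> //; rewrite -e.
split; first exact/eqP.
by rewrite qualifE /= expr0 scale1r e2.
Qed.

Lemma samx_zmod_closed : zmod_closed samx.
Proof.
split=> [|A B /samxP[A1 A2] /samxP[B1 B2]]; apply/samxP.
  split; last by rewrite trmx0 map_mx0.
  rewrite -[LHS]mxdiag0; apply: eq_mxdiag => i.
  by apply/matrixP => a b; rewrite !mxE.
split; last by rewrite raddfB/= map_mxB A2 B2.
rewrite {1}A1 {1}B1 -mxdiagB; apply: eq_mxdiag => i.
by apply/matrixP => a b; rewrite !mxE.
Qed.

HB.instance Definition _ := GRing.isZmodClosed.Build _ samx samx_zmod_closed.
HB.instance Definition _ := [SubChoice_isSubZmodule of sa by <:].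

Lemma sa_scale_subproof (a : R) (x : sa) : a%:C *: sa_val x \in samx.
Proof.
have /samxP[x1 x2] := sa_valP x; apply/samxP; split.
  have subZ (c : R[i]) (M : 'M[R[i]]_(\sum_i n_ i)) i j :
      submxblock (c *: M) i j = c *: submxblock M i j.
    by apply/matrixP => p q; rewrite !mxE.
  rewrite {1}x1; apply/mxblockP => i j; rewrite subZ !mxblockK.
  have [<-|_] := eqVneq i j; last by rewrite scaler0.
  by rewrite !conform_mx_id subZ.
rewrite linearZ/= map_mxZ x2; congr (_ *: _).
by apply/eqP; rewrite eq_complex /= oppr0 !eqxx.
Qed.

Definition sa_scale (a : R) (x : sa) : sa := Sa (sa_scale_subproof a x).

Fact sa_scaleA a b x : sa_scale a (sa_scale b x) = sa_scale (a * b) x.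
Proof. by apply: val_inj; rewrite /= scalerA rmorphM. Qed.
Fact sa_scale1 : left_id 1 sa_scale.
Proof. by move=> x; apply: val_inj; rewrite /= scale1r. Qed.
Fact sa_scaleDr : right_distributive sa_scale +%R.
Proof. by move=> a x y; apply: val_inj; rewrite /= scalerDr. Qed.
Fact sa_scaleDl x : {morph sa_scale^~ x : a b / a + b}.
Proof. by move=> a b; apply: val_inj; rewrite /= rmorphD scalerDl. Qed.

HB.instance Definition _ := GRing.Zmodule_isLmodule.Build R sa
  sa_scaleA sa_scale1 sa_scaleDr sa_scaleDl.

(* The norm of [sa] is the sup norm of matrices; the latter is a complex number
   that is real and nonnegative, whence the real part. *)
Definition sa_norm (x : sa) : R := complex.Re `|sa_val x|.

Lemma sa_normE x : (sa_norm x)%:C = `|sa_val x|.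
Proof. by rewrite /sa_norm RRe_real// normr_real. Qed.

Fact sa_normD x y : sa_norm (x + y) <= sa_norm x + sa_norm y.
Proof. by rewrite -lecR rmorphD/= !sa_normE ler_normD. Qed.
Fact sa_normZ a x : sa_norm (a *: x) = `|a| * sa_norm x.
Proof.
apply: (@complexI R); rewrite rmorphM/= !sa_normE normrZ; congr (_ * _).
by rewrite normc_def/= expr0n addr0 sqrtr_sqr.
Qed.
Fact sa_norm0_eq0 x : sa_norm x = 0 -> x = 0.
Proof.
move=> x0; apply: val_inj; apply/eqP; rewrite /= -normr_eq0 -sa_normE x0.
by rewrite rmorph0.
Qed.

HB.instance Definition _ := Lmodule_isNormed.Build R sa
  sa_normD sa_normZ sa_norm0_eq0.

End BlockAlgebra.

(* On [R[i]], [0 <= z] means that [z] is real and nonnegative. *)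
Definition psdmx (R : realType) (m : nat) (M : 'M[R[i]]_m) : Prop :=
  M \is hermsymmx /\ forall u : 'cV[R[i]]_m, 0 <= (u ^t* *m M *m u) 0 0.

Definition density (R : realType) (k : nat) (n_ : 'I_k -> nat) :
    set (sa R n_) :=
  [set rho | psdmx (sa_val rho) /\ \tr (sa_val rho) = 1].
Arguments density R {k} n_.

(** * Semialgebraic sets *)

Section Semialgebraic.
Variable R : realType.

(* A triple [(ps, qs, rs)] encodes the conditions [p = 0] for [p] in [ps],
   [q >= 0] for [q] in [qs] and [r > 0] for [r] in [rs]. *)
Definition poly_conds (N : nat) : Type :=
  (seq (mpoly N R) * seq (mpoly N R) * seq (mpoly N R))%type.

Definition basic_semialg (N : nat) (c : poly_conds N) : set 'rV[R]_N :=
  [set x | [/\ forall p, p \in c.1.1 -> meval (x 0) p = 0,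
               forall q, q \in c.1.2 -> 0 <= meval (x 0) q
             & forall r, r \in c.2 -> 0 < meval (x 0) r]].

Definition semialg (N : nat) (X : set 'rV[R]_N) : Prop :=
  exists cs : seq (poly_conds N),
    X = \big[setU/set0]_(c <- cs) basic_semialg c.

Definition semialgebraic (V : lmodType R) (X : set V) : Prop :=
  exists (N : nat) (f : {linear V -> 'rV[R]_N}),
    bijective f /\ semialg (f @` X).

End Semialgebraic.

(** * Decompositions of topological spaces *)

(* [X] carries the subspace topology. As the pieces lie in [X], the frontier
   condition is the same for closures in [X] and closures in [T]. *)
Record decomposition (T : topologicalType) (X : set T) (I : Type)
    (S : I -> set T) : Prop := Decomposition {
  decomp_cover : \bigcup_i S i = X;
  decomp_disjoint : forall i j, i <> j -> S i `&` S j = set0;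
  decomp_locally_closed : forall i,
    exists U F : set T, [/\ open U, closed F & S i = X `&` U `&` F];
  decomp_locally_finite : forall x, X x ->
    exists2 U, nbhs x U & finite_set [set i | S i `&` U !=set0];
  decomp_frontier : forall i j,
    S i `&` closure (S j) !=set0 -> S i `<=` closure (S j)
}.

(** * Smooth maps and embedded submanifolds of a normed space *)

Section Smooth.
Variable R : realType.

(* Maps of class C^m on an open set [U], for a finite-dimensional domain. *)
Fixpoint Cm_on (V W : normedModType R) (m : nat) (U : set V) (f : V -> W) :
    Prop :=
  if m is m'.+1 then
    (forall x, U x -> differentiable f x) /\
    (forall v : V, Cm_on m' U (fun x => 'D_v f x))
  else forall x, U x -> {for x, continuous f}.

Definition smooth_on (V W : normedModType R) (U : set V) (f : V -> W) : Prop :=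
  forall m, Cm_on m U f.

Record diffeo_on (V W : normedModType R) (U : set V) (U' : set W)
    (f : V -> W) (g : W -> V) : Prop := DiffeoOn {
  diffeo_open : open U;
  diffeo_open' : open U';
  diffeo_smooth : smooth_on U f;
  diffeo_smooth' : smooth_on U' g;
  diffeoK : forall x, U x -> U' (f x) /\ g (f x) = x;
  diffeoK' : forall y, U' y -> U (g y) /\ f (g y) = y
}.

(* [R^d x {0}] in [R^N] *)
Definition flat (N d : nat) : set 'rV[R]_N :=
  [set y | forall j : 'I_N, (d <= j)%N -> y 0 j = 0].

Variable V : normedModType R.
Implicit Types (S : set V) (L : set V) (x y : V).

(* Existence of slice charts of [V] around the points of [S]. *)
Definition submanifold (d : nat) S : Prop :=
  forall x, S x ->
    exists (N : nat) (U : set V) (U' : set 'rV[R]_N)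
      (f : V -> 'rV[R]_N) (g : 'rV[R]_N -> V),
      [/\ (d <= N)%N, U x, diffeo_on U U' f g
        & f @` (U `&` S) = U' `&` flat d].

(* The velocities at [x] of the smooth curves drawn on [S]. *)
Definition tangent S x : set V :=
  [set v | exists (c : R -> V) (e : R),
    [/\ 0 < e, smooth_on (ball (0 : R) e) c,
        forall t, ball (0 : R) e t -> S (c t), c 0 = x & 'D_1 c 0 = v]].

(** * Grassmannians and Whitney's condition (B) *)

Definition frame (d : nat) : set {ptws 'I_d -> V} :=
  [set b | forall a : 'I_d -> R, \sum_i a i *: b i = 0 -> forall i, a i = 0].

Definition lspan (d : nat) (b : 'I_d -> V) : set V :=
  [set v | exists a : 'I_d -> R, v = \sum_i a i *: b i].

Definition grass (d : nat) : set (set V) := [set lspan b | b in @frame d].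

(* The quotient topology of [grass d], as the space of [d]-frames (which is
   open in [V^d] for [V] finite-dimensional) modulo equality of spans. *)
Definition grass_open (d : nat) (O : set (set V)) : Prop :=
  O `<=` grass d /\ open (@frame d `&` [set b | O (lspan b)]).

Definition grass_cvg (d : nat) (L : nat -> set V) (l : set V) : Prop :=
  grass d l /\
  forall O, grass_open d O -> O l -> \forall k \near \oo, O (L k).

(* The line through [x] and [y] (for [x <> y]), in the linear chart and
   translated to the origin: a point of [grass 1]. *)
Definition secant x y : set V := [set t *: (x - y) | t in [set: R]].

(* The Grassmann bundle of [V] is the product of [V] and of the
   Grassmannian. *)
Definition whitneyB (Si Sj : set V) : Prop :=
  forall (x y : nat -> V) (y0 : V) (d : nat) (l tau : set V),
    (forall k, Sj (x k)) -> (forall k, Si (y k)) -> Si y0 ->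
    x @ \oo --> y0 -> y @ \oo --> y0 -> (forall k, x k <> y k) ->
    grass_cvg 1 (fun k => secant (x k) (y k)) l ->
    grass_cvg d (fun k => tangent Sj (x k)) tau ->
    l `<=` tau.

Record whitney_stratification (X : set V) (I : Type) (S : I -> set V) :
    Prop := WhitneyStratification {
  whitney_closed : closed X;
  whitney_decomposition : decomposition X S;
  whitney_submanifold : forall i, exists d, submanifold d (S i);
  whitney_conditionB : forall i j, S i `<=` closure (S j) -> whitneyB (S i) (S j)
}.

Definition semialgebraic_whitney_stratification (X : set V) (I : Type)
    (S : I -> set V) : Prop :=
  whitney_stratification X S /\ forall i, semialgebraic (S i).

End Smooth.

(* Main.v *)
From HB Require Import structures.
From mathcomp Require Import all_boot all_order all_algebra.
From mathcomp Require Import perm sesquilinear spectral.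
From mathcomp Require Import complex.
From mathcomp Require Import -(notations) mpoly.
From mathcomp Require Import all_classical all_reals all_analysis.
Require Import Defs.
From mathcomp Require Import zify ring lra.
Set Implicit Arguments.
Unset Strict Implicit.
Unset Printing Implicit Defensive.
Import Order.TTheory GRing.Theory Num.Theory.
Import numFieldNormedType.Exports.
Local Open Scope classical_set_scope.
Local Open Scope complex_scope.
Local Open Scope sesquilinear_scope.
Local Open Scope ring_scope.

(** The strata are the sets of density matrices with prescribed block ranks.

    Each of them is an orbit. In every block, Sylvester's law of inertia takes a
    positive semidefinite matrix to any other one of the same rank by a congruence
    [psd_sylvester], so the invertible elements [g] of the block algebra act
    transitively on a stratum by congruence followed by normalization of the trace
    [act_transitive]. These maps are continuous and preserve all strata, whence the
    frontier condition [stratum_frontier].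

    The strata are semialgebraic and locally closed because positivity and rank of a
    Hermitian matrix [x] can be read off the coefficients of [det ('X + x)], which are
    real polynomials in the entries of [x]: the matrix is positive semidefinite iff
    they are nonnegative [char_poly_ge0_psd], and then the coefficient of ['X^l] is
    positive iff [n - \rank x <= l <= n] [psd_char_poly_gt0].

    For slice charts at [x], let [p] be the orthogonal projection onto the range of
    [x] and [q = 1 - p]. Block elimination along [p] makes [y] near [x] congruent to
    [p y p + (q y q - schur)], so the rank of [y] is that of [x] iff
    [q y q] equals the Schur term, a rational function of the other corners of [y]
    [rank_corner]. Thus [y - schur] straightens the rank condition. This map is
    homogeneous of degree one, so it can be multiplied by [\tr y / \tr (p y p)], which
    makes the condition [\tr y = 1] linear too and keeps an explicit rational inverse
    [chartK, unchartK]. The dimension of the slice is the same at all points of a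
    stratum since congruence carries one linearized condition to the other
    [tangent_dim_le].

    For Whitney's condition (B), let [y] tend to [y0] inside the stratum of [y0], let
    [x] tend to [y0] inside another stratum, and let [q] be the projection onto the
    kernel of [x]. Every trace-free [v] with [q v q = 0] is tangent at [x] to the
    stratum of [x] [tangent_velocity]; the secant [x - y] fails to be of this form by
    [q y q] only, up to a correction of the trace. As the rank of [y] is that of [y0],
    one has [y = y p N p y] with [p] the range projection of [y0] and [N] bounded, and
    [x q = 0] gives [q y q = (q (x - y)) p N p ((x - y) q)], which is of order
    [|x - y|^2] [kernel_estimate]. Hence secants are tangent up to a negligible error,
    and the limiting line is contained in the limiting tangent space
    [grass_limit]. *)

(** * Functions of class C^m *)

Lemma near_eq_differentiable (R : numFieldType) (V W : normedModType R)
    (f g : V -> W) (x : V) :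
  (\forall y \near x, f y = g y) -> differentiable f x -> differentiable g x.
Proof.
move=> fg /diff_locallyP[cf ef].
have eg : g \o shift x = cst (g x) + 'd f x +o_ 0 id.
  apply/eqaddoP => e e0; have /eqaddoP/(_ e e0) := ef.
  have fg0 : \forall y \near 0, f (y + x) = g (y + x).
    by move: fg; rewrite (near_shift 0)/=; apply: filterS => y; rewrite subr0.
  apply: filterS2 fg0 => y fgy.
  by rewrite !fctE/= -fgy -(nbhs_singleton fg).
by apply/diff_locallyP; rewrite (diff_unique cf eg).
Qed.

Section Cm.
Variables (R : realType) (V : normedModType R) (U : set V).
Hypothesis oU : open U.

(** The rules for derivatives of sums, products and inverses hold on [U] only, so the
    inductions on [m] below compare functions that agree on [U]. *)
Lemma Cm_on_ext (W : normedModType R) m (f g : V -> W) :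
  (forall x, U x -> f x = g x) -> Cm_on m U f -> Cm_on m U g.
Proof.
have nearU x : U x -> \forall y \near x, U y by move=> Ux; exact: open_nbhs_nbhs.
elim: m f g => [|m IHm] f g fg /=.
  move=> cf x Ux; have := cf x Ux.
  rewrite /prop_for /continuous_at -(fg x Ux); apply: cvg_trans.
  by apply: near_eq_cvg; apply: filterS (nearU x Ux) => y /fg ->.
move=> [df Cf]; split=> [x Ux|v].
  by apply: near_eq_differentiable (df x Ux); apply: filterS (nearU x Ux).
apply: IHm (Cf v) => x Ux; apply: near_eq_derive.
exact: filterS (nearU x Ux).
Qed.

Lemma Cm_onW (W : normedModType R) m (f : V -> W) : Cm_on m.+1 U f -> Cm_on m U f.
Proof.
elim: m f => [|m IHm] f /= [df Cf]; first by move=> x Ux; exact/differentiable_continuous/df.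
by split=> // v; apply: IHm; exact: Cf.
Qed.

Lemma Cm_on_cst (W : normedModType R) m (w : W) : Cm_on m U (cst w).
Proof.
elim: m w => [|m IHm] w /=; first by move=> x _; exact: cst_continuous.
split=> [x _|v]; first exact: differentiable_cst.
apply: Cm_on_ext (IHm 0) => x _; exact/esym/derive_cst.
Qed.

Lemma Cm_onD (W : normedModType R) m (f g : V -> W) :
  Cm_on m U f -> Cm_on m U g -> Cm_on m U (fun x => f x + g x).
Proof.
elim: m f g => [|m IHm] f g /=; first by move=> cf cg x Ux; apply: continuousD; [exact: cf|exact: cg].
move=> [df Cf] [dg Cg]; split=> [x Ux|v].
  by apply: differentiableD; [exact: df|exact: dg].
apply: Cm_on_ext (IHm _ _ (Cf v) (Cg v)) => x Ux.
by rewrite deriveD//; apply: diff_derivable; [exact: df|exact: dg].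
Qed.

Lemma Cm_onM m (f g : V -> R) :
  Cm_on m U f -> Cm_on m U g -> Cm_on m U (fun x => f x * g x).
Proof.
elim: m f g => [|m IHm] f g /=.
  by move=> cf cg x Ux; apply: continuousM; [exact: cf|exact: cg].
move=> Cf1 Cg1; have [df Cf] := Cf1; have [dg Cg] := Cg1; split=> [x Ux|v].
  by apply: differentiableM; [exact: df|exact: dg].
have Cf0 := Cm_onW Cf1; have Cg0 := Cm_onW Cg1.
apply: Cm_on_ext (Cm_onD (IHm _ _ Cf0 (Cg v)) (IHm _ _ Cg0 (Cf v))) => x Ux.
by rewrite deriveM//; apply: diff_derivable; [exact: df|exact: dg].
Qed.

Lemma Cm_onV m (f : V -> R) : (forall x, U x -> f x != 0) ->
  Cm_on m U f -> Cm_on m U (fun x => (f x)^-1).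
Proof.
move=> f0; elim: m => [|m IHm] /=.
  by move=> cf x Ux; apply: continuousV; [exact: f0|exact: cf].
move=> Cf1; have [df Cf] := Cf1; split=> [x Ux|v].
  by apply: differentiableV; [exact: df|exact: f0].
have Ci := IHm (Cm_onW Cf1).
have CN : Cm_on m U (fun=> -1 : R) by exact: Cm_on_cst.
have H := Cm_onM (Cm_onM CN (Cm_onM Ci Ci)) (Cf v).
apply: Cm_on_ext H => x Ux.
rewrite deriveV//; [|exact: f0|exact/diff_derivable/df].
by rewrite mulN1r /GRing.scale/= -expr2 -exprVn.
Qed.

Lemma Cm_onZl (W : normedModType R) m (f : V -> R) (w : W) :
  Cm_on m U f -> Cm_on m U (fun x => f x *: w).
Proof.
elim: m f => [|m IHm] f /=.
  by move=> cf x Ux; apply: continuousZr_tmp; exact: cf.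
move=> [df Cf]; split=> [x Ux|v]; first by apply: differentiableZl; exact: df.
apply: Cm_on_ext (IHm _ (Cf v)) => x Ux.
have dfx := df x Ux; rewrite !deriveE ?diffZl//.
exact: differentiableZl.
Qed.

Lemma Cm_on_linear (W : normedModType R) m (f : {linear V -> W}) :
  continuous f -> Cm_on m U f.
Proof.
case: m => [|m] cf /=; first by move=> x _; exact: cf.
split=> [x _|v]; first exact: linear_differentiable.
apply: Cm_on_ext (Cm_on_cst m (f v)) => x Ux.
by rewrite deriveE ?diff_lin//; exact: linear_differentiable.
Qed.

End Cm.

Lemma smooth_on_continuous (R : realType) (V W : normedModType R) (U : set V)
  (f : V -> W) x : smooth_on U f -> U x -> {for x, continuous f}.
Proof. by move=> /(_ 0%N); exact. Qed.

(** * Algebras of real functions and matrices with entries in them *)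

(** Polynomial functions on R^N and smooth functions on an open set are both
    instances, so that what is built from matrix entries is handled once for both. *)
Record function_algebra (R : realType) (T : Type) (F : set (T -> R)) : Prop :=
  FunctionAlgebra {
  fun_cst : forall a, F (fun=> a);
  funD : forall f g, F f -> F g -> F (fun x => f x + g x);
  funM : forall f g, F f -> F g -> F (fun x => f x * g x)
}.

Section Complexification.
Variables (R : realType) (T : Type) (F : set (T -> R)).
Hypothesis algF : function_algebra F.
Local Notation C := R[i].

Definition cfun (h : T -> C) : Prop :=
  F (fun x => complex.Re (h x)) /\ F (fun x => complex.Im (h x)).

Lemma cfun_cst c : cfun (fun=> c).
Proof. by split; exact: fun_cst. Qed.

Lemma cfun_real f : F f -> cfun (fun x => (f x)%:C).
Proof. by move=> Ff; split=> //=; exact: fun_cst. Qed.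

Lemma cfunD f g : cfun f -> cfun g -> cfun (fun x => f x + g x).
Proof.
move=> [f1 f2] [g1 g2]; split.
  by under eq_fun do rewrite raddfD/=; exact: funD.
by under eq_fun do rewrite raddfD/=; exact: funD.
Qed.

Lemma cfunM f g : cfun f -> cfun g -> cfun (fun x => f x * g x).
Proof.
move=> [f1 f2] [g1 g2].
have E (a b : C) : a * b =
    (complex.Re a * complex.Re b + -1 * (complex.Im a * complex.Im b)) +i*
    (complex.Re a * complex.Im b + complex.Im a * complex.Re b).
  by case: a => a a'; case: b => b b' /=; rewrite mulN1r.
split; under eq_fun do rewrite E/=.
  by do ?[apply: funD|apply: funM|exact: fun_cst] => //.
by do ?[apply: funD|apply: funM|exact: fun_cst] => //.
Qed.

Lemma cfunN f : cfun f -> cfun (fun x => - f x).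
Proof.
by move=> cf; under eq_fun do rewrite -mulN1r; apply: cfunM => //; exact: cfun_cst.
Qed.

Lemma cfunB f g : cfun f -> cfun g -> cfun (fun x => f x - g x).
Proof. by move=> cf cg; apply: cfunD => //; exact: cfunN. Qed.

Lemma cfun_sum (I : Type) (r : seq I) (P : pred I) (f : I -> T -> C) :
  (forall i, P i -> cfun (f i)) -> cfun (fun x => \sum_(i <- r | P i) f i x).
Proof.
move=> Ff; elim: r => [|i r IHr].
  by under eq_fun do rewrite big_nil; exact: cfun_cst.
under eq_fun do rewrite big_cons.
by case: (boolP (P i)) => // Pi; apply: cfunD => //; exact: Ff.
Qed.

Lemma cfun_prod (I : Type) (r : seq I) (P : pred I) (f : I -> T -> C) :
  (forall i, P i -> cfun (f i)) -> cfun (fun x => \prod_(i <- r | P i) f i x).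
Proof.
move=> Ff; elim: r => [|i r IHr].
  by under eq_fun do rewrite big_nil; exact: cfun_cst.
under eq_fun do rewrite big_cons.
by case: (boolP (P i)) => // Pi; apply: cfunM => //; exact: Ff.
Qed.

Definition mxfun m n (M : T -> 'M[C]_(m, n)) : Prop :=
  forall i j, cfun (fun x => M x i j).

Lemma mxfun_cst m n (M : 'M[C]_(m, n)) : mxfun (fun=> M).
Proof. by move=> i j; exact: cfun_cst. Qed.

Lemma mxfunD m n (M N : T -> 'M[C]_(m, n)) :
  mxfun M -> mxfun N -> mxfun (fun x => M x + N x).
Proof. by move=> cM cN i j; under eq_fun do rewrite mxE; exact: cfunD. Qed.

Lemma mxfunB m n (M N : T -> 'M[C]_(m, n)) :
  mxfun M -> mxfun N -> mxfun (fun x => M x - N x).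
Proof. by move=> cM cN i j; under eq_fun do rewrite !mxE; exact: cfunB. Qed.

Lemma mxfunZ m n (f : T -> C) (M : T -> 'M[C]_(m, n)) :
  cfun f -> mxfun M -> mxfun (fun x => f x *: M x).
Proof. by move=> cf cM i j; under eq_fun do rewrite mxE; exact: cfunM. Qed.

Lemma mxfunM m n p (M : T -> 'M[C]_(m, n)) (N : T -> 'M[C]_(n, p)) :
  mxfun M -> mxfun N -> mxfun (fun x => M x *m N x).
Proof.
move=> cM cN i j; under eq_fun do rewrite mxE.
by apply: cfun_sum => l _; exact: cfunM.
Qed.

Lemma mxfun_sum m n (I : Type) (r : seq I) (P : pred I) (M : I -> T -> 'M[C]_(m, n)) :
  (forall i, P i -> mxfun (M i)) -> mxfun (fun x => \sum_(i <- r | P i) M i x).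
Proof.
move=> cM a b; under eq_fun do rewrite summxE.
by apply: cfun_sum => i Pi; exact: cM.
Qed.

Lemma mxfun_sub m n p q (f : 'I_p -> 'I_m) (g : 'I_q -> 'I_n)
    (M : T -> 'M[C]_(m, n)) : mxfun M -> mxfun (fun x => mxsub f g (M x)).
Proof. by move=> cM i j; under eq_fun do rewrite mxE; exact: cM. Qed.

Lemma cfun_tr n (M : T -> 'M[C]_n) : mxfun M -> cfun (fun x => \tr (M x)).
Proof. by move=> cM; apply: cfun_sum => i _; exact: cM. Qed.

Lemma cfun_det n (M : T -> 'M[C]_n) : mxfun M -> cfun (fun x => \det (M x)).
Proof.
move=> cM; apply: cfun_sum => s _; apply: cfunM; first exact: cfun_cst.
by apply: cfun_prod => i _; exact: cM.
Qed.

Lemma mxfun_adj n (M : T -> 'M[C]_n) : mxfun M -> mxfun (fun x => \adj (M x)).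
Proof.
move=> cM i j; under eq_fun do rewrite mxE.
apply: cfunM; first exact: cfun_cst.
apply: cfun_det => a b; under eq_fun do rewrite !mxE; exact: cM.
Qed.

Definition polyfun (p : T -> {poly C}) : Prop := forall l, cfun (fun x => (p x)`_l).

Lemma polyfun_cst p : polyfun (fun=> p).
Proof. by move=> l; exact: cfun_cst. Qed.

Lemma polyfunM p q : polyfun p -> polyfun q -> polyfun (fun x => p x * q x).
Proof.
move=> cp cq l; under eq_fun do rewrite coefM.
by apply: cfun_sum => i _; exact: cfunM.
Qed.

Lemma polyfun_sum (I : Type) (r : seq I) (P : pred I) (f : I -> T -> {poly C}) :
  (forall i, P i -> polyfun (f i)) -> polyfun (fun x => \sum_(i <- r | P i) f i x).
Proof.
move=> Ff l; under eq_fun do rewrite coef_sum.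
by apply: cfun_sum => i Pi; exact: Ff.
Qed.

Lemma polyfun_prod (I : Type) (r : seq I) (P : pred I) (f : I -> T -> {poly C}) :
  (forall i, P i -> polyfun (f i)) -> polyfun (fun x => \prod_(i <- r | P i) f i x).
Proof.
move=> Ff; elim: r => [|i r IHr].
  by under eq_fun do rewrite big_nil; exact: polyfun_cst.
under eq_fun do rewrite big_cons.
by case: (boolP (P i)) => // Pi; apply: polyfunM => //; exact: Ff.
Qed.

Lemma polyfun_char_poly n (M : T -> 'M[C]_n) :
  mxfun M -> polyfun (fun x => char_poly (M x)).
Proof.
move=> cM; apply: polyfun_sum => s _; apply: polyfunM; first exact: polyfun_cst.
apply: polyfun_prod => i _ l; under eq_fun do rewrite !mxE coefB coefC.
apply: cfunB; first exact: cfun_cst.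
by case: eqP => _; [exact: cM|exact: cfun_cst].
Qed.

End Complexification.

Section SmoothAlgebra.
Variables (R : realType) (V : normedModType R) (U : set V).
Hypothesis oU : open U.
Local Notation C := R[i].

Lemma smooth_algebra : function_algebra [set f : V -> R | smooth_on U f].
Proof.
split=> [a|f g sf sg|f g sf sg] m; first exact: Cm_on_cst.
- exact: Cm_onD.
- exact: Cm_onM.
Qed.

Local Notation csmooth := (cfun [set f : V -> R | smooth_on U f]).

Lemma csmoothV (f : V -> C) : (forall x, U x -> f x != 0) ->
  csmooth f -> csmooth (fun x => (f x)^-1).
Proof.
move=> f0 [f1 f2].
have E (a : C) : a^-1 = (complex.Re a * (complex.Re a ^+ 2 + complex.Im a ^+ 2)^-1) +i*
    (-1 * (complex.Im a * (complex.Re a ^+ 2 + complex.Im a ^+ 2)^-1)).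
  by case: a => a b; rewrite mulN1r.
have sN : smooth_on U (fun x => (complex.Re (f x) ^+ 2 + complex.Im (f x) ^+ 2)^-1).
  move=> m; apply: Cm_onV => // [x Ux|].
    have := f0 x Ux; case: (f x) => a b; rewrite eq_complex/= => ab.
    by rewrite paddr_eq0 ?sqr_ge0// !sqrf_eq0.
  by apply: Cm_onD => //; apply: Cm_onM.
have -> : (fun x => (f x)^-1) = _ := funext (fun x => E (f x)).
split=> m /=; first by apply: Cm_onM.
by apply: Cm_onM => //; [exact: Cm_on_cst|exact: Cm_onM].
Qed.

Lemma mxsmoothV n (M : V -> 'M[C]_n) : (forall x, U x -> M x \in unitmx) ->
  mxfun [set f : V -> R | smooth_on U f] M ->
  mxfun [set f : V -> R | smooth_on U f] (fun x => invmx (M x)).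
Proof.
move=> uM sM; have A := smooth_algebra.
have sI : mxfun [set f : V -> R | smooth_on U f] (fun x => (\det (M x))^-1 *: \adj (M x)).
  apply: mxfunZ => //; last exact: mxfun_adj.
  apply: csmoothV; last exact: cfun_det.
  by move=> x /uM; rewrite unitmxE unitfE.
move=> i j; have [s1 s2] := sI i j; split=> m.
  by apply: Cm_on_ext (s1 m) => // x Ux; rewrite /invmx uM.
by apply: Cm_on_ext (s2 m) => // x Ux; rewrite /invmx uM.
Qed.

End SmoothAlgebra.

Lemma smooth_on_sub (R : realType) (V W : normedModType R) (U U' : set V) (f : V -> W) :
  U' `<=` U -> smooth_on U f -> smooth_on U' f.
Proof.
move=> UU sf l; move: (sf l); elim: l f {sf} => [|l IHl] f /=; first by move=> cf x /UU; exact: cf.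
by move=> [df Cf]; split=> [x /UU|v]; [exact: df|exact: IHl].
Qed.

Lemma mxsmooth_sub (R : realType) (V : normedModType R) (U U' : set V) p q (M : V -> 'M[R[i]]_(p, q)) : U' `<=` U ->
  mxfun [set f : V -> R | smooth_on U f] M -> mxfun [set f : V -> R | smooth_on U' f] M.
Proof. by move=> UU sM a b; have [s1 s2] := sM a b; split; exact: smooth_on_sub UU _. Qed.

(** * Positive semidefinite matrices: inertia, rank and characteristic polynomial *)

Section Adjoint.
Variable C : numClosedFieldType.

Lemma trmxC_mul m n p (A : 'M[C]_(m, n)) (B : 'M[C]_(n, p)) :
  (A *m B)^t* = B^t* *m A^t*.
Proof. by rewrite trmx_mul map_mxM. Qed.

Lemma trmxCD m n (A B : 'M[C]_(m, n)) : (A + B)^t* = A^t* + B^t*.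
Proof. by rewrite linearD map_mxD. Qed.

Lemma trmxCB m n (A B : 'M[C]_(m, n)) : (A - B)^t* = A^t* - B^t*.
Proof. by rewrite linearB map_mxB. Qed.

Lemma trmxC1 n : (1%:M : 'M[C]_n)^t* = 1%:M.
Proof. by rewrite trmx1 map_mx1. Qed.

Lemma hermP n (A : 'M[C]_n) : reflect (A^t* = A) (A \is hermsymmx).
Proof.
by apply: (iffP (is_hermitianmxP _ _ _)); rewrite expr0 scale1r => /esym.
Qed.

Lemma trmxC_unit n (A : 'M[C]_n) : (A^t* \in unitmx) = (A \in unitmx).
Proof. by rewrite map_unitmx unitmx_tr. Qed.

Lemma invmx_trmxC n (A : 'M[C]_n) : (invmx A)^t* = invmx (A^t*).
Proof. by rewrite trmx_inv map_invmx. Qed.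

Lemma trmxC_diag n (d : 'rV[C]_n) : (forall i, d 0 i \is Num.real) ->
  (diag_mx d)^t* = diag_mx d.
Proof.
move=> dr; rewrite tr_diag_mx map_diag_mx; congr diag_mx.
by apply/rowP => i; rewrite mxE; apply/CrealP.
Qed.

Lemma herm_tr_real m (M : 'M[C]_m) : M^t* = M -> \tr M \is Num.real.
Proof. by move=> hM; apply/CrealP; rewrite -{2}hM -map_trmx mxtrace_tr trace_map_mx. Qed.

Lemma hermitian_spectral n (x : 'M[C]_n) : x^t* = x ->
  exists (U : 'M[C]_n) (d : 'rV[C]_n),
    [/\ U *m U^t* = 1%:M, U^t* *m U = 1%:M, forall i, d 0 i \is Num.real
      & x = U^t* *m diag_mx d *m U].
Proof.
move=> /hermP hx; have Uu := spectral_unitarymx x.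
exists (spectralmx x), (spectral_diag x); split.
- exact/unitarymxP.
- by rewrite -invmx_unitary// mulVmx// unitarymx_unit.
- by move=> i; have /mxOverP := hermitian_spectral_diag_real hx; apply.
- by have /hermitian_normalmx/orthomx_spectralP := hx; rewrite invmx_unitary.
Qed.

(** The Moore-Penrose inverse: the nonzero eigenvalues are inverted. *)
Lemma hermitian_pinv n (x : 'M[C]_n) : x^t* = x ->
  exists Z : 'M[C]_n,
    [/\ Z^t* = Z, x *m Z = Z *m x, x *m Z *m x = x & Z *m x *m Z = Z].
Proof.
move=> /hermitian_spectral[U [d [U1 U2 dr xE]]].
pose e := \row_i (d 0 i)^-1.
exists (U^t* *m diag_mx e *m U).
have er i : e 0 i \is Num.real by rewrite mxE realV.
have mulU (a b : 'M[C]_n) : U^t* *m a *m U *m (U^t* *m b *m U) = U^t* *m (a *m b) *m U.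
  by rewrite !mulmxA -[X in X *m b]mulmxA U1 mulmx1.
rewrite xE !mulU; split.
- by rewrite !trmxC_mul trmxCK trmxC_diag// mulmxA.
- by rewrite diag_mxC.
- congr (_ *m _ *m _); rewrite !mulmx_diag; congr diag_mx; apply/rowP => i; rewrite !mxE.
  have [->|d0] := eqVneq (d 0 i) 0; first by rewrite mulr0.
  by rewrite mulfV// mul1r.
- congr (_ *m _ *m _); rewrite !mulmx_diag; congr diag_mx; apply/rowP => i; rewrite !mxE.
  have [->|d0] := eqVneq (d 0 i) 0; first by rewrite invr0 mulr0.
  by rewrite mulVf// mul1r.
Qed.

End Adjoint.

Section Psd.
Variable R : realType.
Local Notation C := R[i].

Lemma psd_herm n (x : 'M[C]_n) : psdmx x -> x^t* = x.
Proof. by case=> /hermP. Qed.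

Lemma psd_congr m n (g : 'M[C]_(m, n)) (x : 'M[C]_n) :
  psdmx x -> psdmx (g *m x *m g^t*).
Proof.
move=> px; split; first by apply/hermP; rewrite !trmxC_mul trmxCK (psd_herm px) mulmxA.
move=> u; have [_ /(_ (g^t* *m u))] := px.
by rewrite trmxC_mul trmxCK !mulmxA.
Qed.

Lemma psdD n (x y : 'M[C]_n) : psdmx x -> psdmx y -> psdmx (x + y).
Proof.
move=> px py; split; first by apply/hermP; rewrite trmxCD !psd_herm.
move=> u; rewrite mulmxDr mulmxDl mxE.
by apply: addr_ge0; [case: px => _ ->|case: py => _ ->].
Qed.

Lemma psd_diag n (d : 'rV[C]_n) : (forall i, 0 <= d 0 i) -> psdmx (diag_mx d).
Proof.
move=> d0; split.
  by apply/hermP; rewrite trmxC_diag// => i; apply: ger0_real.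
move=> u; rewrite mxE; apply: sumr_ge0 => i _.
rewrite mul_mx_diag !mxE mulrAC -normCKC.
by apply: mulr_ge0 => //; apply: exprn_ge0.
Qed.

Lemma psd1 n : psdmx (1%:M : 'M[C]_n).
Proof. by rewrite -diag_const_mx; apply: psd_diag => i; rewrite mxE. Qed.

Lemma psd_gram m n (g : 'M[C]_(m, n)) : psdmx (g *m g^t*).
Proof. by have := psd_congr g (psd1 n); rewrite mulmx1. Qed.

Lemma psd_diag_entry_ge0 n (x : 'M[C]_n) i : psdmx x -> 0 <= x i i.
Proof.
move=> [_ /(_ (delta_mx i 0))]; rewrite mxE (bigD1 i)//= big1.
  rewrite !mxE eqxx mulr1 addr0 (bigD1 i)//= big1.
    by rewrite !mxE !eqxx/= rmorph1 mul1r addr0.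
  by move=> j ji; rewrite !mxE (negbTE ji)/= rmorph0 mul0r.
by move=> j ji; rewrite !mxE (negbTE ji)/= mulr0.
Qed.

Lemma psd_tr_ge0 n (x : 'M[C]_n) : psdmx x -> 0 <= \tr x.
Proof. by move=> px; apply: sumr_ge0 => i _; exact: psd_diag_entry_ge0. Qed.

Lemma psdZ n (c : C) (x : 'M[C]_n) : 0 <= c -> psdmx x -> psdmx (c *: x).
Proof.
move=> c0 px; split.
  apply/hermP; rewrite linearZ/= map_mxZ/= (psd_herm px); congr (_ *: _).
  exact/CrealP/ger0_real.
move=> u; rewrite -scalemxAr -scalemxAl mxE; apply: mulr_ge0 => //.
by case: px.
Qed.

Lemma psd_spectral n (x : 'M[C]_n) : psdmx x ->
  exists (U : 'M[C]_n) (d : 'rV[C]_n),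
    [/\ U *m U^t* = 1%:M, U^t* *m U = 1%:M, forall i, 0 <= d 0 i
      & x = U^t* *m diag_mx d *m U].
Proof.
move=> px; have [U [d [U1 U2 dr xE]]] := hermitian_spectral (psd_herm px).
exists U, d; split=> // i.
have := psd_diag_entry_ge0 i (psd_congr U px).
rewrite xE !mulmxA U1 mul1mx -mulmxA U1 mulmx1.
by rewrite mxE eqxx.
Qed.

(** A permutation brings the selected diagonal entries to the front. *)
Lemma bool_diag_pid n (b : 'I_n -> bool) : exists2 Q : 'M[C]_n,
  Q \in unitmx & diag_mx (\row_i (b i)%:R) = Q *m pid_mx #|b| *m Q^t*.
Proof.
have [s sE] : exists s : 'S_n, forall i, b (s i) = (i < #|b|)%N.
  have /tuple_permP[s sE] : perm_eq [tuple (i < #|b|)%N | i < n] [tuple b i | i < n].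
    have cb (f : 'I_n -> bool) (a : pred bool) :
        count a [tuple f i | i < n] = (a true * #|f| + a false * (n - #|f|))%N.
      have cf : count f (enum 'I_n) = #|f| by rewrite cardE -size_filter enumT.
      have cfN : count (predC f) (enum 'I_n) = (n - #|f|)%N.
        have := count_predC f (enum 'I_n).
        by rewrite cf size_enum_ord => /(congr1 (subn^~ #|f|)); rewrite addKn.
      rewrite /= count_map -cfN -cf.
      elim: (enum 'I_n) => [|i r IHr] /=; first by rewrite !muln0.
      rewrite {}IHr; case: (f i); case: (a true); case: (a false) => /=; lia.
    apply/seq.permP => a; rewrite !cb; suff -> : #|[pred i : 'I_n | (i < #|b|)%N]| = #|b| by [].
    have kn : (#|b| <= n)%N by rewrite -[n in leqRHS]card_ord max_card.
    have -> : #|[pred i : 'I_n | (i < #|b|)%N]| = (\sum_(i < n | (i < #|b|)%N) 1)%N.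
      by rewrite sum1_card.
    by rewrite (big_ord_narrow kn) sum1_card card_ord.
  exists s => i; have : tnth [tuple (i < #|b|)%N | i < n] i = nth false [tuple tnth [tuple b i | i < n] (s i) | i < n] i.
    by rewrite -sE -tnth_nth.
  by rewrite -tnth_nth !tnth_mktuple.
exists (perm_mx s^-1%g); first exact: unitmx_perm.
rewrite tr_perm_mx map_perm_mx -col_permE -row_permE.
apply/matrixP => i j; rewrite !mxE (inj_eq val_inj) (inj_eq perm_inj) -sE permKV.
by case: (i == j) => /=; rewrite ?mulr1n ?mulr0n.
Qed.

(** Sylvester's law of inertia: the eigenvectors are scaled by the square roots of
    the nonzero eigenvalues. *)
Lemma psd_sylvester n (x : 'M[C]_n) : psdmx x ->
  exists2 K : 'M[C]_n, K \in unitmx & x = K *m pid_mx (\rank x) *m K^t*.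
Proof.
move=> /psd_spectral[U [d [U1 U2 d0 xE]]].
pose b i := d 0 i != 0; have [Q Qu QE] := bool_diag_pid b.
pose s := \row_i (if b i then sqrtC (d 0 i) else 1).
have dE : diag_mx d = diag_mx s *m diag_mx (\row_i (b i)%:R) *m (diag_mx s)^t*.
  rewrite trmxC_diag => [|i]; last first.
    by rewrite mxE; case: ifP => // _; rewrite ger0_real// sqrtC_ge0.
  rewrite !mulmx_diag; congr diag_mx; apply/rowP => i; rewrite !mxE /b.
  have [->|_] := eqVneq (d 0 i) 0; first by rewrite mulr0 mul0r.
  by rewrite mulr1 -expr2 sqrtCK.
have Ku : U^t* *m diag_mx s *m Q \in unitmx.
  rewrite !unitmx_mul Qu andbT; apply/andP; split.
    by case/mulmx1_unit: U2.
  rewrite unitmxE det_diag unitfE; apply/prodf_neq0 => i _; rewrite mxE.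
  by case: ifP => [|_]; rewrite ?sqrtC_eq0 ?oner_eq0.
have xK : x = (U^t* *m diag_mx s *m Q) *m pid_mx #|b| *m (U^t* *m diag_mx s *m Q)^t*.
  rewrite !trmxC_mul trmxCK xE dE QE.
  by move: (U^t*) ((diag_mx s)^t*) (Q^t*) => U' s' Q'; rewrite !mulmxA.
exists (U^t* *m diag_mx s *m Q); first exact: Ku.
suff -> : \rank x = #|b| by [].
rewrite {1}xK mxrankMfree; last by rewrite row_free_unit trmxC_unit.
rewrite (eqmxMfull _ _) ?row_full_unit// rank_pid_mx//.
all: by rewrite -[n in leqRHS]card_ord max_card.
Qed.

Lemma mxrank_diag n (d : 'rV[C]_n) : \rank (diag_mx d) = #|[pred i : 'I_n | d 0 i != 0]|.
Proof.
pose b i := d 0 i != 0; have [Q Qu QE] := bool_diag_pid b.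
pose s := \row_i (if b i then d 0 i else 1).
have -> : diag_mx d = diag_mx (\row_i (b i)%:R) *m diag_mx s.
  rewrite mulmx_diag; congr diag_mx; apply/rowP => i; rewrite !mxE /b.
  by have [->|_] := eqVneq (d 0 i) 0; rewrite ?mul0r ?mul1r.
have su : diag_mx s \in unitmx.
  rewrite unitmxE det_diag unitfE; apply/prodf_neq0 => i _; rewrite mxE.
  by case: ifP => [|_]; rewrite ?oner_eq0.
rewrite mxrankMfree ?row_free_unit// QE mxrankMfree ?row_free_unit ?trmxC_unit//.
rewrite (eqmxMfull _ _) ?row_full_unit// rank_pid_mx//.
all: by rewrite -[n in leqRHS]card_ord max_card.
Qed.

Lemma psd_conj n (x y : 'M[C]_n) : psdmx x -> psdmx y -> \rank x = \rank y ->
  exists2 g : 'M[C]_n, g \in unitmx & y = g *m x *m g^t*.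
Proof.
move=> /psd_sylvester[K Ku xE] /psd_sylvester[L Lu yE] rxy.
exists (L *m invmx K); first by rewrite unitmx_mul Lu unitmx_inv.
have Ku' : K^t* \in unitmx by rewrite trmxC_unit.
rewrite {1}yE -rxy {2}xE trmxC_mul invmx_trmxC !mulmxA.
by move: (K^t*) (L^t*) Ku' => K' L' Ku'; rewrite (mulmxKV Ku) (mulmxK Ku').
Qed.

Lemma char_polyN_conj n (U : 'M[C]_n) (d : 'rV[C]_n) : U *m U^t* = 1%:M ->
  U^t* *m U = 1%:M ->
  char_poly (- (U^t* *m diag_mx d *m U)) = \prod_i ('X + (d 0 i)%:P).
Proof.
move=> U1 U2; rewrite /char_poly /char_poly_mx.
have -> : 'X%:M - map_mx polyC (- (U^t* *m diag_mx d *m U)) =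
    map_mx polyC (U^t*) *m diag_mx (\row_i ('X + (d 0 i)%:P)) *m map_mx polyC U.
  have -> : diag_mx (\row_i ('X + (d 0 i)%:P)) = 'X%:M + map_mx polyC (diag_mx d).
    apply/matrixP => i j; rewrite !mxE.
    by case: eqP => _; rewrite ?mulr1n ?mulr0n ?addr0.
  rewrite mulmxDr mulmxDl -!map_mxM mul_mx_scalar -scalemxAl -map_mxM U2.
  by rewrite map_mx1 scalemx1 map_mxN opprK.
rewrite !det_mulmx mulrAC -det_mulmx -map_mxM U2 map_mx1 det1 mul1r det_diag.
by apply: eq_bigr => i _; rewrite mxE.
Qed.

Lemma psd_char_poly_ge0 n (x : 'M[C]_n) l : psdmx x -> 0 <= (char_poly (- x))`_l.
Proof.
move=> /psd_spectral[U [d [U1 U2 d0 ->]]]; rewrite char_polyN_conj//.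
elim: (index_enum _) l => [|i r IHr] l; first by rewrite big_nil coef1 ler0n.
rewrite big_cons mulrDl coefD coefXM coefCM; apply: addr_ge0.
  by case: ifP.
exact: mulr_ge0.
Qed.

(** A monic polynomial with nonnegative coefficients has no positive root, whereas the
    opposite of a negative eigenvalue of [x] would be one. *)
Lemma char_poly_ge0_psd n (x : 'M[C]_n) : x^t* = x ->
  (forall l, 0 <= (char_poly (- x))`_l) -> psdmx x.
Proof.
move=> hx q0; have [U [d [U1 U2 dr xE]]] := hermitian_spectral hx.
suff d0 i : 0 <= d 0 i.
  by rewrite xE -{2}[U]trmxCK; apply: psd_congr; exact: psd_diag.
have /real_leP/(_ (dr i)) := real0 C; case => // di.
have : (char_poly (- x)).[- d 0 i] = 0.
  rewrite xE char_polyN_conj// horner_prod (bigD1 i)//= hornerD hornerX hornerC.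
  by rewrite addNr mul0r.
rewrite horner_coef size_char_poly big_ord_recr/=.
have := char_poly_monic (- x); rewrite monicE lead_coefE size_char_poly/= => /eqP ->.
move=> /eqP; rewrite mul1r paddr_eq0.
- by rewrite expf_eq0 oppr_eq0 (lt_eqF di) !andbF.
- by apply: sumr_ge0 => j _; apply: mulr_ge0 => //; apply: exprn_ge0; rewrite oppr_ge0 ltW.
- by apply: exprn_ge0; rewrite oppr_ge0 ltW.
Qed.

Lemma char_poly_real n (x : 'M[C]_n) l : x^t* = x ->
  (char_poly (- x))`_l \is Num.real.
Proof.
move=> /hermitian_spectral[U [d [U1 U2 dr ->]]]; rewrite char_polyN_conj//.
elim: (index_enum _) l => [|i r IHr] l; first by rewrite big_nil coef1 realn.
rewrite big_cons mulrDl coefD coefXM coefCM; apply: realD.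
  by case: ifP => // _; exact: real0.
exact: realM.
Qed.

(** In the product of the ['X + d i], the zero eigenvalues contribute a power of ['X]
    and the other ones a polynomial with positive coefficients only. *)
Lemma psd_char_poly_gt0 n (x : 'M[C]_n) l : psdmx x ->
  (0 < (char_poly (- x))`_l) = (n - \rank x <= l <= n)%N.
Proof.
move=> /psd_spectral[U [d [U1 U2 d0 xE]]].
have -> : \rank x = #|[pred i : 'I_n | d 0 i != 0]|.
  have Uu : U \in unitmx by case/mulmx1_unit: U1.
  rewrite xE mxrankMfree ?row_free_unit// (eqmxMfull _ _) ?row_full_unit ?trmxC_unit//.
  exact: mxrank_diag.
have eE : index_enum 'I_n = enum 'I_n by rewrite [index_enum _]unlock enumT.
have -> : (n - #|[pred i : 'I_n | (d 0 i != 0)%R]|)%N = count (fun i : 'I_n => d 0 i == 0) (index_enum 'I_n).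
  rewrite -{1}(card_ord n) -(cardC [pred i : 'I_n | d 0 i != 0]) addKn cardE size_filter/= -enumT eE.
  by apply: eq_count => i; rewrite !inE negbK.
have sE : size (index_enum 'I_n) = n by rewrite eE size_enum_ord.
rewrite xE char_polyN_conj// -[X in (l <= X)%N]sE {sE}.
elim: (index_enum _) l => [|i r IHr] l.
  by rewrite big_nil coef1; case: l => [|l] /=; rewrite ?ltr01 ?ltxx.
rewrite big_cons mulrDl coefD coefXM coefCM /=.
have p0 j : 0 <= (\prod_(j <- r) ('X + (d 0 j)%:P))`_j.
  elim: r j {IHr} => [|a r IHr] j; first by rewrite big_nil coef1 ler0n.
  rewrite big_cons mulrDl coefD coefXM coefCM; apply: addr_ge0; last exact: mulr_ge0.
  by case: ifP.
have cs : (count (fun i : 'I_n => (d 0 i == 0)%R) r <= size r)%N by exact: count_size.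
have [->|di] := eqVneq (d 0 i) 0.
  rewrite mul0r addr0; case: l => [|l] /=; first by rewrite ltxx.
  by rewrite IHr.
rewrite add0n lt0r addr_ge0 ?mulr_ge0//; last by case: ifP.
rewrite andbT paddr_eq0 ?mulr_ge0//; last by case: ifP.
rewrite mulf_eq0 (negbTE di)/= negb_and.
have E j : ((\prod_(j <- r) ('X + (d 0 j)%:P))`_j != 0) =
   (count (fun i : 'I_n => (d 0 i == 0)%R) r <= j <= size r)%N.
  by rewrite -IHr lt0r p0 andbT.
move: cs; case: l => [|l] /=; rewrite ?eqxx !E; set c := count _ _.
  by move: c (size r) => c s /=; lia.
by move: c (size r) => c s; lia.
Qed.

Lemma psd_rank_ge n (x : 'M[C]_n) r : psdmx x ->
  (r <= \rank x)%N = (r <= n)%N && (0 < (char_poly (- x))`_(n - r)).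
Proof.
by move=> px; rewrite psd_char_poly_gt0//; have := rank_leq_row x; lia.
Qed.

Lemma psd_unit n (x : 'M[C]_n) : psdmx x ->
  (x \in unitmx) = [forall l : 'I_n.+1, 0 < (char_poly (- x))`_l].
Proof.
move=> px; rewrite -row_free_unit /row_free; apply/eqP/forallP => [r l|/(_ ord0)].
  by rewrite psd_char_poly_gt0// r subnn/= -ltnS.
by rewrite psd_char_poly_gt0//=; have := rank_leq_row x; lia.
Qed.

End Psd.

(** * Linear coordinates and dimension *)

Section FiniteDim.
Variable R : realType.

(** [V] is isomorphic to the image of the projector [iota \o pi], which is a row space;
    a basis of this row space gives the coordinates. *)
Lemma coordinates_of_retract (V : lmodType R) M (iota : {linear V -> 'rV[R]_M})
    (pi : {linear 'rV[R]_M -> V}) : cancel iota pi ->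
  exists (N : nat) (phi : {linear V -> 'rV[R]_N}) (psi : {linear 'rV[R]_N -> V}),
    cancel phi psi /\ cancel psi phi.
Proof.
move=> iK; pose A := lin1_mx (iota \o pi); pose B := row_base A.
have mulA r : r *m A = iota (pi r) by rewrite mul_rV_lin1.
have iB v : (iota v <= B)%MS by rewrite -(iK v) -mulA eq_row_base submxMl.
pose phi := mulmxr (pinvmx B) \o iota; pose psi := pi \o mulmxr B.
exists (\rank A), phi, psi; split=> [v|w] /=; first by rewrite mulmxKpV.
have : (w *m B <= A)%MS by rewrite -(eq_row_base A) submxMl.
move=> /submxP[D E].
by rewrite E mulA iK -mulA -E -mulmxA mulmxVp ?mulmx1// row_base_free.
Qed.

Lemma submx_pid N d (w : 'rV[R]_N) m : (d <= m)%N ->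
  (w <= (pid_mx d : 'M[R]_(m, N)))%MS <-> flat d w.
Proof.
move=> dm; split=> [/submxP[D ->] j dj|fw].
  rewrite mxE big1// => i _; rewrite mxE.
  case: eqP => [->|_]; last by rewrite mulr0.
  by rewrite ltnNge dj mulr0.
rewrite (_ : w = w *m (pid_mx d : 'M[R]_(N, m)) *m (pid_mx d : 'M[R]_(m, N))) ?submxMl//.
rewrite -mulmxA pid_mx_id//; apply/rowP => j; rewrite mxE (bigD1 j)//= big1 ?addr0.
  rewrite mxE eqxx/=; case: ltnP; first by rewrite mulr1.
  by move=> /fw ->; rewrite mul0r.
by move=> i /negbTE ij; rewrite mxE [(_ == _ :> nat)]ij mulr0.
Qed.

(** In coordinates, the kernel of [L] is the row space of a matrix, which the invertible
    factor of its Gaussian elimination puts in flat position. *)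
Lemma straighten (V : lmodType R) N M (phi : {linear V -> 'rV[R]_N})
    (psi : {linear 'rV[R]_N -> V}) (L : {linear V -> 'rV[R]_M}) :
  cancel phi psi -> cancel psi phi ->
  exists (d : nat) (phi' : {linear V -> 'rV[R]_N}) (psi' : {linear 'rV[R]_N -> V}),
    [/\ (d <= N)%N, cancel phi' psi', cancel psi' phi' &
        forall v, L v = 0 <-> flat d (phi' v)].
Proof.
move=> phiK psiK; pose A := lin1_mx (L \o psi).
have mulA w : w *m A = L (psi w) by rewrite mul_rV_lin1.
pose K := kermx A; pose E := row_ebase K; have Eu : E \in unitmx := row_ebase_unit K.
exists (\rank K), (mulmxr (invmx E) \o phi), (psi \o mulmxr E); split.
- exact: rank_leq_row.
- by move=> v /=; rewrite mulmxKV.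
- by move=> w /=; rewrite psiK mulmxK.
- move=> v /=; rewrite -(submx_pid _ (rank_leq_row K)).
  rewrite -{1}(phiK v) -mulA; split.
    move=> /eqP; rewrite -sub_kermx -/K -{1}(mulmx_ebase K) => vK.
    have := submxMr (invmx E) vK; rewrite mulmxK// => /submx_trans; apply.
    exact: submxMl.
  move=> vE; apply/eqP; rewrite -sub_kermx -/K -{1}(mulmx_ebase K) -mulmxA.
  rewrite (eqmxMfull _ _) ?row_full_unit ?col_ebase_unit//.
  by have := submxMr E vE; rewrite mulmxKV.
Qed.

(** [Psi] maps the first [d1] basis vectors to the rows of a matrix of rank [d1], all
    contained in a subspace of dimension [d2]. *)
Lemma flat_dim_le (V : lmodType R) N1 N2 d1 d2
    (phi1 : {linear V -> 'rV[R]_N1}) (psi1 : {linear 'rV[R]_N1 -> V})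
    (phi2 : {linear V -> 'rV[R]_N2}) (Psi : {linear V -> V}) :
  (d1 <= N1)%N -> (d2 <= N2)%N -> cancel phi1 psi1 -> cancel psi1 phi1 -> injective phi2 ->
  (forall v, flat d1 (phi1 v) -> Psi v = 0 -> v = 0) ->
  (forall v, flat d1 (phi1 v) -> flat d2 (phi2 (Psi v))) ->
  (d1 <= d2)%N.
Proof.
move=> dN1 dN2 phiK psiK phi2I inj12 sub12.
pose G := lin1_mx (phi2 \o (Psi \o psi1)).
have mulG w : w *m G = phi2 (Psi (psi1 w)) by rewrite mul_rV_lin1.
pose J := (pid_mx d1 : 'M[R]_(d1, N1)).
have fJ u : flat d1 (phi1 (psi1 (u *m J))).
  by rewrite psiK; apply/(submx_pid _ (leqnn d1)); exact: submxMl.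
have freeG : row_free (J *m G).
  rewrite -kermx_eq0; apply/eqP/row_matrixP => i; rewrite row0.
  set u := row i _; have : u *m (J *m G) = 0.
    by apply/eqP; rewrite -sub_kermx row_sub.
  rewrite mulmxA mulG -(raddf0 phi2) => /phi2I /(inj12 _ (fJ u)) /(congr1 phi1).
  rewrite psiK raddf0 => /(congr1 (mulmxr (pid_mx d1 : 'M[R]_(N1, d1)))) /=.
  by rewrite -mulmxA mul_pid_mx !minnn (minn_idPr dN1) pid_mx_1 mulmx1 mul0mx.
have rG : \rank (J *m G) = d1 by apply/eqP.
rewrite -[leqLHS]rG -(rank_pid_mx R dN2 dN2); apply: mxrankS.
apply/row_subP => i; rewrite row_mul mulG; apply/(submx_pid _ dN2)/sub12.
by rewrite rowE; exact: fJ.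
Qed.

End FiniteDim.

(** * Block-diagonal matrices *)

Section BlockAlg.
Variables (R : realType) (k : nat) (n_ : 'I_k -> nat).
Local Notation C := R[i].
Local Notation m := (\sum_i n_ i)%N.
Local Notation A := (@blockalg R k n_).
Implicit Types M N : 'M[C]_m.

Lemma blockalg_offdiagP M :
  reflect (forall a b, a != b -> submxblock M a b = 0) (M \in A).
Proof.
apply: (iffP eqP) => [-> a b ab|M0]; first by rewrite mxblockK (negbTE ab).
rewrite -[LHS](submxblockK M); apply/mxblockP => a b; rewrite !mxblockK.
by have [->|/M0] := eqVneq a b; rewrite ?conform_mx_id.
Qed.

(** The block algebra is the commutant of these projections, which makes its stability
    under products and inverses immediate. *)
Definition blkproj (i : 'I_k) : 'M[C]_m := \mxdiag_j ((i == j)%:R%:M).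

Lemma blockalg_commP M :
  reflect (forall i, M *m blkproj i = blkproj i *m M) (M \in A).
Proof.
have E1 i : M *m blkproj i = \mxblock_(a, b) (submxblock M a b *m ((i == b)%:R%:M)).
  by rewrite -{1}(submxblockK M) mul_mxblock_mxdiag.
have E2 i : blkproj i *m M = \mxblock_(a, b) ((i == a)%:R%:M *m submxblock M a b).
  by rewrite -{1}(submxblockK M) mul_mxdiag_mxblock.
apply: (iffP idP) => [/blockalg_offdiagP M0 i|comm].
  rewrite E1 E2; apply/mxblockP => a b; rewrite !mxblockK.
  have [->|/M0 ->] := eqVneq a b; last by rewrite mul0mx mulmx0.
  by rewrite scalar_mxC.
apply/blockalg_offdiagP => a b ab.
have : submxblock (M *m blkproj a) a b = submxblock (blkproj a *m M) a b by rewrite comm.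
by rewrite E1 E2 !mxblockK eqxx (negbTE ab) mul_mx_scalar scale0r mul1mx.
Qed.

Lemma blockalgM M N : M \in A -> N \in A -> M *m N \in A.
Proof.
move=> /blockalg_commP cM /blockalg_commP cN; apply/blockalg_commP => i.
by rewrite -mulmxA cN mulmxA cM mulmxA.
Qed.

Lemma blockalg1 : 1%:M \in A.
Proof. by apply/blockalg_commP => i; rewrite mul1mx mulmx1. Qed.

Lemma blockalgD M N : M \in A -> N \in A -> M + N \in A.
Proof.
move=> /blockalg_commP cM /blockalg_commP cN; apply/blockalg_commP => i.
by rewrite mulmxDl mulmxDr cN cM.
Qed.

Lemma blockalgZ c M : M \in A -> c *: M \in A.
Proof.
move=> /blockalg_commP cM; apply/blockalg_commP => i.
by rewrite -scalemxAl -scalemxAr cM.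
Qed.

Lemma blockalgB M N : M \in A -> N \in A -> M - N \in A.
Proof. by move=> cM cN; rewrite -scaleN1r; apply: blockalgD => //; exact: blockalgZ. Qed.

Lemma blockalg_diag (B : forall i, 'M[C]_(n_ i)) : \mxdiag_i B i \in A.
Proof. by apply/eqP; apply: eq_mxdiag => i; rewrite submxblock_diag. Qed.

Lemma submxblock_trmxC M a b : submxblock (M^t*) a b = (submxblock M b a)^t*.
Proof. by apply/matrixP => i j; rewrite !mxE. Qed.

Lemma blockalg_trmxC M : M \in A -> M^t* \in A.
Proof.
move=> /blockalg_offdiagP M0; apply/blockalg_offdiagP => a b ab.
by rewrite submxblock_trmxC M0 1?eq_sym// trmx0 map_mx0.
Qed.

Lemma blockalgV M : M \in A -> invmx M \in A.
Proof.
move=> /blockalg_commP cM; apply/blockalg_commP => i.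
have [Mu|/negbTE Mu] := boolP (M \in unitmx); last by rewrite /invmx Mu.
rewrite -[LHS]mulmx1 -(mulmxV Mu) mulmxA -(mulmxA (invmx M)) -cM.
by rewrite mulmxA mulVmx// mul1mx.
Qed.

Lemma submxblockM M N i : M \in A -> N \in A ->
  submxblock (M *m N) i i = submxblock M i i *m submxblock N i i.
Proof.
move=> /eqP {1}-> _; rewrite -{1}(submxblockK N).
by rewrite mul_mxdiag_mxblock mxblockK.
Qed.

Lemma submxblock1 i : submxblock (1%:M : 'M[C]_m) i i = 1%:M.
Proof. by rewrite -mxdiagZ submxblock_diag. Qed.

Lemma submxblock_unit M i : M \in A -> M \in unitmx -> submxblock M i i \in unitmx.
Proof.
move=> MA Mu; have := submxblockM i MA (blockalgV MA).
by rewrite mulmxV// submxblock1 => /esym/mulmx1_unit[].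
Qed.

Definition block_rank M i := \rank (submxblock M i i).

Lemma block_rank_mul g M h i : g \in A -> M \in A -> h \in A ->
  g \in unitmx -> h \in unitmx -> block_rank (g *m M *m h) i = block_rank M i.
Proof.
move=> gA MA hA gu hu; rewrite /block_rank !submxblockM ?blockalgM//.
rewrite mxrankMfree ?row_free_unit ?submxblock_unit//.
by rewrite (eqmxMfull _ _)// row_full_unit submxblock_unit.
Qed.

Lemma rank_block M : M \in A -> \rank M = (\sum_i block_rank M i)%N.
Proof. by move=> /eqP {1}->; rewrite rank_mxdiag. Qed.

Lemma block_psd M i : psdmx M -> psdmx (submxblock M i i).
Proof.
move=> pM; pose E := rowsub (tagnat.Rank i) (1%:M : 'M[C]_m).
have -> : submxblock M i i = E *m M *m E^t*; last exact: psd_congr.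
have -> : E^t* = colsub (tagnat.Rank i) 1%:M.
  by apply/matrixP => a b; rewrite !mxE eq_sym rmorph_nat.
rewrite mul_rowsub_mx mul1mx mulmx_colsub mulmx1.
by apply/matrixP => a b; rewrite !mxE.
Qed.

Lemma block_psd_conj x y : x \in A -> y \in A -> psdmx x -> psdmx y ->
  (forall i, block_rank x i = block_rank y i) ->
  exists g, [/\ g \in A, g \in unitmx & y = g *m x *m g^t*].
Proof.
move=> xA yA px py rxy.
have /fin_all_exists[g gP] i : exists gi : 'M[C]_(n_ i),
    gi \in unitmx /\ submxblock y i i = gi *m submxblock x i i *m gi^t*.
  by have [gi giu giE] := psd_conj (block_psd i px) (block_psd i py) (rxy i); exists gi.
have GA := blockalg_diag g; set G := (\mxdiag_i g i) in GA *.
have Gi i : submxblock G i i = g i by rewrite submxblock_diag.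
exists G; split=> //.
  rewrite -row_free_unit /row_free rank_mxdiag; apply/eqP; apply: eq_bigr => i _.
  by apply/eqP; have [gu _] := gP i; move: gu; rewrite -row_free_unit.
have H : G *m x *m G^t* \in A by rewrite !blockalgM ?blockalg_trmxC.
rewrite (eqP yA) (eqP H); apply: eq_mxdiag => i.
by rewrite !submxblockM ?blockalgM ?blockalg_trmxC// submxblock_trmxC Gi; case: (gP i).
Qed.

(** The Moore-Penrose inverse is taken block by block, so it stays in the algebra. *)
Lemma blockalg_pinv x : x \in A -> x^t* = x -> exists Z : 'M[C]_m,
  [/\ Z \in A, Z^t* = Z, x *m Z = Z *m x, x *m Z *m x = x & Z *m x *m Z = Z].
Proof.
move=> xA hx.
have /fin_all_exists[z zP] i : exists Z : 'M[C]_(n_ i), let xi := submxblock x i i in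
    [/\ Z^t* = Z, xi *m Z = Z *m xi, xi *m Z *m xi = xi & Z *m xi *m Z = Z].
  by apply: hermitian_pinv; rewrite -submxblock_trmxC hx.
have ZA := blockalg_diag z; set Z := (\mxdiag_i z i) in ZA *.
have Zi i : submxblock Z i i = z i by rewrite submxblock_diag.
have blkE M N : M \in A -> N \in A -> (forall i, submxblock M i i = submxblock N i i) -> M = N.
  by move=> /eqP MA /eqP NA MN; rewrite MA NA; apply: eq_mxdiag.
exists Z; split=> //; apply: blkE; rewrite ?blockalgM ?blockalg_trmxC// => i.
all: rewrite ?submxblockM ?blockalgM// ?submxblock_trmxC Zi; by case: (zP i).
Qed.

End BlockAlg.

(** * Schur complements along a projection *)

Section Corner.
Variables (T : pzRingType) (p q y n : T).
Hypothesis pp : p * p = p.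
Hypothesis qE : q = 1 - p.
Hypothesis nB : n * (p * y * p + q) = 1.
Hypothesis Bn : (p * y * p + q) * n = 1.

Let pq : p * q = 0. Proof. by rewrite qE mulrBr mulr1 pp subrr. Qed.
Let qp : q * p = 0. Proof. by rewrite qE mulrBl mul1r pp subrr. Qed.
Let qq : q * q = q. Proof. by rewrite {2}qE mulrBr mulr1 qp subr0. Qed.

Lemma corner_invq : n * q = q.
Proof.
have Bq : (p * y * p + q) * q = q by rewrite mulrDl -mulrA pq mulr0 add0r qq.
by rewrite -{1}Bq mulrA nB mul1r.
Qed.

Lemma corner_qinv : q * n = q.
Proof.
have qB : q * (p * y * p + q) = q by rewrite mulrDr !mulrA qp !mul0r add0r qq.
by rewrite -{1}qB -mulrA Bn mulr1.
Qed.

Lemma corner_mulV : p * y * p * n = p.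
Proof.
rewrite -[p * y * p](addrK q) mulrBl Bn corner_qinv.
by rewrite qE opprB addrC subrK.
Qed.

Lemma corner_Vmul : n * (p * y * p) = p.
Proof.
rewrite -[p * y * p](addrK q) mulrBr nB corner_invq.
by rewrite qE opprB addrC subrK.
Qed.

(** In the decomposition along the idempotent [p], with [q = 1 - p] and [n] inverse to
    [p y p + q], this is what block elimination subtracts from the corner [q y q]. *)
Definition schur : T := q * y * p * n * p * y * q.

Let split z : z = p * z + q * z. Proof. by rewrite -mulrDl qE addrC subrK mul1r. Qed.
Let splitr z : z = z * p + z * q. Proof. by rewrite -mulrDr qE addrC subrK mulr1. Qed.

Lemma corner_mul_rows : y * p * n * p * y = p * y + q * y * p + schur.
Proof.
rewrite [LHS]split !mulrA corner_mulV pp -addrA; congr (_ + _).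
rewrite [LHS]splitr; congr (_ + _).
have -> : q * y * p * n * p * y * p = q * y * p * (n * (p * y * p)) by rewrite !mulrA.
by rewrite corner_Vmul -mulrA pp.
Qed.

(** Block elimination: the two unipotent factors clear the mixed corners. *)
Lemma corner_elim :
  (1 - q * y * p * n * p) * y * (1 - p * n * p * y * q) = p * y * p + (q * y * q - schur).
Proof.
have wy : q * y * p * n * p * y = q * y * p + schur.
  have -> : q * y * p * n * p * y = q * (y * p * n * p * y) by rewrite !mulrA.
  rewrite corner_mul_rows.
  by rewrite !mulrDr !mulrA qp mul0r add0r !qq.
have yv : y * (p * n * p * y * q) = p * y * q + schur.
  rewrite !mulrA corner_mul_rows !mulrDl -[q * y * p * q]mulrA pq mulr0 addr0.
  by rewrite /schur -[_ * q * q]mulrA qq.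
have sv : schur * (p * n * p * y * q) = 0.
  by rewrite /schur !mulrA -[_ * q * p]mulrA qp mulr0 !mul0r.
rewrite mulrBl mul1r wy mulrBr mulr1 mulrBl yv mulrDl sv addr0.
have -> : q * y * p * (p * n * p * y * q) = schur by rewrite !mulrA -[_ * p * p]mulrA pp.
have yE : y = p * y * p + p * y * q + (q * y * p + q * y * q).
  by rewrite -!splitr -split.
rewrite {1}yE {yE}.
move: (p * y * p) (p * y * q) (q * y * p) (q * y * q) => a b c d.
rewrite addrK opprD (addrC c d) !addrA addrK -!addrA; congr (a + _).
by rewrite (addrC b) -!addrA addNr addr0.
Qed.

Lemma corner_unipotent (w : T) : w * w = 0 -> (1 - w) * (1 + w) = 1 /\ (1 + w) * (1 - w) = 1.
Proof.
move=> ww; split.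
  by rewrite mulrBl mul1r mulrDr mulr1 ww addr0 addrK.
by rewrite mulrBr mulr1 mulrDl mul1r ww addr0 addrK.
Qed.

Lemma corner_row_sq : (q * y * p * n * p) * (q * y * p * n * p) = 0.
Proof. by rewrite !mulrA -[_ * p * q]mulrA pq mulr0 !mul0r. Qed.

Lemma corner_col_sq : (p * n * p * y * q) * (p * n * p * y * q) = 0.
Proof. by rewrite !mulrA -[_ * q * p]mulrA qp mulr0 !mul0r. Qed.

(** When the Schur complement vanishes, the first block row and column determine [y]. *)
Lemma corner_full : q * y * q = schur -> y = y * p * n * p * y.
Proof.
move=> E; rewrite corner_mul_rows -E [LHS]split -addrA; congr (_ + _).
exact: splitr.
Qed.

End Corner.

Section RankCorner.
Variables (C : fieldType) (m : nat).
Implicit Types p y : 'M[C]_m.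

Definition corner p y : 'M[C]_m := p *m y *m p + (1%:M - p).

Definition schurmx p y : 'M[C]_m := schur p (1%:M - p) y (invmx (corner p y)).

Lemma schurmxE p y : schurmx p y =
  (1%:M - p) *m y *m p *m invmx (corner p y) *m p *m y *m (1%:M - p).
Proof. by []. Qed.

Lemma corner_factor p y : p *m p = p -> corner p y \in unitmx ->
  exists W V, [/\ W \in unitmx, V \in unitmx,
    W = 1%:M + (1%:M - p) *m y *m p *m invmx (corner p y) *m p,
    V = 1%:M + p *m invmx (corner p y) *m p *m y *m (1%:M - p) &
    y = W *m (p *m y *m p + ((1%:M - p) *m y *m (1%:M - p) - schurmx p y)) *m V].
Proof.
move=> pp Bu; have nB : invmx (corner p y) *m corner p y = 1%:M by rewrite mulVmx.
have Bn : corner p y *m invmx (corner p y) = 1%:M by rewrite mulmxV.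
have [w1 w2] := corner_unipotent (corner_row_sq y (invmx (corner p y)) pp erefl).
have [v1 v2] := corner_unipotent (corner_col_sq y (invmx (corner p y)) pp erefl).
have E := corner_elim pp erefl nB Bn.
exists (1%:M + (1%:M - p) *m y *m p *m invmx (corner p y) *m p).
exists (1%:M + p *m invmx (corner p y) *m p *m y *m (1%:M - p)).
split=> //; first by case/mulmx1_unit: w1.
  by case/mulmx1_unit: v1.
rewrite -[RHS]/((_ * (_ + (_ * _ * _ - schur p (1%:M - p) y (invmx (corner p y))))) * _) -E.
by rewrite !mulrA w2 mul1r -mulrA v1 mulr1.
Qed.

(** By elimination, [y] has the rank of the sum of an invertible matrix on the range of
    [p] and of the Schur complement; equality with the rank of [p] forces the latter
    to be zero. *)
Lemma rank_corner p y : p *m p = p -> corner p y \in unitmx -> \rank y = \rank p ->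
  (1%:M - p) *m y *m (1%:M - p) = schurmx p y.
Proof.
move=> pp Bu ry; apply/eqP; rewrite -subr_eq0; apply/eqP.
set q := 1%:M - p; set D := _ - schurmx p y.
have pq : p *m q = 0 by rewrite mulmxBr mulmx1 pp subrr.
have qp : q *m p = 0 by rewrite mulmxBl mul1mx pp subrr.
have pD : p *m D = 0.
  by rewrite /D mulmxBr schurmxE -/q !mulmxA pq !mul0mx subrr.
have Dp : D *m p = 0.
  by rewrite /D mulmxBl schurmxE -/q -!mulmxA qp !mulmx0 subrr.
have [W [V [Wu Vu _ _ yE]]] := corner_factor pp Bu.
have nB : invmx (corner p y) *m corner p y = 1%:M by rewrite mulVmx.
have Bn : corner p y *m invmx (corner p y) = 1%:M by rewrite mulmxV.
pose S : 'M[C]_m := p + D.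
have E : invmx (corner p y) *m (p *m y *m p + D) = S.
  rewrite mulmxDr -[invmx _ *m (_ *m _ *m _)]/(_ * (_ * _ * _)) (corner_Vmul pp erefl nB); congr (_ + _).
  have -> : D = q *m D by rewrite mulmxBl mul1mx pD subr0.
  by rewrite mulmxA -[invmx _ *m _]/(_ * _) (corner_invq pp erefl nB).
have rE : \rank S = \rank p.
  rewrite -E (eqmxMfull _ _) ?row_full_unit ?unitmx_inv//.
  rewrite -ry [in RHS]yE mxrankMfree ?row_free_unit//.
  by rewrite (eqmxMfull _ _) ?row_full_unit.
have sub : (p <= S)%MS.
  by apply/submxP; exists p; rewrite /S mulmxDr pp pD addr0.
have : (S <= p)%MS.
  by rewrite -(geq_leqif (mxrank_leqif_sup sub)) rE.
move=> pDp; have : (D <= p)%MS.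
  rewrite -[D](addKr p) addrC; apply: addmx_sub => //.
  by rewrite -scaleN1r scalemx_sub.
by move=> /submxP[X DE]; rewrite -[LHS]subr0 -Dp {2}DE -mulmxA pp -DE subrr.
Qed.

End RankCorner.

(** * The space of Hermitian block-diagonal matrices *)

Lemma Cm_on_sum (R : realType) (V W : normedModType R) (U : set V) (I : Type)
    (r : seq I) m (f : I -> V -> W) : open U ->
  (forall i, Cm_on m U (f i)) -> Cm_on m U (fun x => \sum_(i <- r) f i x).
Proof.
move=> oU Cf; elim: r => [|i r IHr].
  by under eq_fun do rewrite big_nil; exact: Cm_on_cst.
by under eq_fun do rewrite big_cons; exact: Cm_onD.
Qed.

Lemma entry_le_mx_norm (K : numDomainType) p q (M : 'M[K]_(p, q)) a b :
  `|M a b| <= mx_norm M.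
Proof.
rewrite mx_normE -[leLHS]nngE num_le; exact: (le_bigmax _ _ (a, b)).
Qed.

Section SaSpace.
Variables (R : realType) (k : nat) (n_ : 'I_k -> nat).
Local Notation C := R[i].
Local Notation m := (\sum_i n_ i)%N.
Local Notation A := (@blockalg R k n_).
Local Notation sa := (sa R n_).
Implicit Types M N : 'M[C]_m.

Lemma samxE M : (M \in @samx R k n_) = (M \in A) && (M^t* == M).
Proof. by apply/samxP/andP => -[e1 e2]; split; exact/eqP. Qed.

Lemma sa_alg (x : sa) : sa_val x \in A.
Proof. by have := sa_valP x; rewrite samxE => /andP[]. Qed.

Lemma sa_herm (x : sa) : (sa_val x)^t* = sa_val x.
Proof. by have := sa_valP x; rewrite samxE => /andP[_ /eqP]. Qed.

Lemma sa_valD (x y : sa) : sa_val (x + y) = sa_val x + sa_val y. Proof. by []. Qed.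
Lemma sa_valB (x y : sa) : sa_val (x - y) = sa_val x - sa_val y. Proof. by []. Qed.
Lemma sa_valZ c (x : sa) : sa_val (c *: x) = c%:C *: sa_val x. Proof. by []. Qed.

Lemma sa_val_sum (I : Type) (r : seq I) (P : pred I) (f : I -> sa) :
  sa_val (\sum_(i <- r | P i) f i) = \sum_(i <- r | P i) sa_val (f i).
Proof. by rewrite (big_morph _ sa_valD (erefl _)). Qed.

Lemma sa_entry_norm (x : sa) a b : `|sa_val x a b| <= (`|x|)%:C.
Proof.
rewrite -[(`|x|)%:C]/((sa_norm x)%:C) sa_normE.
exact: entry_le_mx_norm.
Qed.

Lemma norm_Re (z : C) : (`|complex.Re z|)%:C <= `|z|.
Proof. exact: normc_ge_Re. Qed.

Lemma norm_Im (z : C) : (`|complex.Im z|)%:C <= `|z|.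
Proof.
rewrite normc_def lecR -sqrtr_sqr; apply: ler_wsqrtr.
by rewrite lerDr sqr_ge0.
Qed.

(** The projection onto Hermitian block-diagonal matrices: using it in [sa_proj], maps
    with values in [sa] need no membership proof, and remain real-linear in the matrix. *)
Definition hermpart M : 'M[C]_m :=
  \mxdiag_i submxblock ((2^-1 : R)%:C *: (M + M^t*)) i i.

Lemma hermpart_sa M : hermpart M \in @samx R k n_.
Proof.
rewrite samxE blockalg_diag/=; apply/eqP.
have /eqP -> := blockalg_trmxC (blockalg_diag (fun i => submxblock ((2^-1 : R)%:C *: (M + M^t*)) i i)).
apply: eq_mxdiag => i; rewrite submxblock_trmxC submxblock_diag -submxblock_trmxC.
congr (submxblock _ i i); rewrite linearZ/= map_mxZ/= trmxCD trmxCK addrC.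
by congr (_ *: _); apply/eqP; rewrite eq_complex/= oppr0 !eqxx.
Qed.

Definition sa_proj M : sa := Sa (hermpart_sa M).

Lemma sa_projK M : M \in A -> M^t* = M -> sa_val (sa_proj M) = M.
Proof.
move=> /eqP MA hM; rewrite /= /hermpart hM [RHS]MA; apply: eq_mxdiag => i.
congr (submxblock _ i i); have -> : M + M = (2%:R : C) *: M by rewrite scaler_nat mulr2n.
have -> : (2%:R : C) = (2%:R : R)%:C by rewrite rmorph_nat.
by rewrite scalerA -rmorphM mulVf ?pnatr_eq0// scale1r.
Qed.

Lemma sa_proj_val (x : sa) : sa_proj (sa_val x) = x.
Proof. by apply: val_inj; rewrite /= -[RHS](sa_projK (sa_alg x) (sa_herm x)). Qed.

Lemma sa_projD M N : sa_proj (M + N) = sa_proj M + sa_proj N.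
Proof.
apply: val_inj; rewrite /= /hermpart -mxdiagD; apply: eq_mxdiag => i.
rewrite -submxblockD -scalerDr; congr (submxblock (_ *: _) i i).
by rewrite trmxCD addrACA.
Qed.

Lemma sa_projZ (c : R) M : sa_proj (c%:C *: M) = c *: sa_proj M.
Proof.
apply: val_inj; rewrite /= /hermpart.
have -> : (c%:C *: M)^t* = c%:C *: M^t*.
  rewrite linearZ/= map_mxZ/=; congr (_ *: _).
  by apply/eqP; rewrite eq_complex/= oppr0 !eqxx.
rewrite -scalerDr scalerA mulrC -scalerA.
have /eqP -> : c%:C *: \mxdiag_i submxblock ((2^-1 : R)%:C *: (M + M^t*)) i i \in A.
  by apply: blockalgZ; exact: blockalg_diag.
have subZ z X i : submxblock (z *: X) i i = z *: submxblock X i i :> 'M[C]_(n_ i).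
  by apply/matrixP => a b; rewrite !mxE.
by apply: eq_mxdiag => i; rewrite subZ [in RHS]subZ submxblock_diag.
Qed.

Lemma complex_rect (z : C) : z = (complex.Re z)%:C + (complex.Im z)%:C * 'i%C.
Proof. by case: z => a b; apply/eqP; rewrite eq_complex/= !(mulr0, mulr1, mul0r, subr0, addr0, add0r) !eqxx. Qed.

Lemma sa_projE M : sa_proj M = \sum_a \sum_b
  (complex.Re (M a b) *: sa_proj (delta_mx a b) + complex.Im (M a b) *: sa_proj ('i%C *: delta_mx a b)).
Proof.
have sa_proj0 : sa_proj 0 = 0 by rewrite -[0 in LHS](scale0r (0 : 'M[C]_m)) -[0 in LHS](rmorph0 (real_complex R)) sa_projZ scale0r.
rewrite {1}[M]matrix_sum_delta (big_morph _ sa_projD sa_proj0); apply: eq_bigr => a _.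
rewrite (big_morph _ sa_projD sa_proj0); apply: eq_bigr => b _.
by rewrite {1}[M a b]complex_rect scalerDl -scalerA sa_projD !sa_projZ.
Qed.

Lemma sa_linearE (W : lmodType R) (f : {linear sa -> W}) M : f (sa_proj M) = \sum_a \sum_b
  (complex.Re (M a b) *: f (sa_proj (delta_mx a b)) +
   complex.Im (M a b) *: f (sa_proj ('i%C *: delta_mx a b))).
Proof.
rewrite {1}[sa_proj M]sa_projE raddf_sum; apply: eq_bigr => a _.
by rewrite raddf_sum; apply: eq_bigr => b _; rewrite [LHS]linearD !linearZ_LR.
Qed.

Lemma sa_linear_bounded (W : normedModType R) (f : {linear sa -> W}) :
  exists2 c, 0 < c & forall x, `|f x| <= c * `|x|.
Proof.
pose c := \sum_a \sum_b (`|f (sa_proj (delta_mx a b))| + `|f (sa_proj ('i%C *: delta_mx a b))|).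
have c0 : 0 <= c by apply: sumr_ge0 => a _; apply: sumr_ge0 => b _; apply: addr_ge0.
exists (1 + c) => [|x]; first by rewrite ltr_pwDl.
rewrite mulrDl mul1r (le_trans _ (_ : c * `|x| <= _))//; last by rewrite lerDr.
rewrite -{1}[x]sa_proj_val sa_linearE /c mulr_suml (le_trans (ler_norm_sum _ _ _))//.
apply: ler_sum => a _; rewrite mulr_suml (le_trans (ler_norm_sum _ _ _))//.
apply: ler_sum => b _; rewrite (le_trans (ler_normD _ _))// mulrDl !normrZ.
by apply: lerD; rewrite mulrC; apply: ler_wpM2l => //; rewrite -lecR;
  apply: le_trans (sa_entry_norm x a b); [exact: norm_Re|exact: norm_Im].
Qed.

Lemma sa_linear_continuous (W : normedModType R) (f : {linear sa -> W}) : continuous f.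
Proof.
apply/linear_bounded_continuous/linear_boundedP.
have [c c0 fc] := sa_linear_bounded f.
apply: filterS (nbhs_pinfty_ge (gtr0_real c0)) => r cr x.
by apply: le_trans (fc x) _; exact: ler_wpM2r.
Qed.

(** The values of [f] on a real basis of the matrices reduce the claim to scalar
    functions. *)
Lemma smooth_sa_proj (V W : normedModType R) (U : set V) (M : V -> 'M[C]_m)
    (f : {linear sa -> W}) (w : W) : open U ->
  mxfun [set g : V -> R | smooth_on U g] M -> smooth_on U (fun v => f (sa_proj (M v)) + w).
Proof.
move=> oU sM l; under eq_fun do rewrite sa_linearE.
apply: Cm_onD => //; last exact: Cm_on_cst.
apply: Cm_on_sum => // a; apply: Cm_on_sum => // b; have [s1 s2] := sM a b.
by apply: Cm_onD => //; apply: Cm_onZl.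
Qed.

Definition sa_re a b (x : sa) : R := complex.Re (sa_val x a b).
Definition sa_im a b (x : sa) : R := complex.Im (sa_val x a b).

Fact sa_re_linear a b : linear (sa_re a b).
Proof.
move=> c x y; rewrite /sa_re sa_valD sa_valZ !mxE raddfD/=; congr (_ + _).
by case: (sa_val x a b) => u v /=; rewrite mul0r subr0.
Qed.
Fact sa_im_linear a b : linear (sa_im a b).
Proof.
move=> c x y; rewrite /sa_im sa_valD sa_valZ !mxE raddfD/=; congr (_ + _).
by case: (sa_val x a b) => u v /=; rewrite mul0r addr0.
Qed.
HB.instance Definition _ a b := GRing.isLinear.Build R sa R _ (sa_re a b) (sa_re_linear a b).
HB.instance Definition _ a b := GRing.isLinear.Build R sa R _ (sa_im a b) (sa_im_linear a b).

Lemma smooth_sa_entries (U : set sa) : open U ->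
  mxfun [set g : sa -> R | smooth_on U g] (fun x => sa_val x).
Proof.
move=> oU a b; split=> l.
  exact: (Cm_on_linear oU _ (@sa_linear_continuous R (sa_re a b))).
exact: (Cm_on_linear oU _ (@sa_linear_continuous R (sa_im a b))).
Qed.

Lemma rV_smooth_coord (N : nat) (U : set 'rV[R]_N) j : open U ->
  smooth_on U (fun w : 'rV[R]_N => w 0 j : R).
Proof.
move=> oU l.
have @f : {linear 'rV[R]_N -> R}.
  by exists (fun w : 'rV[R]_N => w 0 j); do 2![eexists]; do ?[constructor];
     rewrite ?mxE// => ? *; rewrite ?mxE//; move=> ?; rewrite !mxE.
rewrite (_ : (fun _ => _) = f) //; apply: Cm_on_linear => //; exact: coord_continuous.
Qed.

Lemma rV_entries (N : nat) (F : set ('rV[R]_N -> R)) (psi : {linear 'rV[R]_N -> sa}) (x0 : sa) :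
  function_algebra F -> (forall j, F (fun w => w 0 j)) ->
  mxfun F (fun w => sa_val (psi w + x0)).
Proof.
move=> algF Fw.
have E w : sa_val (psi w + x0) = \sum_j (w 0 j)%:C *: sa_val (psi (delta_mx 0 j)) + sa_val x0.
  rewrite sa_valD {1}[w]row_sum_delta linear_sum sa_val_sum; congr (_ + _).
  by apply: eq_bigr => j _; rewrite linearZ_LR sa_valZ.
rewrite (funext E); apply: mxfunD => //; last exact: mxfun_cst.
apply: mxfun_sum => // j _; apply: mxfunZ => //; last exact: mxfun_cst.
by apply: cfun_real.
Qed.

Lemma smooth_rV_entries (N : nat) (U : set 'rV[R]_N) (psi : {linear 'rV[R]_N -> sa}) (x0 : sa) : open U ->
  mxfun [set g : 'rV[R]_N -> R | smooth_on U g] (fun w => sa_val (psi w + x0)).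
Proof.
move=> oU; apply: rV_entries; first exact: smooth_algebra.
by move=> j; exact: rV_smooth_coord.
Qed.

Lemma sa_coordinates : exists (N : nat) (phi : {linear sa -> 'rV[R]_N})
  (psi : {linear 'rV[R]_N -> sa}), cancel phi psi /\ cancel psi phi.
Proof.
pose iota (x : sa) : 'rV[R]_(m * m + m * m) :=
  row_mx (mxvec (map_mx (@complex.Re R) (sa_val x))) (mxvec (map_mx (@complex.Im R) (sa_val x))).
pose pi (r : 'rV[R]_(m * m + m * m)) : sa :=
  \sum_a \sum_b (vec_mx (lsubmx r) a b *: sa_proj (delta_mx a b) +
                 vec_mx (rsubmx r) a b *: sa_proj ('i%C *: delta_mx a b)).
have iL : linear iota.
  move=> c x y; rewrite /iota sa_valD sa_valZ.
  rewrite scale_row_mx add_row_mx -!linearP; congr (row_mx (mxvec _) (mxvec _)).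
    apply/matrixP => a b; rewrite !mxE raddfD/=; congr (_ + _).
    by case: (sa_val x a b) => u v /=; rewrite mul0r subr0.
  apply/matrixP => a b; rewrite !mxE raddfD/=; congr (_ + _).
  by case: (sa_val x a b) => u v /=; rewrite mul0r addr0.
have pL : linear pi.
  move=> c r s; rewrite /pi scaler_sumr -big_split/=; apply: eq_bigr => a _.
  rewrite scaler_sumr -big_split/=; apply: eq_bigr => b _.
  by rewrite !linearP/= !mxE !scalerDl !scalerA addrACA [in RHS]mulrC.
pose iotaM := GRing.isLinear.Build _ _ _ _ _ iL.
pose iotaL : {linear sa -> 'rV[R]_(m * m + m * m)} := HB.pack iota iotaM.
pose piM := GRing.isLinear.Build _ _ _ _ _ pL.
pose piL : {linear 'rV[R]_(m * m + m * m) -> sa} := HB.pack pi piM.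
have iK : cancel iotaL piL.
  move=> x; rewrite -[RHS]sa_proj_val sa_projE /=; apply: eq_bigr => a _; apply: eq_bigr => b _.
  by rewrite /iota row_mxKl row_mxKr !mxvecK !mxE.
exact: coordinates_of_retract iK.
Qed.

End SaSpace.

(** * Semialgebraic subsets of R^N *)

Section SemialgebraicSets.
Variables (R : realType) (N : nat).
Implicit Types X Y : set 'rV[R]_N.

Lemma semialg_basic (c : poly_conds R N) : semialg (basic_semialg c).
Proof. by exists [:: c]; rewrite big_seq1. Qed.

Lemma semialg0 : semialg (set0 : set 'rV[R]_N).
Proof. by exists [::]; rewrite big_nil. Qed.

Lemma semialgU X Y : semialg X -> semialg Y -> semialg (X `|` Y).
Proof. by move=> [c ->] [d ->]; exists (c ++ d); rewrite big_cat. Qed.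

Lemma basic_semialgI (c d : poly_conds R N) :
  exists e, basic_semialg c `&` basic_semialg d = basic_semialg e.
Proof.
exists (c.1.1 ++ d.1.1, c.1.2 ++ d.1.2, c.2 ++ d.2).
apply/seteqP; split=> x /=.
  move=> [[c1 c2 c3] [d1 d2 d3]]; split=> p /=; rewrite mem_cat => /orP[];
  by [exact: c1|exact: d1|exact: c2|exact: d2|exact: c3|exact: d3].
by move=> [h1 h2 h3]; split; split=> p pc; [apply: h1|apply: h2|apply: h3|apply: h1|apply: h2|apply: h3];
  rewrite /= mem_cat pc ?orbT.
Qed.

Lemma semialgI X Y : semialg X -> semialg Y -> semialg (X `&` Y).
Proof.
move=> [cs ->] [ds ->]; elim: cs => [|c cs IHcs].
  by rewrite big_nil set0I; exact: semialg0.
rewrite big_cons setIUl; apply: semialgU => //.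
elim: {IHcs} ds => [|d ds IHds]; first by rewrite big_nil setI0; exact: semialg0.
rewrite big_cons setIUr; apply: semialgU => //.
by have [e ->] := basic_semialgI c d; exact: semialg_basic.
Qed.

Lemma semialgT : semialg (setT : set 'rV[R]_N).
Proof.
have -> : setT = basic_semialg ([::], [::], [::]) :> set 'rV[R]_N.
  by apply/seteqP; split=> // x _; split.
exact: semialg_basic.
Qed.

Lemma semialg_forall (I : finType) (X : I -> set 'rV[R]_N) :
  (forall i, semialg (X i)) -> semialg [set w | forall i, X i w].
Proof.
move=> sX; have -> : [set w | forall i, X i w] = \big[setI/setT]_(i <- enum I) X i.
  rewrite -bigcap_seq; apply/seteqP; split=> w /= Xw i; first by move=> _; exact: Xw.
  by apply: Xw => /=; rewrite mem_enum.
by elim/big_ind: _ => //; [exact: semialgT|exact: semialgI].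
Qed.

Definition polynomial_fun : set ('rV[R]_N -> R) :=
  [set f : 'rV[R]_N -> R | exists p : mpoly N R, forall w : 'rV[R]_N, f w = meval (w 0) p].

Lemma polynomial_algebra : function_algebra polynomial_fun.
Proof.
split=> [a|f g [p fp] [q gq]|f g [p fp] [q gq]].
- by exists (mpolyC N a) => w; rewrite mevalC.
- by exists (p + q) => w; rewrite mevalD fp gq.
- by exists (p * q) => w; rewrite mevalM fp gq.
Qed.

Lemma polynomial_coord j : polynomial_fun (fun w => w 0 j).
Proof. by exists (mpolyX R (mnm1 j)) => w; rewrite mevalXU. Qed.

Lemma semialg_ge0 f : polynomial_fun f -> semialg [set w | 0 <= f w].
Proof.
move=> [p fp]; have -> : [set w | 0 <= f w] = basic_semialg ([::], [:: p], [::]).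
  apply/seteqP; split=> w /=; first by move=> fw; split=> // q; rewrite inE => /eqP ->; rewrite -fp.
  by move=> [_ h _]; rewrite fp; apply: h; rewrite inE.
exact: semialg_basic.
Qed.

Lemma semialg_gt0 f : polynomial_fun f -> semialg [set w | 0 < f w].
Proof.
move=> [p fp]; have -> : [set w | 0 < f w] = basic_semialg ([::], [::], [:: p]).
  apply/seteqP; split=> w /=; first by move=> fw; split=> // q; rewrite inE => /eqP ->; rewrite -fp.
  by move=> [_ _ h]; rewrite fp; apply: h; rewrite inE.
exact: semialg_basic.
Qed.

Lemma semialg_eq0 f : polynomial_fun f -> semialg [set w | f w = 0].
Proof.
move=> [p fp]; have -> : [set w | f w = 0] = basic_semialg ([:: p], [::], [::]).
  apply/seteqP; split=> w /=; first by move=> fw; split=> // q; rewrite inE => /eqP ->; rewrite -fp.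
  by move=> [h _ _]; rewrite fp; apply: h; rewrite inE.
exact: semialg_basic.
Qed.

End SemialgebraicSets.

Lemma open_forall (T : topologicalType) (I : finType) (X : I -> set T) :
  (forall i, open (X i)) -> open [set w | forall i, X i w].
Proof.
move=> sX; have -> : [set w | forall i, X i w] = \big[setI/setT]_(i <- enum I) X i.
  rewrite -bigcap_seq; apply/seteqP; split=> w /= Xw i; first by move=> _; exact: Xw.
  by apply: Xw => /=; rewrite mem_enum.
by elim/big_ind: _ => //; [exact: openT|exact: openI].
Qed.

Lemma smooth_open_gt0 (R : realType) (V : normedModType R) (U : set V) (f : V -> R) : open U ->
  smooth_on U f -> open (U `&` [set x | 0 < f x]).
Proof.
move=> oU sf; rewrite openE => x [Ux fx]; apply: filterI; first exact: open_nbhs_nbhs.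
have cf := smooth_on_continuous sf Ux.
have : nbhs (f x) [set y : R | 0 < y] by apply: open_nbhs_nbhs; split => //; exact: open_gt.
exact: cf.
Qed.

Section Coefficients.
Variables (R : realType) (T : Type) (F : set (T -> R)).
Hypothesis algF : function_algebra F.

Lemma fun_char_coef n (M : T -> 'M[R[i]]_n) l : mxfun F M ->
  F (fun x => complex.Re (char_poly (- M x))`_l).
Proof.
move=> cM; have : mxfun F (fun x => - M x).
  have -> : (fun x => - M x) = (fun x => (-1) *: M x) by apply/funext => x; rewrite scaleN1r.
  by apply: mxfunZ => //; exact: cfun_cst.
by move=> /(polyfun_char_poly algF)/(_ l)[].
Qed.

Lemma funN f : F f -> F (fun x => - f x).
Proof.
move=> Ff; have -> : (fun x => - f x) = (fun x => -1 * f x).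
  by apply/funext => x; rewrite mulN1r.
by apply: funM => //; exact: fun_cst.
Qed.
End Coefficients.

(** * The strata: semialgebraic and locally closed *)

Section Strata.
Variables (R : realType) (k : nat) (n_ : 'I_k -> nat).
Local Notation C := R[i].
Local Notation m := (\sum_i n_ i)%N.
Local Notation A := (@blockalg R k n_).
Local Notation sa := (sa R n_).
Local Notation D := (density R n_).

Definition char_coef (l : nat) (x : sa) : R :=
  complex.Re (char_poly (- sa_val x))`_l.

Definition block_coef i (l : nat) (x : sa) : R :=
  complex.Re (char_poly (- submxblock (sa_val x) i i))`_l.

Definition trace_re (x : sa) : R := complex.Re (\tr (sa_val x)).

Lemma Re_ge0 (z : C) : z \is Num.real -> (0 <= complex.Re z) = (0 <= z).
Proof. by move=> zr; rewrite -[in RHS](RRe_real zr) lecR. Qed.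

Lemma Re_gt0 (z : C) : z \is Num.real -> (0 < complex.Re z) = (0 < z).
Proof. by move=> zr; rewrite -[in RHS](RRe_real zr) ltcR. Qed.

Lemma tr_sa_real (x : sa) : \tr (sa_val x) \is Num.real.
Proof. exact/herm_tr_real/sa_herm. Qed.

(** The coefficients of index above the size of the matrix are zero. *)
Lemma densityP x : D x <-> (forall l : 'I_m.+1, 0 <= char_coef l x) /\ trace_re x - 1 = 0.
Proof.
split=> [[px tx]|[px /subr0_eq tx]].
  by split=> [l|]; [rewrite Re_ge0 ?char_poly_real ?psd_char_poly_ge0 ?sa_herm|
    rewrite /trace_re tx subrr].
split; last by rewrite -(RRe_real (tr_sa_real x)) -/(trace_re x) tx.
apply: char_poly_ge0_psd; first exact: sa_herm.
move=> l; have [lm|ml] := ltnP l m.+1; last by rewrite nth_default// size_char_poly.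
by have := px (Ordinal lm); rewrite Re_ge0// char_poly_real// sa_herm.
Qed.

Lemma block_rank_geP x i r : D x ->
  (r <= block_rank (sa_val x) i)%N = (r <= n_ i)%N && (0 < block_coef i (n_ i - r) x).
Proof.
move=> [px _]; have pb := block_psd i px.
by rewrite /block_rank psd_rank_ge// Re_gt0// char_poly_real// psd_herm.
Qed.

Definition stratum (r : {ffun 'I_k -> 'I_m.+1}) : set sa :=
  D `&` [set x | forall i, block_rank (sa_val x) i = r i].

Definition rank_above i r : set sa := [set x | (r <= n_ i)%N /\ 0 < block_coef i (n_ i - r) x].

Lemma stratumE r : stratum r = D `&` [set x | forall i, rank_above i (r i) x] `&`
  ~` [set x | exists i, rank_above i (r i).+1 x].
Proof.
have E x i s : D x -> rank_above i s x <-> (s <= block_rank (sa_val x) i)%N.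
  by move=> Dx; rewrite block_rank_geP//; split=> [[-> ->]|/andP].
apply/seteqP; split=> x /=.
  move=> [Dx rx]; split; first by split=> // i; apply/E => //; rewrite rx.
  by move=> [j /(E _ _ _ Dx)]; rewrite rx ltnn.
move=> [[Dx r1] r2]; split=> // i; apply/eqP; rewrite eqn_leq.
apply/andP; split; last by apply/E.
by rewrite leqNgt; apply/negP => /(E _ _ _ Dx) h; apply: r2; exists i.
Qed.

Section Algebra.
Variables (T : Type) (F : set (T -> R)) (X : T -> sa).
Hypothesis algF : function_algebra F.
Hypothesis XF : mxfun F (fun t => sa_val (X t)).

Lemma fun_char_coef_sa l : F (fun t => char_coef l (X t)).
Proof. exact: fun_char_coef. Qed.

Lemma fun_block_coef i l : F (fun t => block_coef i l (X t)).
Proof. by apply: (@fun_char_coef _ _ _ algF _ (fun t => submxblock (sa_val (X t)) i i)); exact: mxfun_sub. Qed.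

Lemma fun_trace_re : F (fun t => trace_re (X t)).
Proof. by have [] := cfun_tr algF XF. Qed.

End Algebra.

Lemma semialgebraic_coord N (phi : {linear sa -> 'rV[R]_N}) (psi : {linear 'rV[R]_N -> sa}) X :
  cancel phi psi -> cancel psi phi -> semialg [set w | X (psi w)] -> semialgebraic X.
Proof.
move=> phiK psiK sX; exists N, phi; split; first by exists psi.
suff -> : phi @` X = [set w | X (psi w)] by [].
apply/seteqP; split=> w /=; first by move=> [x Xx <-]; rewrite phiK.
by move=> Xw; exists (psi w).
Qed.

Lemma semialg_density N (psi : {linear 'rV[R]_N -> sa}) : semialg [set w | D (psi w)].
Proof.
have PA := @polynomial_algebra R N.
have XF : mxfun (@polynomial_fun R N) (fun w => sa_val (psi w)).
  have := rV_entries psi 0 PA (@polynomial_coord R N).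
  by congr mxfun; apply/funext => w; rewrite addr0.
have -> : [set w | D (psi w)] =
    [set w | forall l : 'I_m.+1, 0 <= char_coef l (psi w)] `&` [set w | trace_re (psi w) - 1 = 0].
  by apply/seteqP; split=> w /=; [move/densityP|move=> ?; apply/densityP].
apply: semialgI.
  apply: (semialg_forall (X := fun l : 'I_m.+1 => [set w | 0 <= char_coef l (psi w)])) => l.
  by apply: semialg_ge0; exact: fun_char_coef_sa.
apply: semialg_eq0; apply: funD => //; first exact: fun_trace_re.
exact: fun_cst.
Qed.

Lemma semialg_stratum N (psi : {linear 'rV[R]_N -> sa}) r : semialg [set w | stratum r (psi w)].
Proof.
have PA := @polynomial_algebra R N.
have XF : mxfun (@polynomial_fun R N) (fun w => sa_val (psi w)).
  have := rV_entries psi 0 PA (@polynomial_coord R N).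
  by congr mxfun; apply/funext => w; rewrite addr0.
have -> : [set w | stratum r (psi w)] = [set w | D (psi w)] `&`
    [set w | forall i, rank_above i (r i) (psi w)] `&`
    [set w | forall i, ~ rank_above i (r i).+1 (psi w)].
  rewrite stratumE; apply/seteqP; split=> w /= [[h1 h2] h3].
    by split=> // i ?; apply: h3; exists i.
  by split=> // -[j]; exact: h3.
apply: semialgI; first apply: semialgI; first exact: semialg_density.
  apply: (semialg_forall (X := fun i => [set w | rank_above i (r i) (psi w)])) => i.
  have [rn|/negP rn] := boolP (r i <= n_ i)%N.
    have -> : [set w | rank_above i (r i) (psi w)] = [set w | 0 < block_coef i (n_ i - r i) (psi w)].
      by apply/seteqP; split=> w; [case|].
    by apply: semialg_gt0; exact: fun_block_coef.
  rewrite (_ : [set w | _] = set0); first exact: semialg0.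
  by apply/seteqP; split=> // w [].
apply: (semialg_forall (X := fun i => [set w | ~ rank_above i (r i).+1 (psi w)])) => i.
have [rn|/negP rn] := boolP (r i < n_ i)%N; last first.
  rewrite (_ : [set w | _] = setT); first exact: semialgT.
  by apply/seteqP; split=> // w _ [].
have -> : [set w | ~ rank_above i (r i).+1 (psi w)] = [set w | 0 <= - block_coef i (n_ i - (r i).+1) (psi w)].
  apply/seteqP; split=> w /=; rewrite oppr_ge0.
    by move=> h; rewrite leNgt; apply/negP => h'; apply: h.
  by move=> h [_]; rewrite ltNge h.
by apply: semialg_ge0; apply: funN => //; exact: fun_block_coef.
Qed.

Lemma open_gt0 (f : sa -> R) : smooth_on setT f -> open [set x | 0 < f x].
Proof. by move=> sf; rewrite -[X in open X]setTI; apply: smooth_open_gt0 => //; exact: openT. Qed.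

Let SA := smooth_algebra (@openT sa).
Let SE := @smooth_sa_entries R k n_ setT openT.

Lemma open_rank_above i r : open (rank_above i r).
Proof.
have [rn|/negP rn] := boolP (r <= n_ i)%N; last first.
  by rewrite (_ : rank_above i r = set0); [exact: open0|apply/seteqP; split=> // x []].
have -> : rank_above i r = [set x | 0 < block_coef i (n_ i - r) x].
  by apply/seteqP; split=> x //; case.
by apply: open_gt0; exact: (fun_block_coef SA SE).
Qed.

Lemma closed_density : closed D.
Proof.
rewrite -[D]setCK; apply: open_closedC.
have -> : ~` D = (\bigcup_(l : 'I_m.+1) [set x | 0 < - char_coef l x]) `|`
    ([set x | 0 < trace_re x - 1] `|` [set x | 0 < - (trace_re x - 1)]).
  apply/seteqP; split=> x /=.
    move=> nD; apply: contrapT => h; apply: nD; apply/densityP; split.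
      move=> l; rewrite leNgt; apply/negP => cl; apply: h; left; exists l => //=.
      by rewrite oppr_gt0.
    apply/eqP; rewrite eq_le -oppr_ge0 !leNgt; apply/andP; split; apply/negP => h'; apply: h; right.
      by left; rewrite oppr_lt0 in h'.
    by right; rewrite /= oppr_gt0.
  move=> h /densityP[h1 h2]; move: h; rewrite h2 oppr0 ltxx => -[[l _]|[]//].
  by rewrite /= oppr_gt0 ltNge h1.
have sT : smooth_on setT (fun x => trace_re x - 1).
  by apply: (funD SA); [exact: (fun_trace_re SA SE)|exact: (fun_cst SA)].
apply: openU; last apply: openU.
- apply: bigcup_open => l _; apply: open_gt0; apply: (funN SA).
  exact: (fun_char_coef_sa SA SE).
- exact: open_gt0.
- by apply: open_gt0; exact: (funN SA).
Qed.

Lemma stratum_locally_closed r : exists U F : set sa, [/\ open U, closed F & stratum r = D `&` U `&` F].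
Proof.
exists [set x | forall i, rank_above i (r i) x], (~` [set x | exists i, rank_above i (r i).+1 x]).
split; last exact: stratumE.
  by apply: (open_forall (X := fun i => rank_above i (r i))) => i; exact: open_rank_above.
apply: open_closedC.
have -> : [set x | exists i, rank_above i (r i).+1 x] = \bigcup_i (rank_above i (r i).+1).
  by apply/seteqP; split=> x /= [j]; [move=> h; exists j|move=> _ h; exists j].
by apply: bigcup_open => i _; exact: open_rank_above.
Qed.

End Strata.

(** * Congruence action and frontier condition *)

Lemma psd_tr_eq0 (R : realType) n (x : 'M[R[i]]_n) : psdmx x -> \tr x = 0 -> x = 0.
Proof.
move=> /psd_spectral[U [d [U1 U2 d0 xE]]] tx.
have /eqP : \sum_i d 0 i = 0.
  rewrite -mxtrace_diag -tx xE -mulmxA mxtrace_mulC -mulmxA U1 mulmx1.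
  by [].
rewrite psumr_eq0; last by move=> i _; exact: d0.
move=> /allP d00; have d_0 : d = 0.
  apply/rowP => i; rewrite [RHS]mxE.
  by apply/eqP; apply: d00; rewrite mem_index_enum.
by rewrite xE d_0 linear0 mulmx0 mul0mx.
Qed.

Section Action.
Variables (R : realType) (k : nat) (n_ : 'I_k -> nat).
Local Notation C := R[i].
Local Notation m := (\sum_i n_ i)%N.
Local Notation A := (@blockalg R k n_).
Local Notation sa := (sa R n_).
Local Notation D := (density R n_).

Local Notation S := (@stratum R k n_).
Implicit Types g : 'M[C]_m.

Definition act (g : 'M[C]_m) (x : sa) : sa :=
  sa_proj ((\tr (g *m sa_val x *m g^t*))^-1 *: (g *m sa_val x *m g^t*)).

Lemma act_trace_gt0 g x : g \in unitmx -> D x -> 0 < \tr (g *m sa_val x *m g^t*).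
Proof.
move=> gu [px tx]; have pgx := psd_congr g px.
rewrite lt0r psd_tr_ge0// andbT; apply/eqP => /(psd_tr_eq0 pgx) gx0.
have x0 : sa_val x = 0.
  have gu' : g^t* \in unitmx by rewrite trmxC_unit.
  by rewrite -[LHS](mulKmx gu) -[g *m sa_val x](mulmxK gu') gx0 mul0mx mulmx0.
by move: tx; rewrite x0 mxtrace0 => /esym/eqP; rewrite oner_eq0.
Qed.

Lemma congr_sa g (x : sa) : g \in A -> g *m sa_val x *m g^t* \in A /\
  (g *m sa_val x *m g^t*)^t* = g *m sa_val x *m g^t*.
Proof.
move=> gA; split; first by rewrite !blockalgM ?blockalg_trmxC ?sa_alg.
by rewrite !trmxC_mul trmxCK sa_herm mulmxA.
Qed.

Lemma act_val g x : g \in A -> g \in unitmx -> D x ->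
  sa_val (act g x) = (\tr (g *m sa_val x *m g^t*))^-1 *: (g *m sa_val x *m g^t*).
Proof.
move=> gA gu Dx; have [gxA gxh] := congr_sa x gA; apply: sa_projK; first exact: blockalgZ.
rewrite linearZ/= map_mxZ/= gxh; congr (_ *: _).
by apply/CrealP; rewrite realV; apply: gtr0_real; exact: act_trace_gt0.
Qed.

Lemma act_stratum g r x : g \in A -> g \in unitmx -> S r x -> S r (act g x).
Proof.
move=> gA gu [Dx rx]; have t0 := act_trace_gt0 gu Dx; have [px tx] := Dx.
have ti0 : 0 <= (\tr (g *m sa_val x *m g^t*))^-1 by rewrite invr_ge0 ltW.
split; [split|].
- by rewrite (act_val gA gu Dx); exact: (psdZ ti0 (psd_congr g px)).
- by rewrite act_val// mxtraceZ mulVf// gt_eqF.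
- move=> i; rewrite act_val// !scalemxAl block_rank_mul ?blockalgZ ?blockalg_trmxC ?sa_alg ?trmxC_unit//.
  by rewrite unitmxZ// unitfE invr_eq0 gt_eqF.
Qed.

Lemma act_transitive r x y : S r x -> S r y ->
  exists g, [/\ g \in A, g \in unitmx & sa_val y = g *m sa_val x *m g^t*].
Proof.
move=> [[px tx] rx] [[py ty] ry].
by apply: block_psd_conj; rewrite ?sa_alg// => i; rewrite rx ry.
Qed.

Lemma actE g (x y : sa) : \tr (sa_val y) = 1 -> sa_val y = g *m sa_val x *m g^t* -> act g x = y.
Proof. by move=> ty yE; rewrite /act -yE ty invr1 scale1r sa_proj_val. Qed.

Lemma smooth_congr g : mxfun [set f : sa -> R | smooth_on setT f] (fun y : sa => g *m sa_val y *m g^t*).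
Proof.
have SA := smooth_algebra (@openT sa).
apply: mxfunM => //; last exact: mxfun_cst.
by apply: mxfunM => //; [exact: mxfun_cst|exact: (smooth_sa_entries openT)].
Qed.

Lemma act_continuous g x : g \in unitmx -> D x -> {for x, continuous (act g)}.
Proof.
move=> gu Dx; pose t (y : sa) := complex.Re (\tr (g *m sa_val y *m g^t*)).
pose U := [set y | 0 < t y].
have [st _] := cfun_tr (smooth_algebra (@openT sa)) (smooth_congr g).
have oU : open U by exact: open_gt0.
have Ux : U x.
  have := act_trace_gt0 gu Dx; rewrite -Re_gt0//.
  exact/gtr0_real/act_trace_gt0.
have SU := smooth_algebra oU.
have sM : mxfun [set f : sa -> R | smooth_on U f] (fun y : sa => g *m sa_val y *m g^t*).
  by apply: mxsmooth_sub (smooth_congr g).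
have sa : smooth_on U (fun y => (idfun : {linear sa -> sa}) (act g y) + 0).
  apply: smooth_sa_proj => //; apply: mxfunZ => //; apply: csmoothV => //; last exact: cfun_tr.
  move=> y Uy; apply/eqP => ty0; move: Uy; rewrite /U /t/= ty0.
  by rewrite ltxx.
have := smooth_on_continuous sa Ux.
by rewrite (_ : (fun y => _) = act g)//; apply/funext => y; rewrite addr0.
Qed.

(** Some [act g] takes a given point of the first stratum to any other one; it is
    continuous there and preserves the second stratum. *)
Lemma stratum_frontier r s : S r `&` closure (S s) !=set0 ->
  S r `<=` closure (S s).
Proof.
move=> [y [Sry cy]] z Srz; have [g [gA gu zE]] := act_transitive Sry Srz.
have [[Dy _] [[_ tz] _]] := (Sry, Srz).
have az : act g y = z by exact: actE.
move=> B; rewrite -az => /(act_continuous gu Dy) => nB.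
have [w [Sw Bw]] := cy _ nB; exists (act g w); split => //.
exact: act_stratum.
Qed.

Lemma stratum_decomposition : decomposition D (@stratum R k n_).
Proof.
split.
- apply/seteqP; split=> x /=; first by move=> [r _ []].
  move=> Dx; have rm i : (block_rank (sa_val x) i < m.+1)%N.
    rewrite ltnS (leq_trans (rank_leq_row _))//.
    by rewrite (bigD1 i)//= leq_addr.
  exists [ffun i => Ordinal (rm i)] => //; split=> // i /=; by rewrite ffunE.
- move=> r s rs; apply/seteqP; split=> // x [[_ rx] [_ sx]]; apply: rs.
  by apply/ffunP => i; apply: val_inj; rewrite /= -rx -sx.
- exact: stratum_locally_closed.
- by move=> x _; exists setT; [exact: filterT|exact: finite_finset].
- exact: stratum_frontier.
Qed.

End Action.

(** * The algebra of slice charts *)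

Section PosDef.
Variables (R : realType) (n : nat).
Implicit Types M : 'M[R[i]]_n.

Definition posdef M : Prop := psdmx M /\ M \in unitmx.

Lemma posdefP M : M^t* = M ->
  posdef M <-> forall l : 'I_n.+1, 0 < complex.Re (char_poly (- M))`_l.
Proof.
move=> hM; split=> [[pM uM] l|q0].
  by rewrite Re_gt0 ?char_poly_real//; move: uM; rewrite psd_unit// => /forallP.
have pM : psdmx M.
  apply: char_poly_ge0_psd => // l.
  have [ln|nl] := ltnP l n.+1; last by rewrite nth_default// size_char_poly.
  by rewrite ltW// -Re_gt0 ?char_poly_real//; exact: (q0 (Ordinal ln)).
split=> //; rewrite psd_unit//; apply/forallP => l.
by rewrite -Re_gt0 ?char_poly_real.
Qed.

End PosDef.

Section Chart.
Variables (R : realType) (m : nat) (p : 'M[R[i]]_m).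
Local Notation C := R[i].
Local Notation q := (1%:M - p).
Implicit Types y z : 'M[C]_m.
Hypothesis pp : p *m p = p.
Hypothesis ph : p^t* = p.

Let pq : p *m q = 0. Proof. by rewrite mulmxBr mulmx1 pp subrr. Qed.
Let qp : q *m p = 0. Proof. by rewrite mulmxBl mul1mx pp subrr. Qed.
Let qq : q *m q = q. Proof. by rewrite mulmxBr mulmx1 qp subr0. Qed.
Let pDq : p + q = 1%:M. Proof. by rewrite addrC subrK. Qed.
Let qh : q^t* = q. Proof. by rewrite trmxCB trmxC1 ph. Qed.

Lemma corner_herm y : y^t* = y -> (corner p y)^t* = corner p y.
Proof. by move=> hy; rewrite trmxCD !trmxC_mul qh ph hy mulmxA. Qed.

Lemma psd_corner_part y : psdmx (corner p y) -> psdmx (p *m y *m p).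
Proof.
move=> /(psd_congr p); rewrite ph /corner mulmxDr mulmxDl !mulmxA pp pq mul0mx addr0.
by rewrite -mulmxA pp.
Qed.

Lemma corner_part y : corner p y *m p = p *m y *m p.
Proof. by rewrite /corner mulmxDl qp addr0 -mulmxA pp. Qed.

Lemma schurmx_herm y : y^t* = y -> (schurmx p y)^t* = schurmx p y.
Proof.
move=> hy; rewrite schurmxE !trmxC_mul invmx_trmxC (corner_herm hy) qh ph hy.
by move: (invmx _) (1%:M - p) => N Q; rewrite !mulmxA.
Qed.

Lemma schurmx_kernel y : q *m schurmx p y *m q = schurmx p y.
Proof. by rewrite schurmxE !mulmxA qq -[_ *m q *m q]mulmxA qq. Qed.

Lemma corner_addq y c : q *m c *m q = c -> corner p (y + c) = corner p y.
Proof.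
move=> cE; rewrite /corner mulmxDr mulmxDl; congr (_ + _).
by rewrite -cE !mulmxA pq !mul0mx addr0.
Qed.

Lemma schurmx_addq y c : q *m c *m q = c -> schurmx p (y + c) = schurmx p y.
Proof.
move=> cE; rewrite !schurmxE corner_addq//.
have cp : c *m p = 0 by rewrite -cE -mulmxA qp mulmx0.
have pc : p *m c = 0 by rewrite -cE !mulmxA pq !mul0mx.
rewrite [q *m (y + c) *m p](_ : _ = q *m y *m p); last first.
  by rewrite mulmxDr mulmxDl -[q *m c *m p]mulmxA cp mulmx0 addr0.
by rewrite -[_ *m p *m (y + c)]mulmxA [p *m (y + c)]mulmxDr pc addr0 !mulmxA.
Qed.

Lemma schurmx_shift y (c : C) : schurmx p (y + c *: schurmx p y) = schurmx p y.
Proof. by apply: schurmx_addq; rewrite -scalemxAr -scalemxAl schurmx_kernel. Qed.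

Lemma corner_shift y (c : C) : corner p (y + c *: schurmx p y) = corner p y.
Proof. by apply: corner_addq; rewrite -scalemxAr -scalemxAl schurmx_kernel. Qed.

(** On the corner of [p], the inverse scales by [c^-1], and it stands between two factors
    that scale by [c]. *)
Lemma schurmxZ y (c : C) : c != 0 -> corner p y \in unitmx ->
  schurmx p (c *: y) = c *: schurmx p y.
Proof.
move=> c0 Bu; set N := invmx (corner p y).
have nB : N *m corner p y = 1%:M by rewrite mulVmx.
have Bn : corner p y *m N = 1%:M by rewrite mulmxV.
have NP : N *m (p *m y *m p) = p := corner_Vmul pp erefl nB.
have Nq : N *m q = q := corner_invq pp erefl nB.
have E : ((c^-1 *: p + q) *m N) *m corner p (c *: y) = 1%:M.
  rewrite -mulmxA /corner -scalemxAr -scalemxAl.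
  move: pq qp qq Nq pDq; move: (1%:M - p) => Q pQ Qp QQ NQ pDQ.
  rewrite mulmxDr -scalemxAr NP NQ.
  rewrite mulmxDl -!scalemxAl !mulmxDr -!scalemxAr pp pQ Qp QQ !scaler0 addr0 add0r scalerA.
  by rewrite mulVf// scale1r.
have Bu' : corner p (c *: y) \in unitmx by case/mulmx1_unit: E.
have NE : invmx (corner p (c *: y)) = (c^-1 *: p + q) *m N.
  move: Bu' E; move: (_ *m N) (corner p (c *: y)) => X B Bu' E.
  have : X *m B *m invmx B = 1%:M *m invmx B by rewrite E.
  by rewrite -mulmxA mulmxV// mulmx1 mul1mx.
have E1 : schurmx p (c *: y) = q *m (c *: y) *m p *m invmx (corner p (c *: y)) *m p *m (c *: y) *m q.
  exact: schurmxE.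
have E2 : schurmx p y = q *m y *m p *m N *m p *m y *m q by exact: schurmxE.
rewrite E1 E2 NE; move: (N) => N'.
have -> : q *m (c *: y) *m p *m ((c^-1 *: p + q) *m N') = q *m y *m p *m N'.
  rewrite mulmxA; congr (_ *m _).
  move: pq; move: (1%:M - p) => Q pQ.
  rewrite -scalemxAr -scalemxAl mulmxDr -!scalemxAl -scalemxAr -!mulmxA pp pQ !mulmx0 scaler0 addr0.
  by rewrite scalerA mulfV// scale1r.
by rewrite -scalemxAr -scalemxAl.
Qed.

Lemma posdef_cornerZ y (c : C) : 0 < c -> posdef (corner p y) -> posdef (corner p (c *: y)).
Proof.
move=> c0 [pB Bu]; have pq1 : psdmx q by have := psd_gram q; rewrite qh qq.
have pc : psdmx (corner p (c *: y)).
  have pz : psdmx (c *: (p *m y *m p)) by apply: psdZ; [exact: ltW|exact: psd_corner_part].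
  by rewrite /corner -scalemxAr -scalemxAl; exact: psdD pz pq1.
split; first exact: pc.
have -> : corner p (c *: y) = (c *: p + q) *m corner p y.
  rewrite /corner; move: pq qp qq; move: (1%:M - p) => Q pQ Qp QQ.
  rewrite mulmxDl !mulmxDr -!scalemxAl !mulmxA pp Qp !mul0mx pQ scaler0 addr0 add0r QQ.
  by rewrite -scalemxAr -!scalemxAl.
rewrite unitmx_mul Bu andbT.
have : (c *: p + q) *m (c^-1 *: p + q) = 1%:M.
  move: pq qp qq pDq; move: (1%:M - p) => Q pQ Qp QQ pDQ.
  rewrite mulmxDl !mulmxDr -!scalemxAl -!scalemxAr pp pQ Qp QQ !scaler0 addr0 add0r scalerA.
  by rewrite mulfV ?gt_eqF// scale1r.
by case/mulmx1_unit.
Qed.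

Definition ctrace y : C := \tr (p *m y *m p).

Lemma ctraceZ c y : ctrace (c *: y) = c * ctrace y.
Proof. by rewrite /ctrace -scalemxAr -scalemxAl mxtraceZ. Qed.

Lemma ctraceD y z : ctrace (y + z) = ctrace y + ctrace z.
Proof. by rewrite /ctrace mulmxDr mulmxDl mxtraceD. Qed.

Lemma ctrace_shift y (c : C) : ctrace (y + c *: schurmx p y) = ctrace y.
Proof.
rewrite ctraceD ctraceZ /ctrace -schurmx_kernel !mulmxA pq !mul0mx.
by rewrite mxtrace0 mulr0 addr0.
Qed.

(** The difference [y - schurmx p y] straightens the rank condition; the scalar factor
    gives the result the trace of [y] on the corner of [p], so that the condition on
    the trace becomes linear. *)
Definition chart y : 'M[C]_m := (\tr y / ctrace y) *: (y - schurmx p y).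
Definition unchart z : 'M[C]_m := (ctrace z / \tr (z + schurmx p z)) *: (z + schurmx p z).

Definition chart_dom y : Prop := [/\ posdef (corner p y), 0 < ctrace y & 0 < \tr y].
Definition chart_im z : Prop := [/\ posdef (corner p z), 0 < ctrace z & 0 < \tr (z + schurmx p z)].

Lemma chart_pieces y : chart_dom y -> let c := \tr y / ctrace y in
  [/\ posdef (corner p (chart y)), schurmx p (chart y) = c *: schurmx p y,
      ctrace (chart y) = \tr y & chart y + schurmx p (chart y) = c *: y].
Proof.
move=> [[pB Bu] by0 ty0] c; have c0 : 0 < c := divr_gt0 ty0 by0.
have E : y - schurmx p y = y + (-1) *: schurmx p y by rewrite scaleN1r.
have cB : corner p (y + (-1) *: schurmx p y) = corner p y := corner_shift _ _.
have cu : corner p (y + (-1) *: schurmx p y) \in unitmx by rewrite cB.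
have sE : schurmx p (chart y) = c *: schurmx p y.
  by rewrite /chart -/c E (schurmxZ (lt0r_neq0 c0) cu) schurmx_shift.
split; [|exact: sE| |].
- by rewrite /chart -/c E; apply: posdef_cornerZ c0 _; rewrite cB; split.
- by rewrite /chart ctraceZ E ctrace_shift divfK ?(lt0r_neq0 by0).
- by rewrite sE /chart -/c -scalerDr subrK.
Qed.

Lemma unchart_pieces z : chart_im z -> let c := ctrace z / \tr (z + schurmx p z) in
  [/\ posdef (corner p (unchart z)), schurmx p (unchart z) = c *: schurmx p z,
      \tr (unchart z) = ctrace z & ctrace (unchart z) = c * ctrace z].
Proof.
move=> [[pB Bu] by0 ty0] c; have c0 : 0 < c := divr_gt0 by0 ty0.
have E : z + schurmx p z = z + 1 *: schurmx p z by rewrite scale1r.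
have cB : corner p (z + 1 *: schurmx p z) = corner p z := corner_shift _ _.
have cu : corner p (z + 1 *: schurmx p z) \in unitmx by rewrite cB.
have sE : schurmx p (unchart z) = c *: schurmx p z.
  by rewrite /unchart -/c E (schurmxZ (lt0r_neq0 c0) cu) schurmx_shift.
split; [|exact: sE| |].
- by rewrite /unchart -/c E; apply: posdef_cornerZ c0 _; rewrite cB; split.
- by rewrite /unchart mxtraceZ divfK ?(lt0r_neq0 ty0).
- by rewrite /unchart -/c ctraceZ E ctrace_shift.
Qed.

Let cancel_ratio (a b : C) : a != 0 -> b != 0 -> a / (a / b * a) * (a / b) = 1.
Proof. by move=> a0 b0; field; rewrite a0 b0. Qed.

Lemma chartK y : chart_dom y -> chart_im (chart y) /\ unchart (chart y) = y.
Proof.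
move=> dy; have [pc sc bc ac] := chart_pieces dy; have [pB by0 ty0] := dy.
have c0 : 0 < \tr y / ctrace y := divr_gt0 ty0 by0.
split.
  split; [exact: pc|by rewrite bc|by rewrite ac mxtraceZ mulr_gt0].
rewrite /unchart bc ac mxtraceZ scalerA -[RHS]scale1r; congr (_ *: _).
by rewrite cancel_ratio ?(lt0r_neq0 ty0) ?(lt0r_neq0 by0).
Qed.

Lemma unchartK z : chart_im z -> chart_dom (unchart z) /\ chart (unchart z) = z.
Proof.
move=> dz; have [pc sc tc bc] := unchart_pieces dz; have [pB bz0 tz0] := dz.
have c0 : 0 < ctrace z / \tr (z + schurmx p z) := divr_gt0 bz0 tz0.
split; first by split; [exact: pc|rewrite bc mulr_gt0|rewrite tc].
rewrite /chart tc bc sc /unchart -scalerBr addrK scalerA -[RHS]scale1r; congr (_ *: _).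
by rewrite cancel_ratio ?(lt0r_neq0 bz0) ?(lt0r_neq0 tz0).
Qed.

End Chart.

(** * Smoothness of slice charts *)

Section SmoothChart.
Variables (R : realType) (V : normedModType R) (m : nat) (p : 'M[R[i]]_m).
Variables (O : set V) (X : V -> 'M[R[i]]_m).
Local Notation C := R[i].
Hypothesis ph : p^t* = p.
Hypothesis oO : open O.
Hypothesis Xh : forall v, (X v)^t* = X v.
Hypothesis sX : mxfun [set f : V -> R | smooth_on O f] X.

Let SO := smooth_algebra oO.

Lemma smooth_corner : mxfun [set f : V -> R | smooth_on O f] (fun v => corner p (X v)).
Proof.
apply: (mxfunD SO); last exact: mxfun_cst.
apply: (mxfunM SO); last exact: mxfun_cst.
by apply: (mxfunM SO) => //; exact: mxfun_cst.
Qed.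

Lemma open_posdef_corner : open (O `&` [set v | posdef (corner p (X v))]).
Proof.
have -> : O `&` [set v | posdef (corner p (X v))] =
   O `&` [set v | forall l : 'I_m.+1, (O `&` [set v | 0 < complex.Re (char_poly (- corner p (X v)))`_l]) v].
  apply/seteqP; split=> v /= [Ov].
    by move=> /(posdefP (corner_herm ph (Xh v))) h; split.
  by move=> h; split=> //; apply/(posdefP (corner_herm ph (Xh v))) => l; have [] := h l.
apply: openI => //; apply: (open_forall (X := fun l : 'I_m.+1 => (O `&` [set v | 0 < complex.Re (char_poly (- corner p (X v)))`_l]))) => l.
apply: smooth_open_gt0 => //.
exact: (fun_char_coef SO l smooth_corner).
Qed.

Hypothesis uO : forall v, O v -> corner p (X v) \in unitmx.

Lemma smooth_schurmx : mxfun [set f : V -> R | smooth_on O f] (fun v => schurmx p (X v)).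
Proof.
have sI := mxsmoothV oO uO smooth_corner.
have cc M : mxfun [set f : V -> R | smooth_on O f] (fun=> M : 'M[C]_m) by exact: mxfun_cst.
exact: (mxfunM SO (mxfunM SO (mxfunM SO (mxfunM SO (mxfunM SO (mxfunM SO (cc _) sX) (cc p)) sI) (cc p)) sX) (cc _)).
Qed.

Lemma smooth_ctrace : cfun [set f : V -> R | smooth_on O f] (fun v => ctrace p (X v)).
Proof.
have cc M : mxfun [set f : V -> R | smooth_on O f] (fun=> M : 'M[C]_m) by exact: mxfun_cst.
exact: (cfun_tr SO (mxfunM SO (mxfunM SO (cc p) sX) (cc p))).
Qed.

Lemma smooth_chart : (forall v, O v -> ctrace p (X v) != 0) ->
  mxfun [set f : V -> R | smooth_on O f] (fun v => chart p (X v)).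
Proof.
move=> t0; apply: (mxfunZ SO); last exact: (mxfunB SO sX smooth_schurmx).
apply: (cfunM SO); first exact: (cfun_tr SO sX).
by apply: csmoothV => //; exact: smooth_ctrace.
Qed.

Lemma smooth_unchart : (forall v, O v -> \tr (X v + schurmx p (X v)) != 0) ->
  mxfun [set f : V -> R | smooth_on O f] (fun v => unchart p (X v)).
Proof.
move=> t0; have sS := mxfunD SO sX smooth_schurmx.
apply: (mxfunZ SO); last exact: sS.
apply: (cfunM SO); first exact: smooth_ctrace.
by apply: csmoothV => //; exact: (cfun_tr SO sS).
Qed.

End SmoothChart.

Section OpenDomains.
Variables (R : realType) (V : normedModType R) (m : nat) (p : 'M[R[i]]_m).
Variables (X : V -> 'M[R[i]]_m).
Local Notation C := R[i].
Hypothesis ph : p^t* = p.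
Hypothesis Xh : forall v, (X v)^t* = X v.
Hypothesis sX : mxfun [set f : V -> R | smooth_on setT f] X.

Let sXO (O : set V) : mxfun [set f : V -> R | smooth_on O f] X.
Proof. by apply: mxsmooth_sub sX. Qed.

Lemma herm_corner_part v : (p *m X v *m p)^t* = p *m X v *m p.
Proof. by rewrite !trmxC_mul ph Xh mulmxA. Qed.

Let O1 := [set v | posdef (corner p (X v))].

Let oO1 : open O1.
Proof. by have := open_posdef_corner ph openT Xh sX; rewrite setTI. Qed.

Lemma open_chart_dom : open [set v | chart_dom p (X v)].
Proof.
have -> : [set v | chart_dom p (X v)] = O1 `&` [set v | 0 < complex.Re (ctrace p (X v))] `&`
    (O1 `&` [set v | 0 < complex.Re (\tr (X v))]).
  have rc v := herm_tr_real (herm_corner_part v); have rt v := herm_tr_real (Xh v).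
  apply/seteqP; split=> v /=; first by move=> [h1 h2 h3]; rewrite !Re_gt0 ?rc ?rt.
  by rewrite !Re_gt0 ?rc ?rt// => -[[h1 h2] [_ h3]].
apply: openI; apply: smooth_open_gt0 => //.
  by have [] := smooth_ctrace p oO1 (sXO _).
by have [] := cfun_tr (smooth_algebra oO1) (sXO O1).
Qed.

Lemma open_chart_im : open [set v | chart_im p (X v)].
Proof.
have -> : [set v | chart_im p (X v)] = O1 `&` [set v | 0 < complex.Re (ctrace p (X v))] `&`
    (O1 `&` [set v | 0 < complex.Re (\tr (X v + schurmx p (X v)))]).
  have rc v := herm_tr_real (herm_corner_part v).
  have rt v : \tr (X v + schurmx p (X v)) \is Num.real.
    by apply: herm_tr_real; rewrite trmxCD Xh schurmx_herm.
  apply/seteqP; split=> v /=; first by move=> [h1 h2 h3]; rewrite !Re_gt0 ?rc ?rt.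
  by rewrite !Re_gt0 ?rc ?rt// => -[[h1 h2] [_ h3]].
apply: openI; apply: smooth_open_gt0 => //.
  by have [] := smooth_ctrace p oO1 (sXO _).
have uO v : O1 v -> corner p (X v) \in unitmx by case.
by have [] := cfun_tr (smooth_algebra oO1) (mxfunD (smooth_algebra oO1) (sXO O1) (smooth_schurmx oO1 (sXO O1) uO)).
Qed.

Lemma smooth_chart_dom :
  mxfun [set f : V -> R | smooth_on [set v | chart_dom p (X v)] f] (fun v => chart p (X v)).
Proof.
apply: smooth_chart; [exact: open_chart_dom|exact: sXO|by move=> v [[]]|].
by move=> v [_ h _]; exact: lt0r_neq0.
Qed.

Lemma smooth_unchart_im :
  mxfun [set f : V -> R | smooth_on [set v | chart_im p (X v)] f] (fun v => unchart p (X v)).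
Proof.
apply: smooth_unchart; [exact: open_chart_im|exact: sXO|by move=> v [[]]|].
by move=> v [_ _ h]; exact: lt0r_neq0.
Qed.

End OpenDomains.

(** * Slices of strata *)

Section Slice.
Variables (R : realType) (k : nat) (n_ : 'I_k -> nat).
Local Notation C := R[i].
Local Notation m := (\sum_i n_ i)%N.
Local Notation A := (@blockalg R k n_).
Local Notation sa := (sa R n_).
Local Notation D := (density R n_).
Local Notation S := (@stratum R k n_).

(** The orthogonal projection [p] onto the range of [x], with the properties used
    below; the witness [Z] of [rproj_fact] is the Moore-Penrose inverse of [x]. *)
Record range_proj (x p : 'M[C]_m) : Prop := RangeProj {
  rproj_alg : p \in A;
  rproj_herm : p^t* = p;
  rproj_idem : p *m p = p;
  rproj_mul : p *m x = x;
  rproj_mulr : x *m p = x;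
  rproj_fact : exists Z, [/\ Z \in A, Z^t* = Z, x *m Z = p & Z *m x = p];
  rproj_corner : psdmx x -> posdef (corner p x);
  rproj_rank : forall i, block_rank p i = block_rank x i
}.

Lemma range_proj_ex (x : 'M[C]_m) : x \in A -> x^t* = x -> exists p, range_proj x p.
Proof.
move=> xA hx; have [Z [ZA hZ xZ xZx ZxZ]] := blockalg_pinv xA hx.
pose p := x *m Z.
have ph : p^t* = p by rewrite trmxC_mul hx hZ -xZ.
have px : p *m x = x by [].
have xp : x *m p = x by rewrite /p xZ mulmxA.
have pp : p *m p = p by rewrite /p mulmxA xZx.
have cE : corner p x = x + (1%:M - p) by rewrite /corner px xp.
have Bu : corner p x \in unitmx.
  have : corner p x *m (Z + (1%:M - p)) = 1%:M.
    have xq : x *m (1%:M - p) = 0 by rewrite mulmxBr mulmx1 xp subrr.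
    have qZ : (1%:M - p) *m Z = 0 by rewrite mulmxBl mul1mx /p xZ ZxZ subrr.
    have qq : (1%:M - p) *m (1%:M - p) = 1%:M - p.
      by rewrite mulmxBr mulmx1 mulmxBl mul1mx pp subrr subr0.
    move: xq qZ qq; rewrite cE; have : p + (1%:M - p) = 1%:M by rewrite addrC subrK.
    move: (1%:M - p) => q pq xq qZ qq.
    by rewrite mulmxDl !mulmxDr xq qZ qq addr0 add0r.
  by case/mulmx1_unit.
exists p; split; [exact: blockalgM|exact: ph|exact: pp|exact: px|exact: xp| | |].
- by exists Z; split=> //; rewrite -xZ.
- move=> psx; split; last exact: Bu.
  have pq : psdmx (1%:M - p).
    have := psd_gram (1%:M - p); rewrite trmxCB trmxC1 ph.
    by rewrite mulmxBr mulmx1 mulmxBl mul1mx pp subrr subr0.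
  by rewrite cE; exact: psdD psx pq.
- move=> i; have cA : corner p x \in A.
    by rewrite cE blockalgD ?blockalgB ?blockalg1// blockalgM.
  have -> : x = corner p x *m p *m 1%:M by rewrite mulmx1 corner_part// px xp.
  by rewrite block_rank_mul ?blockalg1 ?unitmx1 ?blockalgM.
Qed.

Lemma corner_alg (p y : 'M[C]_m) : p \in A -> y \in A -> corner p y \in A.
Proof. by move=> pA yA; rewrite blockalgD ?blockalgB ?blockalg1// !blockalgM. Qed.

Lemma schurmx_alg (p y : 'M[C]_m) : p \in A -> y \in A -> schurmx p y \in A.
Proof.
move=> pA yA; have cA := blockalgV (corner_alg pA yA).
have qA : 1%:M - p \in A by rewrite blockalgB ?blockalg1.
by rewrite schurmxE; do ?[apply: blockalgM => //].
Qed.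

Lemma chart_alg (p y : 'M[C]_m) : p \in A -> y \in A -> chart p y \in A.
Proof. by move=> pA yA; apply: blockalgZ; rewrite blockalgB ?schurmx_alg. Qed.

Lemma unchart_alg (p y : 'M[C]_m) : p \in A -> y \in A -> unchart p y \in A.
Proof. by move=> pA yA; apply: blockalgZ; rewrite blockalgD ?schurmx_alg. Qed.

Lemma realZ_herm (c : C) (M : 'M[C]_m) : c \is Num.real -> M^t* = M -> (c *: M)^t* = c *: M.
Proof. by move=> /CrealP cr hM; rewrite linearZ/= map_mxZ/= hM cr. Qed.

Lemma ctrace_real (p y : 'M[C]_m) : p^t* = p -> y^t* = y -> ctrace p y \is Num.real.
Proof. by move=> ph yh; apply: herm_tr_real; rewrite !trmxC_mul ph yh mulmxA. Qed.

Lemma chart_herm (p y : 'M[C]_m) : p^t* = p -> y^t* = y -> (chart p y)^t* = chart p y.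
Proof.
move=> ph yh; apply: realZ_herm; last by rewrite trmxCB yh schurmx_herm.
by rewrite realM ?realV ?ctrace_real// herm_tr_real.
Qed.

Lemma unchart_herm (p y : 'M[C]_m) : p^t* = p -> y^t* = y -> (unchart p y)^t* = unchart p y.
Proof.
move=> ph yh; have sh : (y + schurmx p y)^t* = y + schurmx p y by rewrite trmxCD yh schurmx_herm.
by apply: realZ_herm => //; rewrite realM ?realV ?ctrace_real// herm_tr_real.
Qed.

Lemma herm_shear (a b c e : 'M[C]_m) : a^t* = a -> b^t* = b -> c^t* = c -> e^t* = e ->
  (1%:M + a *m b *m c *m e *m c)^t* = 1%:M + c *m e *m c *m b *m a.
Proof.
by move=> ha hb hc he; rewrite trmxCD trmxC1 !trmxC_mul ha hb hc he !mulmxA.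
Qed.

Section AtPoint.
Variables (r : {ffun 'I_k -> 'I_m.+1}) (x : sa) (p : 'M[C]_m).
Hypothesis Sx : S r x.
Hypothesis rp : range_proj (sa_val x) p.
Local Notation q := (1%:M - p).

Let pA := rproj_alg rp.
Let ph := rproj_herm rp.
Let pp := rproj_idem rp.

(** The ranks of the blocks add up to the rank, so [rank_corner] applies to [y] in the
    stratum; conversely elimination writes [y] as a congruence of [p y p] by an element
    of the block algebra. *)
Lemma stratum_flat (y : sa) : chart_dom p (sa_val y) ->
  S r y <-> q *m chart p (sa_val y) *m q = 0 /\ ctrace p (chart p (sa_val y)) = 1.
Proof.
move=> dy; have [pc sc bc ac] := chart_pieces pp ph dy; have [[pB Bu] by0 ty0] := dy.
rewrite bc; have c0 : \tr (sa_val y) / ctrace p (sa_val y) != 0.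
  by rewrite mulf_neq0 ?invr_eq0 ?lt0r_neq0.
have qcE : q *m chart p (sa_val y) *m q =
    (\tr (sa_val y) / ctrace p (sa_val y)) *: (q *m sa_val y *m q - schurmx p (sa_val y)).
  rewrite /chart -scalemxAr -scalemxAl; congr (_ *: _).
  by rewrite [q *m (_ - schurmx _ _)]mulmxBr [LHS]mulmxBl schurmx_kernel.
rewrite qcE; have [[px tx] rx] := Sx.
split=> [[[py ty] ry]|].
  split=> //; rewrite (rank_corner pp Bu) ?subrr ?scaler0//.
  rewrite !rank_block ?sa_alg//; apply: eq_bigr => i _.
  by rewrite (rproj_rank rp) rx ry.
move=> [/eqP]; rewrite scaler_eq0 (negbTE c0)/= subr_eq0 => /eqP E ty.
have [W [W' [Wu Wu' WE WE' yE]]] := corner_factor pp Bu.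
rewrite E subrr addr0 in yE.
have WA : W \in A.
  rewrite WE; apply: blockalgD; first exact: blockalg1.
  by rewrite !blockalgM ?blockalgB ?blockalg1 ?sa_alg ?blockalgV ?corner_alg ?sa_alg.
have W'W : W' = W^t*.
  have Nh : (invmx (corner p (sa_val y)))^t* = invmx (corner p (sa_val y)).
    by rewrite invmx_trmxC (corner_herm ph (sa_herm y)).
  have qh : q^t* = q by rewrite trmxCB trmxC1 ph.
  by rewrite WE WE' (herm_shear qh (sa_herm y) ph Nh).
split; last first.
  move=> i; rewrite /= -rx -(rproj_rank rp) yE -(corner_part pp) mulmxA.
  have WB : W *m corner p (sa_val y) \in A := blockalgM WA (corner_alg pA (sa_alg y)).
  have WB' : W *m corner p (sa_val y) \in unitmx by rewrite unitmx_mul Wu Bu.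
  have W'A : W' \in A by rewrite W'W; exact: blockalg_trmxC.
  exact: (block_rank_mul _ WB pA W'A WB' Wu').
split; last exact: ty.
by rewrite yE W'W; apply: psd_congr; exact: (psd_corner_part pp ph pB).
Qed.

Lemma chart_base : chart_dom p (sa_val x) /\ chart p (sa_val x) = sa_val x.
Proof.
have [[px tx] rx] := Sx.
have tc : ctrace p (sa_val x) = 1 by rewrite /ctrace (rproj_mul rp) (rproj_mulr rp).
have s0 : schurmx p (sa_val x) = 0.
  by rewrite schurmxE mulmxBl mul1mx (rproj_mul rp) subrr !mul0mx.
split; first by split; [exact: (rproj_corner rp)|rewrite tc ltr01|rewrite tx ltr01].
by rewrite /chart tc tx s0 subr0 divr1 scale1r.
Qed.

(** The chart is followed by the translation that sends [x] to 0 and by [phi]. *)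
Lemma slice_chart (N d : nat) (phi : {linear sa -> 'rV[R]_N}) (psi : {linear 'rV[R]_N -> sa}) :
  (d <= N)%N -> cancel phi psi -> cancel psi phi ->
  (forall v : sa, q *m sa_val v *m q = 0 /\ ctrace p (sa_val v) = 0 <-> flat d (phi v)) ->
  exists (N : nat) (U : set sa) (U' : set 'rV[R]_N)
      (f : sa -> 'rV[R]_N) (g : 'rV[R]_N -> sa),
      [/\ (d <= N)%N, U x, diffeo_on U U' f g
        & f @` (U `&` S r) = U' `&` flat d].
Proof.
move=> dN phiK psiK phiL.
pose U := [set y : sa | chart_dom p (sa_val y)].
pose U' := [set w : 'rV[R]_N | chart_im p (sa_val (psi w + x))].
pose f (y : sa) : 'rV[R]_N := phi (sa_proj (chart p (sa_val y))) - phi x.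
pose g (w : 'rV[R]_N) : sa := (idfun : {linear sa -> sa}) (sa_proj (unchart p (sa_val (psi w + x)))) + 0.
have fE y : sa_val (psi (f y) + x) = chart p (sa_val y).
  rewrite /f -linearB phiK subrK sa_projK ?chart_herm ?chart_alg ?sa_alg ?sa_herm//.
have gE w : sa_val (g w) = unchart p (sa_val (psi w + x)).
  by rewrite /g addr0 sa_projK ?unchart_herm ?unchart_alg ?sa_alg ?sa_herm.
have fK y : U y -> U' (f y) /\ g (f y) = y.
  move=> Uy; have [im uc] := chartK pp ph Uy; split; first by rewrite -fE in im.
  have H : sa_val (g (f y)) = sa_val y by rewrite gE fE.
  exact: val_inj H.
have gK w : U' w -> U (g w) /\ f (g w) = w.
  move=> Uw; have [dm uc] := unchartK pp ph Uw; split; first by rewrite -gE in dm.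
  by rewrite /f gE uc sa_proj_val linearD addrK psiK.
have sE := @smooth_sa_entries R k n_ setT openT.
have sE' := smooth_rV_entries psi x openT.
have oU : open U := open_chart_dom ph (@sa_herm R k n_) sE.
have oU' : open U' := open_chart_im ph (fun w => sa_herm (psi w + x)) sE'.
have sf : smooth_on U f.
  exact: (smooth_sa_proj phi (- phi x) oU (smooth_chart_dom ph (@sa_herm R k n_) sE)).
have sg : smooth_on U' g.
  exact: (smooth_sa_proj _ 0 oU' (smooth_unchart_im ph (fun w => sa_herm (psi w + x)) sE')).
exists N, U, U', f, g; split; [exact: dN|by have [] := chart_base|by split|].
have [[px tx] rx] := Sx.
have qx : q *m sa_val x *m q = 0.
  by rewrite mulmxBl mul1mx (rproj_mul rp) subrr mul0mx.
have tcx : ctrace p (sa_val x) = 1 by rewrite /ctrace (rproj_mul rp) (rproj_mulr rp).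
have qD v : q *m sa_val (v + x) *m q = q *m sa_val v *m q.
  by rewrite sa_valD [q *m (_ + sa_val x)]mulmxDr [LHS]mulmxDl qx addr0.
have tD v : ctrace p (sa_val (v + x)) = ctrace p (sa_val v) + 1.
  by rewrite sa_valD ctraceD tcx.
have key y : U y -> S r y <-> flat d (f y).
  move=> Uy; rewrite (stratum_flat Uy) -fE; split.
    move=> [h1 h2]; have := phiL (psi (f y)); rewrite psiK => -[H _]; apply: H.
    move: h1 h2; rewrite qD tD => -> /eqP.
    by rewrite -subr_eq0 addrK => /eqP ->.
  move=> fl; have := phiL (psi (f y)); rewrite psiK => -[_ /(_ fl)[h1 h2]].
  by rewrite qD tD h1 h2 add0r.
apply/seteqP; split=> w /=.
  by move=> [y [Uy Sy] <-]; split; [have [] := fK y Uy|exact/key].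
move=> [Uw fw]; have [Ug fg] := gK w Uw; exists (g w); last exact: fg.
by split; [exact: Ug|apply/(key _ Ug); rewrite fg; exact: fw].
Qed.

End AtPoint.
End Slice.

(** * Constancy of the dimension *)

Section Dimension.
Variables (R : realType) (k : nat) (n_ : 'I_k -> nat).
Local Notation C := R[i].
Local Notation m := (\sum_i n_ i)%N.
Local Notation A := (@blockalg R k n_).
Local Notation sa := (sa R n_).
Local Notation D := (density R n_).
Local Notation S := (@stratum R k n_).

Definition tangent_at (p : 'M[C]_m) (v : sa) : Prop :=
  (1%:M - p) *m sa_val v *m (1%:M - p) = 0 /\ ctrace p (sa_val v) = 0.

Lemma linear_sa_proj (F : 'M[C]_m -> 'M[C]_m) :
  (forall (c : C) M N, F (c *: M + N) = c *: F M + F N) ->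
  linear (fun v : sa => sa_proj (F (sa_val v)) : sa).
Proof. by move=> FL c v w; rewrite sa_valD sa_valZ FL sa_projD sa_projZ. Qed.

Lemma range_proj_neq0 r (x : sa) p : S r x -> range_proj (sa_val x) p -> p != 0.
Proof.
move=> [[_ tx] _] rp; apply/eqP => p0; move: tx.
by rewrite -(rproj_mul rp) p0 mul0mx mxtrace0 => /esym/eqP; rewrite oner_eq0.
Qed.

(** The two conditions form a single linear equation, [q v q] and a multiple of [p]
    being linearly independent. *)
Lemma tangent_straight r (x : sa) p N0 (phi0 : {linear sa -> 'rV[R]_N0}) (psi0 : {linear 'rV[R]_N0 -> sa}) :
  S r x -> range_proj (sa_val x) p -> cancel phi0 psi0 -> cancel psi0 phi0 ->
  exists (d : nat) (phi : {linear sa -> 'rV[R]_N0}) (psi : {linear 'rV[R]_N0 -> sa}),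
    [/\ (d <= N0)%N, cancel phi psi, cancel psi phi &
        forall v, tangent_at p v <-> flat d (phi v)].
Proof.
move=> Sx rp phiK psiK; pose q := 1%:M - p.
pose F (M : 'M[C]_m) := q *m M *m q + ctrace p M *: p.
have FL (c : C) M N : F (c *: M + N) = c *: F M + F N.
  rewrite /F ctraceD ctraceZ scalerDl -scalerA scalerDr.
  rewrite [q *m (_ + _)]mulmxDr [(_ + _) *m q]mulmxDl -scalemxAr -scalemxAl.
  by rewrite addrACA.
pose L := fun v : sa => sa_proj (F (sa_val v)) : sa.
pose LM := GRing.isLinear.Build _ _ _ _ _ (linear_sa_proj FL).
pose LL : {linear sa -> sa} := HB.pack L LM.
have [d [phi [psi [dN K1 K2 H]]]] := straighten (phi0 \o LL) phiK psiK.
exists d, phi, psi; split=> // v; rewrite -H /=.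
have pA := rproj_alg rp; have ph := rproj_herm rp; have pp := rproj_idem rp.
have pq : p *m q = 0 by rewrite mulmxBr mulmx1 pp subrr.
have qh : q^t* = q by rewrite trmxCB trmxC1 ph.
have qA : q \in A by rewrite blockalgB ?blockalg1.
have Lv : sa_val (L v) = F (sa_val v).
  apply: sa_projK; first by rewrite blockalgD ?blockalgZ// !blockalgM ?sa_alg.
  rewrite trmxCD !trmxC_mul qh sa_herm mulmxA realZ_herm//.
  by apply: ctrace_real => //; exact: sa_herm.
split=> [[h1 h2]|].
  have -> : L v = 0 by apply: val_inj; rewrite [LHS]Lv /F h1 h2 scale0r addr0.
  exact: raddf0.
move=> h; have L0 : L v = 0 by rewrite -[L v]phiK h raddf0.
have : F (sa_val v) = 0 by rewrite -Lv L0.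
rewrite /F => E; have : p *m (q *m sa_val v *m q + ctrace p (sa_val v) *: p) = 0.
  by rewrite E mulmx0.
rewrite [LHS]mulmxDr !mulmxA pq !mul0mx add0r -scalemxAr pp => /eqP.
rewrite scaler_eq0 (negbTE (range_proj_neq0 Sx rp)) orbF => /eqP t0.
by move: E; rewrite t0 scale0r addr0.
Qed.

(** If [y = h x h^*], congruence by [h] preserves the condition on the corner of the
    kernel; subtracting a multiple of [y] restores the condition on the trace without
    loss of injectivity, since only multiples of [x] are mapped to multiples of [y]
    and 0 is the only one that satisfies the trace condition. *)
Lemma tangent_dim_le r (x y : sa) px py N d1 d2
    (phi1 phi2 : {linear sa -> 'rV[R]_N}) (psi1 psi2 : {linear 'rV[R]_N -> sa}) :
  S r x -> S r y -> range_proj (sa_val x) px -> range_proj (sa_val y) py ->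
  (d1 <= N)%N -> (d2 <= N)%N -> cancel phi1 psi1 -> cancel psi1 phi1 -> cancel phi2 psi2 ->
  (forall v, tangent_at px v <-> flat d1 (phi1 v)) ->
  (forall v, tangent_at py v <-> flat d2 (phi2 v)) ->
  (d1 <= d2)%N.
Proof.
move=> Sx Sy rx ry d1N d2N K1 K1' K2 H1 H2.
have [h [hA hu yE]] := act_transitive Sx Sy.
pose F (M : 'M[C]_m) := h *m M *m h^t* - ctrace py (h *m M *m h^t*) *: sa_val y.
have FL (c : C) M N' : F (c *: M + N') = c *: F M + F N'.
  rewrite /F [h *m (_ + _)]mulmxDr [(_ + _) *m h^t*]mulmxDl -scalemxAr -scalemxAl.
  by rewrite ctraceD ctraceZ scalerDl -scalerA scalerBr opprD addrACA.
pose L := fun v : sa => sa_proj (F (sa_val v)) : sa.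
pose LM := GRing.isLinear.Build _ _ _ _ _ (linear_sa_proj FL).
pose LL : {linear sa -> sa} := HB.pack L LM.
have yh := rproj_herm ry.
have Lv v : sa_val (L v) = F (sa_val v).
  have [hvA hvh] := congr_sa v hA.
  apply: sa_projK; first by rewrite blockalgB ?blockalgZ ?sa_alg.
  by rewrite trmxCB hvh realZ_herm ?sa_herm// ctrace_real.
have tcx : ctrace px (sa_val x) = 1.
  by have [[_ tx] _] := Sx; rewrite /ctrace (rproj_mul rx) (rproj_mulr rx).
have tcy : ctrace py (sa_val y) = 1.
  by have [[_ ty] _] := Sy; rewrite /ctrace (rproj_mul ry) (rproj_mulr ry).
apply: (flat_dim_le (Psi := LL) d1N d2N K1 K1' (can_inj K2)) => v /H1[v1 v2].
  move=> L0; have : F (sa_val v) = 0 by rewrite -Lv [L v]L0.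
  move=> /subr0_eq; rewrite yE; set b := ctrace _ _ => E.
  have vE : sa_val v = b *: sa_val x.
    have hu' : h^t* \in unitmx by rewrite trmxC_unit.
    rewrite -[LHS](mulKmx hu) -[h *m sa_val v](mulmxK hu') E.
    by rewrite -scalemxAl mulmxK// -scalemxAr mulKmx.
  move: v2; rewrite vE ctraceZ tcx mulr1 => b0.
  by apply: val_inj; rewrite [LHS]vE b0 scale0r.
apply/H2; rewrite /tangent_at [sa_val (LL v)]Lv /F.
have qy : (1%:M - py) *m sa_val y = 0 by rewrite mulmxBl mul1mx (rproj_mul ry) subrr.
have qhp : (1%:M - py) *m h *m px = 0.
  have [Z [_ _ <- _]] := rproj_fact rx.
  have -> : (1%:M - py) *m h *m (sa_val x *m Z) =
      (1%:M - py) *m (h *m sa_val x *m h^t*) *m (invmx (h^t*) *m Z).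
    by rewrite !mulmxA mulmxK ?trmxC_unit.
  by rewrite -yE qy mul0mx.
have qhE : (1%:M - py) *m h = (1%:M - py) *m h *m (1%:M - px).
  by rewrite [RHS]mulmxBr mulmx1 qhp subr0.
have hqE : h^t* *m (1%:M - py) = (1%:M - px) *m (h^t* *m (1%:M - py)).
  have := congr1 (fun M : 'M[C]_m => M^t*) qhE.
  by rewrite !trmxC_mul !trmxCB trmxC1 yh (rproj_herm rx).
split; last by rewrite ctraceD -scaleN1r !ctraceZ tcy mulr1 mulN1r subrr.
rewrite [_ *m (_ - _ *: sa_val y)]mulmxBr [LHS]mulmxBl -scalemxAr qy scaler0 mul0mx subr0.
have -> : (1%:M - py) *m (h *m sa_val v *m h^t*) *m (1%:M - py) =
   (1%:M - py) *m h *m sa_val v *m (h^t* *m (1%:M - py)) by rewrite !mulmxA.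
rewrite qhE hqE.
have -> : (1%:M - py) *m h *m (1%:M - px) *m sa_val v *m ((1%:M - px) *m (h^t* *m (1%:M - py))) =
  (1%:M - py) *m h *m ((1%:M - px) *m sa_val v *m (1%:M - px)) *m (h^t* *m (1%:M - py)).
  by rewrite !mulmxA.
by rewrite v1 mulmx0 mul0mx.
Qed.

Lemma stratum_submanifold r : exists d, submanifold d (S r).
Proof.
have [[x0 Sx0]|S0] := pselect (exists x, S r x); last first.
  by exists 0%N => x Sx; case: S0; exists x.
have [N [phi [psi [K1 K2]]]] := sa_coordinates R n_.
have [p0 rp0] := range_proj_ex (sa_alg x0) (sa_herm x0).
have [d [f0 [g0 [dN F1 F2 F3]]]] := tangent_straight Sx0 rp0 K1 K2.
exists d => x Sx; have [p rp] := range_proj_ex (sa_alg x) (sa_herm x).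
have [d' [f [g [dN' G1 G2 G3]]]] := tangent_straight Sx rp K1 K2.
have dd : d = d'.
  apply/eqP; rewrite eqn_leq; apply/andP; split.
    exact: (tangent_dim_le Sx0 Sx rp0 rp dN dN' F1 F2 G1 F3 G3).
  exact: (tangent_dim_le Sx Sx0 rp rp0 dN' dN G1 G2 F1 G3 F3).
rewrite dd; exact: (slice_chart Sx rp dN' G1 G2 G3).
Qed.

End Dimension.

(** * Limits of subspaces *)

Section Grassmannian.
Variables (R : realType) (V : normedModType R).

Record dual_frame (d : nat) (b : 'I_d -> V) (T : {linear V -> 'rV[R]_d}) (c : R) : Prop := DualFrame {
  dual_frameE : forall j, T (b j) = delta_mx 0 j;
  dual_frame_gt0 : 0 < c;
  dual_frame_bound : forall v, \sum_i `|T v 0 i| <= c * `|v|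
}.

Lemma norm_lincomb_le d (a : 'I_d -> R) (u : 'I_d -> V) e :
  (forall i, `|u i| <= e) -> `|\sum_i a i *: u i| <= (\sum_i `|a i|) * e.
Proof.
move=> ue; rewrite mulr_suml (le_trans (ler_norm_sum _ _ _))//.
by apply: ler_sum => i _; rewrite normrZ; apply: ler_wpM2l.
Qed.

Section Dual.
Variables (d : nat) (b : 'I_d -> V) (T : {linear V -> 'rV[R]_d}) (c : R).
Hypothesis dT : dual_frame b T c.

Lemma dual_coord (a : 'I_d -> R) j : T (\sum_i a i *: b i) 0 j = a j.
Proof.
rewrite linear_sum summxE (bigD1 j)//= big1 ?addr0.
  by rewrite linearZ_LR (dual_frameE dT) !mxE !eqxx mulr1.
by move=> i ij; rewrite linearZ_LR (dual_frameE dT) !mxE eq_sym (negbTE ij) andbF mulr0.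
Qed.

(** Frames close to [b] are uniformly free: the functionals dual to [b] recover the
    coefficients up to an error that the left-hand side absorbs. *)
Lemma coef_bound e (b' : 'I_d -> V) (a : 'I_d -> R) : c * e <= 2^-1 ->
  (forall i, `|b' i - b i| <= e) -> \sum_i `|a i| <= 2 * c * `|\sum_i a i *: b' i|.
Proof.
move=> ce bb; set s := \sum_i `|a i|; set v := \sum_i _.
pose w := \sum_i a i *: (b' i - b i).
have vw : \sum_i a i *: b i = v - w.
  by rewrite /v /w -sumrB; apply: eq_bigr => i _; rewrite -scalerBr opprB addrC subrK.
have s1 : s <= c * `|v| + c * `|w|.
  rewrite (le_trans _ (lerD (dual_frame_bound dT v) (dual_frame_bound dT w)))// -big_split.
  apply: ler_sum => j _; rewrite -[a j]dual_coord vw linearB !mxE.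
  exact: ler_normB.
have s0 : 0 <= s by apply: sumr_ge0.
have ws : `|w| <= s * e by exact: norm_lincomb_le.
have : c * `|w| <= s / 2.
  apply: (le_trans (ler_wpM2l (ltW (dual_frame_gt0 dT)) ws)).
  by rewrite mulrCA; apply: ler_wpM2l.
move: s1; move: (c * `|w|) => z; rewrite -mulrA; move: (c * `|v|) => t; lra.
Qed.

Lemma near_frame e (b' : 'I_d -> V) : c * e <= 2^-1 ->
  (forall i, `|b' i - b i| <= e) -> frame (b' : {ptws 'I_d -> V}).
Proof.
move=> ce bb a a0 i; have := coef_bound a ce bb; rewrite a0 normr0 mulr0 => s0.
apply/eqP; rewrite -normr_le0 (le_trans _ s0)// (bigD1 i)//= lerDl.
exact: sumr_ge0.
Qed.

End Dual.

Lemma near_ptws d (b0 : {ptws 'I_d -> V}) e : 0 < e ->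
  \forall b1 \near b0, forall i, `|b1 i - b0 i| < e.
Proof.
move=> e0.
apply: (@filter_forall _ _ (fun i (b1 : {ptws 'I_d -> V}) => `|b1 i - b0 i| < e) (nbhs b0)) => i.
have Nb : nbhs (b0 i) [set v | `|v - b0 i| < e].
  by apply/nbhs_normP; exists e => // v; rewrite /ball_ /= distrC.
exact: (@proj_continuous 'I_d (fun=> V) i b0 _ Nb).
Qed.

Lemma nbhs_ptws d (b0 : {ptws 'I_d -> V}) e (P : set {ptws 'I_d -> V}) : 0 < e ->
  (forall b1 : {ptws 'I_d -> V}, (forall i, `|b1 i - b0 i| < e) -> P b1) -> nbhs b0 P.
Proof.
move=> e0 H.
exact: (@filterS _ (nbhs b0) _ [set b1 : {ptws 'I_d -> V} | forall i, `|b1 i - b0 i| < e] P H (near_ptws b0 e0)).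
Qed.

Hypothesis dual_frame_ex : forall d (b : 'I_d -> V), frame (b : {ptws 'I_d -> V}) ->
  exists T c, @dual_frame d b T c.

Definition span_nbhd d (b : 'I_d -> V) e : set (set V) :=
  [set L | exists b', (forall i, `|b' i - b i| < e) /\ L = @lspan R V d b'].

Lemma lspan_lincomb d (b : 'I_d -> V) (a : 'I_d -> R) : lspan b (\sum_i a i *: b i).
Proof. by exists a. Qed.

Lemma lspan_gen d (b : 'I_d -> V) i : lspan b (b i).
Proof.
exists (fun j => (j == i)%:R); rewrite (bigD1 i)//= eqxx scale1r big1 ?addr0//.
by move=> j /negbTE ->; rewrite scale0r.
Qed.

Lemma lspan_sub d d' (b : 'I_d -> V) (b' : 'I_d' -> V) : (forall i, lspan b' (b i)) -> lspan b `<=` lspan b'.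
Proof.
move=> /choice[g gE] v [a ->]; exists (fun j => \sum_i a i * g i j).
under eq_bigr => i _ do rewrite gE scaler_sumr.
rewrite exchange_big; apply: eq_bigr => j _ /=; rewrite scaler_suml.
by apply: eq_bigr => i _; rewrite scalerA.
Qed.

(** If a frame [b0] has the span of some [b'] close to [b], the base change from [b0] to
    [b'] turns every frame near [b0] into one of the same span that is still close to
    [b]. *)
Lemma span_nbhd_open d (b : 'I_d -> V) T c e : dual_frame b T c -> c * e <= 2^-1 -> 0 < e ->
  grass_open d (span_nbhd b e).
Proof.
move=> dT ce e0; split.
  move=> L [b' [bb ->]]; exists b' => //.
  exact: (near_frame dT ce (fun i => ltW (bb i))).
rewrite openE => b0 [/= fb0 [b' [bb' Eb]]].
have /choice[g gE] i : lspan b' (b0 i) by rewrite -Eb; exact: lspan_gen.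
have /choice[h hE] i : lspan b0 (b' i) by rewrite Eb; exact: lspan_gen.
have [T0 [c0 dT0]] := dual_frame_ex fb0.
pose b2 (b1 : 'I_d -> V) j := \sum_i h j i *: b1 i.
have c00 := dual_frame_gt0 dT0.
have f1 : nbhs b0 (@frame R V d).
  have e1 : 0 < (2 * c0)^-1 by rewrite invr_gt0 mulr_gt0.
  apply: (nbhs_ptws e1) => b1 b10.
  apply: (near_frame dT0 (e := (2 * c0)^-1)) => [|i]; last exact/ltW.
  by rewrite invfM mulrCA mulfV ?mulr1// gt_eqF.
(* [b2 b1] is the image of [b1] under the base change taking [b0] to [b'] *)
have f2 : nbhs b0 [set b1 : {ptws 'I_d -> V} | forall j, `|b2 b1 j - b j| < e].
  apply: (@filter_forall _ _ (fun j (b1 : {ptws 'I_d -> V}) => `|b2 b1 j - b j| < e) (nbhs b0)) => j.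
  pose K := 1 + \sum_i `|h j i|; have K0 : 0 < K by rewrite ltr_pwDl// sumr_ge0.
  pose e1 := (e - `|b' j - b j|) / K.
  have e10 : 0 < e1 by rewrite divr_gt0// subr_gt0.
  apply: (nbhs_ptws e10) => b1 b10.
  have E : b2 b1 j - b j = \sum_i h j i *: (b1 i - b0 i) + (b' j - b j).
    rewrite addrA; congr (_ - _); rewrite hE -big_split; apply: eq_bigr => i _ /=.
    by rewrite -scalerDr subrK.
  rewrite E (le_lt_trans (ler_normD _ _))// -ltrBrDr.
  apply: (@le_lt_trans _ _ ((\sum_i `|h j i|) * e1)).
    by apply: norm_lincomb_le => i; exact/ltW.
  rewrite -[ltRHS](divfK (lt0r_neq0 K0)) -/e1 mulrC ltr_pM2l//.
  by rewrite /K ltrDr.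
suff H : @frame R V d `&` [set b1 : {ptws 'I_d -> V} | forall j, `|b2 b1 j - b j| < e] `<=`
    @frame R V d `&` [set b' : {ptws 'I_d -> V} | span_nbhd b e (lspan b')].
  exact: (filterS H (filterI f1 f2)).
move=> b1 [fb1 b21]; split => //.
exists (b2 b1); split=> //; apply/seteqP; split; apply: lspan_sub => i; last first.
  exact: lspan_lincomb.
(* the coefficient matrices of [b0] on [b'] and of [b'] on [b0] are inverse to
   each other, because [b0] is free *)
have gh l : \sum_j g i j * h j l = (i == l)%:R.
  rewrite -(dual_coord dT0 (fun l => \sum_j g i j * h j l)).
  have -> : \sum_l (\sum_j g i j * h j l) *: b0 l = b0 i.
    rewrite [RHS]gE; under [RHS]eq_bigr => j _ do rewrite hE scaler_sumr.
    rewrite [RHS]exchange_big; apply: eq_bigr => q _ /=; rewrite scaler_suml.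
    by apply: eq_bigr => j _; rewrite scalerA.
  by rewrite (dual_frameE dT0) mxE eqxx eq_sym.
exists (g i); rewrite /b2; under eq_bigr => j _ do rewrite scaler_sumr.
rewrite exchange_big (bigD1 i)//= [X in _ + X]big1.
  rewrite addr0; under eq_bigr => j _ do rewrite scalerA.
  by rewrite -scaler_suml gh eqxx scale1r.
move=> l li; under eq_bigr => j _ do rewrite scalerA.
by rewrite -scaler_suml gh eq_sym (negbTE li) scale0r.
Qed.

(** Let [T] be dual to a frame [b] of [tau]. The map sending [v] to
    [v - \sum_i T v 0 i *: b i] vanishes exactly on [tau] and is small, relative to the
    norm, on spans of frames close to [b]; so it vanishes at [e]. *)
Lemma grass_limit d (L : nat -> set V) (tau : set V) (e : V) :
  grass_cvg d L tau ->
  (forall eps, 0 < eps -> \forall k \near \oo, exists2 v, L k v & `|v - e| < eps) ->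
  tau e.
Proof.
move=> [[b fb <-] Lcvg] He.
have [T [c dT]] := dual_frame_ex fb; have c0 := dual_frame_gt0 dT.
pose q (v : V) := v - \sum_i T v 0 i *: b i.
pose K := 1 + c * \sum_i `|b i|.
have K0 : 0 < K by rewrite ltr_pwDl// mulr_ge0 ?(ltW c0)// sumr_ge0.
have qD u v : q (u + v) = q u + q v.
  rewrite /q addrACA; congr (_ + _); rewrite -opprD -big_split; congr (- _).
  by apply: eq_bigr => i _; rewrite linearD mxE scalerDl.
have qZ a v : q (a *: v) = a *: q v.
  rewrite /q scalerBr; congr (_ - _); rewrite scaler_sumr; apply: eq_bigr => i _.
  by rewrite linearZ_LR mxE scalerA.
have q0 : q 0 = 0 by have := qZ 0 0; rewrite !scale0r.
have qb j : q (b j) = 0.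
  rewrite /q (dual_frameE dT) (bigD1 j)//= mxE !eqxx scale1r big1 ?addr0 ?subrr//.
  by move=> i /negbTE ij; rewrite mxE ij andbF scale0r.
have qK v : `|q v| <= K * `|v|.
  rewrite (le_trans (ler_normB _ _))// mulrDl mul1r lerD2l.
  rewrite (le_trans (ler_norm_sum _ _ _))//.
  apply: (@le_trans _ _ (\sum_i `|T v 0 i| * \sum_j `|b j|)).
    apply: ler_sum => i _; rewrite normrZ ler_wpM2l// (bigD1 i)//= lerDl.
    exact: sumr_ge0.
  rewrite -mulr_suml mulrAC; apply: ler_wpM2r; first exact: sumr_ge0.
  exact: (dual_frame_bound dT).
suff : q e = 0 by move=> /subr0_eq ->; exact: lspan_lincomb.
pose M := K + 2 * c * (`|e| + 1) * K.
have M0 : 0 < M by rewrite ltr_pwDl// !mulr_ge0 ?(ltW c0) ?(ltW K0)// addr_ge0.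
have bound eps : 0 < eps -> eps <= 1 -> c * eps <= 2^-1 -> `|q e| <= M * eps.
  move=> e0 e1 ce.
  have Onear := Lcvg _ (span_nbhd_open dT ce e0).
  have [|k [[b' [bb' LE]] [v Lv ve]]] := @filter_ex _ \oo _ _ (filterI (Onear _) (He eps e0)).
    by exists b; split=> // i; rewrite subrr normr0.
  move: Lv; rewrite LE => -[a vE].
  have aS := coef_bound dT a ce (fun i => ltW (bb' i)).
  have vn : `|v| <= `|e| + 1.
    rewrite -[v](subrK e) addrC (le_trans (ler_normD _ _))// lerD2l.
    exact: le_trans (ltW ve) e1.
  have -> : q e = q v + q (e - v) by rewrite -qD addrC subrK.
  have qv : `|q v| <= (2 * c * (`|e| + 1)) * (K * eps).
    have -> : q v = \sum_i a i *: q (b' i - b i).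
      have qsum (I : Type) (r : seq I) (f : I -> V) : q (\sum_(i <- r) f i) = \sum_(i <- r) q (f i).
        exact: (big_morph q qD q0).
      rewrite vE qsum; apply: eq_bigr => i _.
      rewrite qZ; congr (_ *: _).
      by rewrite -{1}(subrK (b i) (b' i)) qD qb addr0.
    apply: (@le_trans _ _ ((\sum_i `|a i|) * (K * eps))).
      apply: norm_lincomb_le => i; rewrite (le_trans (qK _))// ler_pM2l//.
      exact/ltW.
    apply: ler_wpM2r; first by rewrite mulr_ge0// ltW.
    rewrite (le_trans aS)// -vE; apply: ler_wpM2l => //.
    by rewrite mulr_ge0// ltW.
  rewrite (le_trans (ler_normD _ _))// /M mulrDl addrC; apply: lerD.
    by rewrite (le_trans (qK _))// ler_pM2l// distrC ltW.
  by rewrite -mulrA.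
apply/eqP; rewrite -normr_eq0; apply/negPn/negP => qe0.
have qp : 0 < `|q e| by rewrite lt0r qe0/=.
pose eps := Num.min (Num.min 1 (2 * c)^-1) (`|q e| / (2 * M)).
have e0 : 0 < eps by rewrite !lt_min ltr01 invr_gt0 mulr_gt0// divr_gt0// mulr_gt0.
have e1 : eps <= 1 by rewrite /eps !ge_min lexx.
have e2 : eps <= (2 * c)^-1 by rewrite /eps !ge_min lexx orbT.
have e3 : eps <= `|q e| / (2 * M) by rewrite /eps ge_min lexx orbT.
have ce : c * eps <= 2^-1.
  by apply: (le_trans (ler_wpM2l (ltW c0) e2)); rewrite invfM mulrCA mulfV ?mulr1 ?gt_eqF.
have := le_trans (bound eps e0 e1 ce) (ler_wpM2l (ltW M0) e3).
have -> : M * (`|q e| / (2 * M)) = `|q e| / 2.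
  by rewrite invfM mulrCA (mulrCA M) mulfV ?mulr1 ?gt_eqF.
move: qp; move: `|q e| => z; lra.
Qed.

End Grassmannian.

(** * Tangent vectors *)

Section Tangent.
Variables (R : realType) (k : nat) (n_ : 'I_k -> nat).
Local Notation C := R[i].
Local Notation m := (\sum_i n_ i)%N.
Local Notation A := (@blockalg R k n_).
Local Notation sa := (sa R n_).
Local Notation D := (density R n_).
Local Notation S := (@stratum R k n_).

Lemma sa_dual_frame d (b : 'I_d -> sa) : frame (b : {ptws 'I_d -> sa}) ->
  exists (T : {linear sa -> 'rV[R]_d}) c, dual_frame b T c.
Proof.
move=> fb; have [N [phi [psi [phiK psiK]]]] := sa_coordinates R n_.
pose B : 'M[R]_(d, N) := \matrix_i phi (b i).
have rB i : row i B = phi (b i) by rewrite rowK.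
have freeB : row_free B.
  rewrite -kermx_eq0; apply/eqP/row_matrixP => i; rewrite row0.
  set u := row i _; have : u *m B = 0 by apply/eqP; rewrite -sub_kermx row_sub.
  rewrite mulmx_sum_row => u0; apply/rowP => j; rewrite [RHS]mxE; apply: fb.
  apply: (can_inj phiK); rewrite raddf0 linear_sum -[RHS]u0; apply: eq_bigr => l _.
  by rewrite rB linearZ_LR.
pose T := mulmxr (pinvmx B) \o phi.
have [c c0 cT] := sa_linear_bounded T.
exists T, (1 + d%:R * c); split=> [j||v].
- by rewrite /T/= -rB -row_mul mulmxVp// row1.
- by rewrite ltr_pwDl// mulr_ge0// ltW.
- rewrite mulrDl mul1r (@le_trans _ _ (\sum_(i < d) `|T v|))//.
    by apply: ler_sum => i _; exact: entry_le_mx_norm.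
  rewrite sumr_const card_ord -[_ *+ d]mulr_natl.
  apply: (@le_trans _ _ (d%:R * (c * `|v|))); first by apply: ler_wpM2l; [exact: ler0n|exact: cT].
  by rewrite mulrA lerDr.
Qed.

Section Curve.
Variables (r : {ffun 'I_k -> 'I_m.+1}) (x : sa) (p : 'M[C]_m).
Hypothesis Sx : S r x.
Hypothesis rp : range_proj (sa_val x) p.
Variable v : sa.
Hypothesis vq : (1%:M - p) *m sa_val v *m (1%:M - p) = 0.
Hypothesis tv : \tr (sa_val v) = 0.

Lemma tangent_lift : exists2 a, a \in A & a *m sa_val x + sa_val x *m a^t* = sa_val v.
Proof.
have [Z [ZA Zh xZ Zx]] := rproj_fact rp.
pose h : C := 2^-1.
have hh : h^* = h by rewrite /h fmorphV rmorph_nat.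
(* [v p + p v] counts [p v p] twice, whence the subtraction of one half of it on
   each side *)
exists (sa_val v *m Z - h *: (p *m sa_val v *m Z)).
  by rewrite blockalgB ?blockalgZ ?blockalgM ?sa_alg ?(rproj_alg rp).
have E1 : (sa_val v *m Z - h *: (p *m sa_val v *m Z)) *m sa_val x =
    sa_val v *m p - h *: (p *m sa_val v *m p).
  by rewrite mulmxBl -scalemxAl -!mulmxA Zx.
have E2 : sa_val x *m (sa_val v *m Z - h *: (p *m sa_val v *m Z))^t* =
    p *m sa_val v - h *: (p *m sa_val v *m p).
  have -> : (sa_val v *m Z - h *: (p *m sa_val v *m Z))^t* = Z *m sa_val v - h *: (Z *m sa_val v *m p).
    rewrite trmxCB linearZ/= map_mxZ/= !trmxC_mul Zh sa_herm (rproj_herm rp) mulmxA.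
    by congr (_ - _ *: _).
  by rewrite mulmxBr -scalemxAr !mulmxA xZ.
have h2 (M : 'M[C]_m) : h *: M + h *: M = M.
  by rewrite -scalerDl -mulr2n -mulr_natr mulVf ?pnatr_eq0// scale1r.
have vE : sa_val v *m p + p *m sa_val v - p *m sa_val v *m p = sa_val v.
  move: vq; rewrite mulmxBl mul1mx mulmxBr mulmx1 mulmxBl => /eqP.
  rewrite opprB addrA subr_eq0 => /eqP E.
  have -> : sa_val v *m p = sa_val v + p *m sa_val v *m p - p *m sa_val v.
    by rewrite -E addrAC.
  by rewrite subrK addrK.
rewrite E1 E2 addrACA -opprD h2; exact: vE.
Qed.

(** With [a] from [tangent_lift], the curve [act (1 + t a) x] has velocity [v] at 0 and
    stays in the stratum as long as [1 + t a] is invertible. *)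
Lemma tangent_velocity : tangent (S r) x v.
Proof.
have [a aA aE] := tangent_lift.
pose u := a *m sa_val x *m a^t*.
have [uA uh] := congr_sa x aA.
have [[px tx] rx] := Sx.
pose s := complex.Re (\tr u).
have su : \tr u = s%:C by rewrite RRe_real// herm_tr_real.
have pu : psdmx u := psd_congr a px.
have s0 : 0 <= s by rewrite -lecR -su; exact: (psd_tr_ge0 pu).
pose tau (t : R) := 1 + s * (t * t).
have tau0 t : tau t != 0 by rewrite gt_eqF// ltr_pwDl// mulr_ge0// -expr2 sqr_ge0.
pose U : sa := sa_proj u.
pose g (t : R) : 'M[C]_m := 1%:M + t%:C *: a.
pose c (t : R) : sa := act (g t) x.
have gE t : g t *m sa_val x *m (g t)^t* = sa_val x + t%:C *: sa_val v + (t * t)%:C *: u.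
  have -> : (g t)^t* = 1%:M + t%:C *: a^t*.
    rewrite trmxCD trmxC1 linearZ/= map_mxZ/=; congr (_ + _ *: _).
    by apply/eqP; rewrite eq_complex/= oppr0 !eqxx.
  rewrite /g mulmxDl mul1mx mulmxDr mulmx1 mulmxDl -!scalemxAl -!scalemxAr -aE scalerDr scalerA -rmorphM.
  by rewrite -/u !addrA; congr (_ + _); rewrite -!addrA; congr (_ + _); rewrite addrC.
have trE t : \tr (g t *m sa_val x *m (g t)^t*) = (tau t)%:C.
  by rewrite gE !mxtraceD !mxtraceZ tv mulr0 addr0 tx su /tau rmorphD rmorph1 [in RHS]rmorphM mulrC.
have cE t : c t = (tau t)^-1 *: x + (t * (tau t)^-1) *: v + (t * t * (tau t)^-1) *: U.
  rewrite /c /act trE gE -fmorphV sa_projZ !sa_projD !sa_projZ !sa_proj_val !scalerDr !scalerA.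
  by rewrite ![(tau t)^-1 * _]mulrC.
have sid (O : set R) : open O -> smooth_on O (fun t : R => t).
  by move=> oO l; apply: (Cm_on_linear oO l (f := idfun)) => t; exact: cvg_id.
have stau (O : set R) : open O -> smooth_on O (fun t : R => (tau t)^-1).
  move=> oO l; apply: Cm_onV => //; apply: Cm_onD => //; first exact: Cm_on_cst.
  apply: Cm_onM => //; first exact: Cm_on_cst.
  by apply: Cm_onM => //; exact: sid.
have sc (O : set R) : open O -> smooth_on O c.
  move=> oO l; rewrite (funext cE).
  apply: Cm_onD => //; first apply: Cm_onD => //; apply: Cm_onZl => //.
  - exact: stau.
  - by apply: Cm_onM => //; [exact: sid|exact: stau].
  - by apply: Cm_onM => //; [apply: Cm_onM => //; exact: sid|exact: stau].
have g0 : g 0 = 1%:M by rewrite /g rmorph0 scale0r addr0.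
have [sdet _] : cfun [set f : R -> R | smooth_on setT f] (fun t => \det (g t)).
  have SA := smooth_algebra (@openT R).
  apply: (cfun_det SA); apply: (mxfunD SA); first exact: mxfun_cst.
  apply: (mxfunZ SA); last exact: mxfun_cst.
  by apply: (cfun_real SA); exact: (sid _ openT).
have oG : open [set t : R | 0 < complex.Re (\det (g t))].
  have := smooth_open_gt0 openT sdet; by rewrite setTI.
have G0 : [set t : R | 0 < complex.Re (\det (g t))] 0 by rewrite /= g0 det1 ltr01.
have /nbhs_ballP[e /= e0 eG] := open_nbhs_nbhs (conj oG G0).
have diff_s (f : R -> R) : smooth_on setT f -> differentiable f 0.
  by move=> /(_ 1%N)[df _]; exact: df.
have dM (f h : R -> R) : smooth_on setT f -> smooth_on setT h ->
    'D_1 (fun t : R => f t * h t) 0 = f 0 * 'D_1 h 0 + h 0 * 'D_1 f 0.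
  by move=> /diff_s/diff_derivable df /diff_s/diff_derivable dh; exact: (deriveM (df 1) (dh 1)).
have s1 := sid _ openT; have s2 := stau _ openT.
have sM (f h : R -> R) : smooth_on setT f -> smooth_on setT h ->
    smooth_on setT (fun t : R => f t * h t).
  by move=> sf sh l; exact: (Cm_onM openT (sf l) (sh l)).
have s11 : smooth_on setT (fun t : R => t * t) := sM _ _ s1 s1.
have d11 : 'D_1 (fun t : R => t * t) 0 = 0 by rewrite (dM _ _ s1 s1) !mul0r addr0.
have scst (a0 : R) : smooth_on setT (fun _ : R => a0) by move=> l; exact: (Cm_on_cst openT).
have sc1 := scst s.
have ss : smooth_on setT (fun t : R => s * (t * t)) by exact: (sM _ _ sc1 s11).
have stau' : smooth_on setT tau by move=> l; exact: (Cm_onD openT (scst 1 l) (ss l)).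
have dtau : 'D_1 tau 0 = 0.
  have d1 : derivable (cst 1 : R -> R) 0 1 by exact: derivable_cst.
  have -> : 'D_1 tau 0 = 'D_1 (cst 1 : R -> R) 0 + 'D_1 (fun t : R => s * (t * t)) 0.
    exact: (deriveD d1 (diff_derivable (diff_s _ ss))).
  by rewrite derive_cst add0r (dM _ _ sc1 s11) d11 mulr0 derive_cst mulr0 addr0.
have dtauV : 'D_1 (fun t : R => (tau t)^-1) 0 = 0.
  by rewrite (deriveV (tau0 0) (diff_derivable (diff_s _ stau'))) dtau scaler0.
have dZ (f : R -> R) (w : sa) : smooth_on setT f ->
    is_derive (0 : R) (1 : R) (fun t => f t *: w) ('D_1 f 0 *: w).
  move=> /diff_s df; have dfw := differentiableZl w df.
  apply: DeriveDef; first exact: diff_derivable.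
  by rewrite !deriveE// diffZl.
have sf2 : smooth_on setT (fun t : R => t * (tau t)^-1) := sM _ _ s1 s2.
have sf3 : smooth_on setT (fun t : R => t * t * (tau t)^-1) := sM _ _ s11 s2.
have dc : is_derive (0 : R) (1 : R) c
    ('D_1 (fun t : R => (tau t)^-1) 0 *: x + 'D_1 (fun t : R => t * (tau t)^-1) 0 *: v +
     'D_1 (fun t : R => t * t * (tau t)^-1) 0 *: U).
  by rewrite (funext cE); apply: is_deriveD (is_deriveD (dZ _ x s2) (dZ _ v sf2)) (dZ _ U sf3).
have tau00 : (tau 0)^-1 = 1 by rewrite /tau !mulr0 addr0 invr1.
have Dc : 'D_1 c 0 = v.
  case: dc => _ ->; rewrite dtauV (dM _ _ s1 s2) (dM _ _ s11 s2) d11 dtauV.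
  by rewrite tau00 derive_id !(mul0r, mulr0, scale0r, add0r, addr0, mul1r) scale1r.
have Sc t : ball (0 : R) e t -> S r (c t).
  move=> /eG/= dt; apply: act_stratum => //.
    by apply: blockalgD; [exact: blockalg1|exact: blockalgZ].
  rewrite unitmxE unitfE; apply/eqP => d0; move: dt; rewrite d0.
  by rewrite ltxx.
have c0 : c 0 = x by rewrite cE tau00 !(mul0r, scale0r, addr0) scale1r.
by exists c, e; split; [exact: e0|by apply: sc; exact: ball_open|exact: Sc|exact: c0|exact: Dc].
Qed.

End Curve.
End Tangent.

(** * Whitney's condition (B) *)

Section MatrixNorm.
Variables (R : realType) (m : nat).
Local Notation C := R[i].
Implicit Types M N : 'M[C]_m.

Definition mxn M : R := complex.Re `|M|.

Lemma mxnE M : (mxn M)%:C = `|M|.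
Proof. by rewrite /mxn RRe_real// normr_real. Qed.

Lemma mxn_ge0 M : 0 <= mxn M.
Proof. by rewrite -lecR mxnE; exact: normr_ge0. Qed.

Lemma entry_le_mxn M a b : `|M a b| <= (mxn M)%:C.
Proof. by rewrite mxnE; exact: entry_le_mx_norm. Qed.

Lemma mxn_le M (c : R) : 0 <= c -> (forall a b, `|M a b| <= c%:C) -> mxn M <= c.
Proof.
move=> c0 Mc; rewrite -lecR mxnE.
have [E|/mx_norm_neq0[[a b] E]] := eqVneq (mx_norm M) 0; rewrite [leLHS]E; last exact: Mc.
by rewrite lecR.
Qed.

Lemma mxnM M N : mxn (M *m N) <= m%:R * (mxn M * mxn N).
Proof.
apply: mxn_le => [|a b]; first by rewrite !mulr_ge0 ?mxn_ge0.
rewrite mxE (le_trans (ler_norm_sum _ _ _))//.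
apply: (@le_trans _ _ (\sum_(j < m) (mxn M * mxn N)%:C)).
  apply: ler_sum => j _; rewrite normrM rmorphM/=.
  by apply: ler_pM => //; exact: entry_le_mxn.
by rewrite sumr_const card_ord mulr_natl -rmorphMn.
Qed.

Lemma norm_tr_le M : `|\tr M| <= (m%:R * mxn M)%:C.
Proof.
rewrite (le_trans (ler_norm_sum _ _ _))//.
apply: (@le_trans _ _ (\sum_(j < m) (mxn M)%:C)).
  by apply: ler_sum => j _; exact: entry_le_mxn.
by rewrite sumr_const card_ord mulr_natl -rmorphMn.
Qed.

(** The diagonal entry [q a a] is the sum of the squares of the [q a j]; as it
    dominates its own square, it is at most 1. *)
Lemma mxn_proj_le1 (q : 'M[C]_m) : q^t* = q -> q *m q = q -> mxn q <= 1.
Proof.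
move=> qh qq; apply: mxn_le => // a b.
have sq : \sum_j `|q a j| ^+ 2 = q a a.
  rewrite -[in RHS]qq mxE; apply: eq_bigr => j _.
  have -> : q j a = (q a j)^* by rewrite -[in LHS]qh !mxE.
  by rewrite normCK.
have le_qaa j : `|q a j| ^+ 2 <= q a a.
  by rewrite -sq (bigD1 j)//= lerDl; apply: sumr_ge0 => l _; exact: exprn_ge0.
have qa0 : 0 <= q a a by rewrite -sq; apply: sumr_ge0 => l _; exact: exprn_ge0.
have qa1 : q a a <= 1.
  have := le_qaa a; rewrite (ger0_norm qa0) expr2.
  have [->|q0] := eqVneq (q a a) 0; first by rewrite ler01.
  by rewrite ger_pMl// lt0r q0.
rewrite -(@ler_pXn2r _ 2)// ?nnegrE// expr1n.
exact: le_trans (le_qaa b) qa1.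
Qed.

End MatrixNorm.

Section Whitney.
Variables (R : realType) (k : nat) (n_ : 'I_k -> nat).
Local Notation C := R[i].
Local Notation m := (\sum_i n_ i)%N.
Local Notation A := (@blockalg R k n_).
Local Notation sa := (sa R n_).
Local Notation D := (density R n_).
Local Notation S := (@stratum R k n_).

Lemma norm_sa_proj (M : 'M[C]_m) : M \in A -> M^t* = M -> `|sa_proj M : sa| = mxn M.
Proof. by move=> MA Mh; rewrite -[LHS]/(mxn (sa_val (sa_proj M))) sa_projK. Qed.

Lemma nbhs_norm_lt (V : normedModType R) (y : V) e : 0 < e -> nbhs y [set z | `|z - y| < e].
Proof.
by move=> e0; apply/nbhs_normP; exists e => // z; rewrite /ball_ /= distrC.
Qed.

Lemma near_bounded (V : normedModType R) (f : V -> R) (y : V) : {for y, continuous f} ->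
  \forall z \near y, `|f z| <= `|f y| + 1.
Proof.
move=> cf; have N : nbhs (f y) [set u | `|u| <= `|f y| + 1].
  apply/nbhs_normP; exists 1 => [|u]; [exact: ltr01|rewrite /ball_ /= => h].
  rewrite -[u](subrK (f y)) addrC (le_trans (ler_normD _ _))// lerD2l distrC.
  exact: ltW.
exact: (cf _ N).
Qed.

Lemma near_inv_bounded (y0 : sa) (p : 'M[C]_m) : p^t* = p -> posdef (corner p (sa_val y0)) ->
  exists2 K, 0 <= K & \forall y \near y0,
    posdef (corner p (sa_val y)) /\ mxn (invmx (corner p (sa_val y))) <= K.
Proof.
move=> ph pd0; pose O1 := [set y : sa | posdef (corner p (sa_val y))].
have sE := @smooth_sa_entries R k n_ setT openT.
have oO1 : open O1.
  by have := open_posdef_corner ph openT (@sa_herm R k n_) sE; rewrite setTI.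
have O1y0 : O1 y0 by exact: pd0.
have sI : mxfun [set f : sa -> R | smooth_on O1 f] (fun y => invmx (corner p (sa_val y))).
  apply: mxsmoothV => //; first by move=> y [].
  apply: smooth_corner => //; exact: smooth_sa_entries.
pose N (y : sa) := invmx (corner p (sa_val y)).
pose K := \sum_a \sum_b ((`|complex.Re (N y0 a b)| + 1) + (`|complex.Im (N y0 a b)| + 1)).
have t0 a b : 0 <= (`|complex.Re (N y0 a b)| + 1) + (`|complex.Im (N y0 a b)| + 1).
  by rewrite !addr_ge0.
have K0 : 0 <= K by apply: sumr_ge0 => a _; apply: sumr_ge0 => b _.
exists K => //.
have nb : \forall y \near y0, forall ab : 'I_m * 'I_m,
    `|complex.Re (N y ab.1 ab.2)| <= `|complex.Re (N y0 ab.1 ab.2)| + 1 /\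
    `|complex.Im (N y ab.1 ab.2)| <= `|complex.Im (N y0 ab.1 ab.2)| + 1.
  apply: (@filter_forall _ _ (fun (ab : 'I_m * 'I_m) y =>
    `|complex.Re (N y ab.1 ab.2)| <= `|complex.Re (N y0 ab.1 ab.2)| + 1 /\
    `|complex.Im (N y ab.1 ab.2)| <= `|complex.Im (N y0 ab.1 ab.2)| + 1) (nbhs y0)) => -[a b] /=.
  have [s1 s2] := sI a b.
  have c1 := near_bounded (smooth_on_continuous s1 O1y0).
  have c2 := near_bounded (smooth_on_continuous s2 O1y0).
  exact: (filterI c1 c2).
have nO : \forall y \near y0, O1 y by exact: open_nbhs_nbhs.
apply: filterS2 nO nb => y Oy By; split; first exact: Oy.
apply: mxn_le => // a b; have [B1 B2] := By (a, b).
rewrite -/(N y) [N y a b]complex_rect (le_trans (ler_normD _ _))//.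
have E (u : R) : `|u%:C| = (`|u|)%:C by rewrite normc_def/= expr0n addr0 sqrtr_sqr.
rewrite normrM [`|'i%C|]normc_def/= expr0n expr1n add0r sqrtr1 mulr1 !E -rmorphD/= lecR.
apply: (le_trans (lerD B1 B2)); rewrite /K (bigD1 a)//= (bigD1 b)//= -[leRHS]addrA lerDl.
by rewrite addr_ge0// ?sumr_ge0// => i _; rewrite ?sumr_ge0.
Qed.

(** The rank of [y] is that of [y0], hence [y = y p N p y] where [p] is the range
    projection of [y0] and [N] the inverse of the corner of [y], bounded near [y0]. *)
Lemma kernel_estimate r (y0 : sa) : S r y0 ->
  exists2 K, 0 <= K & \forall y \near y0, S r y ->
    forall (x : sa) (q : 'M[C]_m), q^t* = q -> q *m q = q -> sa_val x *m q = 0 ->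
    mxn (q *m sa_val y *m q) <= K * (`|x - y| * `|x - y|).
Proof.
move=> Sy0; have [p rp] := range_proj_ex (sa_alg y0) (sa_herm y0).
have ph := rproj_herm rp; have pp := rproj_idem rp; have [[py0 _] ry0] := Sy0.
have [K K0 HK] := near_inv_bounded ph (rproj_corner rp py0).
have m0 : 0 <= m%:R :> R by exact: ler0n.
exists (m%:R ^+ 6 * K); first by rewrite mulr_ge0// exprn_ge0.
apply: filterS HK => y [[pB Bu] NK] [Dy ry] x q qh qq xq.
set N := invmx (corner p (sa_val y)) in NK.
have rkE : \rank (sa_val y) = \rank p.
  rewrite !rank_block ?sa_alg ?(rproj_alg rp)//; apply: eq_bigr => i _.
  by rewrite (rproj_rank rp) ry0 ry.
have yE : sa_val y = sa_val y *m p *m N *m p *m sa_val y.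
  have nB : N *m corner p (sa_val y) = 1%:M by rewrite mulVmx.
  have Bn : corner p (sa_val y) *m N = 1%:M by rewrite mulmxV.
  exact: (corner_full pp erefl nB Bn (rank_corner pp Bu rkE)).
pose e := sa_val (x - y).
have yq : sa_val y *m q = - (e *m q) by rewrite /e sa_valB mulmxBl xq sub0r opprK.
have qx : q *m sa_val x = 0.
  by have := congr1 (fun M : 'M[C]_m => M^t*) xq; rewrite trmxC_mul qh sa_herm trmx0 map_mx0.
have qy : q *m sa_val y = - (q *m e) by rewrite /e sa_valB mulmxBr qx sub0r opprK.
(* both outer factors are small since [x *m q = 0] and [q *m x = 0] *)
have -> : q *m sa_val y *m q = q *m e *m p *m N *m p *m (e *m q).
  rewrite {1}yE.
  have -> : q *m (sa_val y *m p *m N *m p *m sa_val y) *m q =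
    (q *m sa_val y) *m p *m N *m p *m (sa_val y *m q) by rewrite !mulmxA.
  by rewrite yq qy mulmxN !mulNmx opprK.
have q1 := mxn_proj_le1 qh qq; have p1 := mxn_proj_le1 ph pp.
have ee : mxn e = `|x - y| by [].
have step (M M' : 'M[C]_m) (u u' : R) : mxn M <= u -> mxn M' <= u' -> mxn (M *m M') <= m%:R * (u * u').
  move=> Mu Mu'; apply: (le_trans (mxnM M M')); apply: ler_wpM2l => //.
  by apply: ler_pM; rewrite ?mxn_ge0.
have e1 : mxn e <= `|x - y| by rewrite ee.
have := step _ _ _ _ (step _ _ _ _ (step _ _ _ _ (step _ _ _ _ (step _ _ _ _ q1 e1) p1) NK) p1) (step _ _ _ _ e1 q1).
rewrite !mul1r !mulr1; move=> h; apply: (le_trans h).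
set z := `|x - y|; rewrite le_eqVlt; apply/orP; left; apply/eqP.
by ring.
Qed.

(** Some multiple of [x - y] is close to a generator of the limiting line, and
    [kernel_estimate] provides a tangent vector at [x] close to this multiple. *)
Lemma stratum_whitneyB r s : whitneyB (S r) (S s).
Proof.
move=> x y y0 d l tau Sx Sy Sy0 xy0 yy0 xNy lcvg taucvg.
have [[b1 fb1 lE] lnear] := lcvg; have [[b fb tauE] _] := taucvg.
pose e := b1 ord0.
suff te : tau e.
  rewrite -lE -tauE; apply: lspan_sub => i; rewrite (ord1 i) tauE; exact: te.
apply: (grass_limit (@sa_dual_frame R k n_) taucvg) => eps eps0.
have [K K0 HK] := kernel_estimate Sy0.
pose K2 := K + m%:R * K * (`|y0| + 1).
have K20 : 0 <= K2 by rewrite addr_ge0// !mulr_ge0// ?addr_ge0.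
have [T1 [c1 dT1]] := sa_dual_frame fb1; have c10 := dual_frame_gt0 dT1.
(* the generators of the secants are required to be [e1]-close to [e] *)
pose e1 := Num.min (Num.min 1 (2 * c1)^-1) (eps / 2).
have e10 : 0 < e1 by rewrite !lt_min ltr01 invr_gt0 mulr_gt0// divr_gt0.
have e1a : e1 <= 1 by rewrite /e1 !ge_min lexx.
have e1b : e1 <= (2 * c1)^-1 by rewrite /e1 !ge_min lexx orbT.
have e1c : e1 <= eps / 2 by rewrite /e1 ge_min lexx orbT.
have ce1 : c1 * e1 <= 2^-1.
  by apply: (le_trans (ler_wpM2l (ltW c10) e1b)); rewrite invfM mulrCA mulfV ?mulr1 ?gt_eqF.
have nl := lnear _ (span_nbhd_open (@sa_dual_frame R k n_) dT1 ce1 e10).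
have {}nl : \forall j \near \oo, span_nbhd b1 e1 (secant (x j) (y j)).
  by apply: nl; rewrite -lE; exists b1; split=> // i; rewrite subrr normr0.
(* if the points are within [eta] of [y0], the tangent vector built below is
   within [eps / 2] of the chosen generator of the secant *)
pose M := K2 * (`|e| + 1) + 1.
have M0 : 0 < M by rewrite ltr_wpDl// mulr_ge0// addr_ge0.
pose eta := Num.min 1 (eps / (2 * M) / 2).
have eta0 : 0 < eta by rewrite lt_min ltr01 !divr_gt0// mulr_gt0.
have nx : \forall j \near \oo, `|x j - y0| < eta.
  exact: (xy0 _ (nbhs_norm_lt y0 eta0)).
have ny : \forall j \near \oo, `|y j - y0| < eta.
  exact: (yy0 _ (nbhs_norm_lt y0 eta0)).
have nK := yy0 _ HK.
apply: filterS2 (filterI nl nK) (filterI nx ny) => j [nlj nKj] [nxj nyj].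
have {}nKj := nKj (Sy j).
have [b' [bb' LE]] := nlj.
have [t _ tE] : secant (x j) (y j) (b' ord0) by rewrite LE; exact: lspan_gen.
have [p rp] := range_proj_ex (sa_alg (x j)) (sa_herm (x j)).
have ph := rproj_herm rp; have pp := rproj_idem rp.
pose q := 1%:M - p.
have qh : q^t* = q by rewrite trmxCB trmxC1 ph.
have qp : q *m p = 0 by rewrite mulmxBl mul1mx pp subrr.
have qq : q *m q = q by rewrite [LHS]mulmxBr mulmx1 qp subr0.
have xq : sa_val (x j) *m q = 0 by rewrite mulmxBr mulmx1 (rproj_mulr rp) subrr.
have qx : q *m sa_val (x j) = 0 by rewrite mulmxBl mul1mx (rproj_mul rp) subrr.
have qA : q \in A by rewrite blockalgB ?blockalg1 ?(rproj_alg rp).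
pose z : sa := sa_proj (q *m sa_val (y j) *m q).
have zA : q *m sa_val (y j) *m q \in A by rewrite !blockalgM ?sa_alg.
have zh : (q *m sa_val (y j) *m q)^t* = q *m sa_val (y j) *m q.
  by rewrite !trmxC_mul qh sa_herm mulmxA.
have zE : sa_val z = q *m sa_val (y j) *m q by exact: sa_projK.
pose tz : R := complex.Re (\tr (sa_val z)).
have tzE : \tr (sa_val z) = tz%:C by rewrite RRe_real// tr_sa_real.
(* adding [q y q] cancels the part of [x - y] that is normal to the stratum of
   [x]; the last term restores the zero trace *)
pose v : sa := (x j - y j) + z - tz *: x j.
have [[_ trx] _] := Sx j; have [[_ try] _] := Sy j.
have qv : q *m sa_val v *m q = 0.
  rewrite sa_valB sa_valD sa_valB sa_valZ zE.
  rewrite [q *m (_ - _ *: _)]mulmxBr [LHS]mulmxBl -scalemxAr qx scaler0 mul0mx subr0.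
  rewrite [q *m (_ + q *m _ *m q)]mulmxDr [q *m (_ - sa_val (y j))]mulmxBr qx sub0r.
  rewrite [LHS]mulmxDl mulNmx !mulmxA qq -[_ *m q *m q]mulmxA qq.
  by rewrite addNr.
have trv : \tr (sa_val v) = 0.
  rewrite sa_valB sa_valD sa_valB sa_valZ !raddfB/= raddfD/= raddfB/= mxtraceZ tzE trx try.
  by rewrite subrr add0r mulr1 subrr.
have Tv : tangent (S s) (x j) (t *: v).
  apply: (tangent_velocity (Sx j) rp).
    by rewrite sa_valZ -scalemxAr -scalemxAl qv scaler0.
  by rewrite sa_valZ mxtraceZ trv mulr0.
exists (t *: v) => //.
set del := `|x j - y j| in nKj *.
have zn : `|z| <= K * (del * del).
  by rewrite norm_sa_proj//; exact: (nKj (x j) q qh qq xq).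
have tn : `|tz| <= m%:R * K * (del * del).
  rewrite -lecR (le_trans (norm_Re _))// (le_trans (norm_tr_le _))// lecR -mulrA.
  by rewrite ler_wpM2l.
have eta1 : eta <= 1 by rewrite /eta ge_min lexx.
have xn : `|x j| <= `|y0| + 1.
  rewrite -[x j](subrK y0) addrC (le_trans (ler_normD _ _))// lerD2l.
  exact: le_trans (ltW nxj) eta1.
have vn : `|v - (x j - y j)| <= K2 * (del * del).
  have -> : v - (x j - y j) = z - tz *: x j by rewrite /v [LHS]addrAC (addrC (x j - y j)) addrK.
  rewrite (le_trans (ler_normB _ _))// /K2 mulrDl; apply: lerD => //.
  by rewrite normrZ mulrAC; apply: ler_pM.
have del_eta : del < 2 * eta.
  have -> : del = `|(x j - y0) - (y j - y0)| by rewrite /del opprB addrA subrK.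
  rewrite (le_lt_trans (ler_normB _ _))// mulr_natl mulr2n.
  exact: ltrD.
have b'n : `|t| * del <= `|e| + 1.
  rewrite -normrZ tE -[b' ord0](subrK e) addrC (le_trans (ler_normD _ _))// lerD2l.
  exact: le_trans (ltW (bb' ord0)) e1a.
have tv : `|t *: v - b' ord0| <= K2 * (`|e| + 1) * del.
  rewrite -tE -scalerBr normrZ.
  apply: (le_trans (ler_wpM2l (normr_ge0 t) vn)).
  have -> : `|t| * (K2 * (del * del)) = K2 * (`|t| * del) * del by ring.
  apply: ler_wpM2r; first exact: normr_ge0.
  exact: ler_wpM2l.
have small : K2 * (`|e| + 1) * del < eps / 2.
  apply: (@le_lt_trans _ _ (M * del)).
    by apply: ler_wpM2r; [exact: normr_ge0|rewrite /M lerDl].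
  apply: (@lt_le_trans _ _ (M * (2 * eta))); first by rewrite ltr_pM2l.
  have eta2 : eta <= eps / (2 * M) / 2 by rewrite /eta ge_min lexx orbT.
  apply: (@le_trans _ _ (M * (2 * (eps / (2 * M) / 2)))).
    by rewrite ler_pM2l// ler_pM2l.
  rewrite le_eqVlt; apply/orP; left; apply/eqP; field.
  by rewrite gt_eqF.
have -> : t *: v - e = (t *: v - b' ord0) + (b' ord0 - e) by rewrite addrA subrK.
rewrite (le_lt_trans (ler_normD _ _))// [ltRHS]splitr; apply: ltrD.
  exact: le_lt_trans tv small.
exact: lt_le_trans (bb' ord0) e1c.
Qed.

End Whitney.

(** * The stratification by block ranks *)

Theorem mainTheorem3 (R : realType) (k : nat) (n_ : 'I_k -> nat)
    (hk : (0 < k)%N) (hn : forall i : 'I_k, (0 < n_ i)%N) :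
  [/\ closed (density R n_),
      semialgebraic (density R n_)
    & exists (I : Type) (S : I -> set (sa R n_)),
        semialgebraic_whitney_stratification (density R n_) S].
Proof.
have [N [phi [psi [phiK psiK]]]] := sa_coordinates R n_.
have cD := @closed_density R k n_.
split; first exact: cD.
  exact: semialgebraic_coord phiK psiK (semialg_density psi).
exists {ffun 'I_k -> 'I_(\sum_i n_ i).+1}, (@stratum R k n_); split.
  split; first exact: cD.
  - exact: stratum_decomposition.
  - exact: stratum_submanifold.
  - by move=> r s _; exact: stratum_whitneyB.
by move=> r; exact: (semialgebraic_coord phiK psiK (semialg_stratum psi r)).
Qed.
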